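(* Let $f$ and $g$ be multiplicatively independent non-constant entire functions without zeros. Then for any $\epsilon>0$, $$N_{\gcd}(f-1,g-1,r)\le_{\rm exc}\epsilon\max\{T_f(r),T_g(r)\}.$$
   Context: $f$ and $g$ are multiplicatively independent if $f^ig^j\neq 1$ (as functions) for every $(i,j)\in\mathbb{Z}^2\setminus\{(0,0)\}$. $\le_{\rm exc}$ means that the inequality holds for all $r>0$ outside a set of finite Lebesgue measure, possibly depending on $\epsilon$. For a meromorphic function $f$ on $\mathbb{C}$ put $v_z^+(f)=\max\{0,\mathrm{ord}_z f\}$; let $n_f(\infty,r)$ be the number of poles of $f$ in $|z|\le r$ counted with multiplicity, $N_f(\infty,r)=\int_0^r\frac{n_f(\infty,t)-n_f(\infty,0)}{t}dt+n_f(\infty,0)\log r$, $m_f(\infty,r)=\int_0^{2\pi}\log^+|f(re^{i\theta})|\frac{d\theta}{2\pi}$ with $\log^+x=\max\{0,\log x\}$, and $T_f(r)=m_f(\infty,r)+N_f(\infty,r)$. For meromorphic $f,g$: $n(f,g,r)=\sum_{|z|\le r}\min\{v_z^+(f),v_z^+(g)\}$ and $N_{\gcd}(f,g,r)=\int_0^r\frac{n(f,g,t)-n(f,g,0)}{t}dt+n(f,g,0)\log r$. *)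

(* Defs.v *)
From HB Require Import structures.
From mathcomp Require Import all_boot all_order all_algebra complex.
From mathcomp Require Import all_classical all_reals all_analysis.

Set Implicit Arguments.
Unset Strict Implicit.
Unset Printing Implicit Defensive.

Import Order.TTheory GRing.Theory Num.Theory.
Import numFieldNormedType.Exports.
Import ComplexField.Normc.

Local Open Scope classical_set_scope.
Local Open Scope ring_scope.
Local Open Scope complex_scope.

Section nevanlinna.
Variable R : realType.
Local Notation C := R[i].
Implicit Types (f g h : C -> C) (z : C) (r : R).

(* The scalar field of the normed module C^o is C itself, so derivability in
   the direction 1 is complex differentiability. *)
Definition entire f := forall z, derivable (f : C^o -> C^o) z 1.

Definition holomorphic_near h z :=
  \forall w \near (z : C^o), derivable (h : C^o -> C^o) w 1.

Definition constant_fun f := exists c : C, forall z, f z = c.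

Definition mult_independent f g :=
  forall i j : int, (i, j) != (0, 0) ->
    (fun z => f z ^ i * g z ^ j) <> (fun=> 1).

(* f(w) = (w - z)^k h(w) for w <> z close to z, with h holomorphic near z and
   h(z) <> 0. The value of f at z is irrelevant, so a meromorphic function is
   represented by any total function, with arbitrary values at the poles. *)
Definition has_order f z (k : int) :=
  exists h, [/\ holomorphic_near h z, h z != 0 &
    \forall w \near (z : C^o)^', f w = (w - z) ^ k * h w].

(* Junk value 0 when no order exists, in particular for f identically zero
   near z (where the usual convention is +oo). *)
Definition ord f z : int := xget 0 [set k | has_order f z k].

Definition zero_mult f z : int := Num.max 0 (ord f z).
Definition pole_mult f z : int := Num.max 0 (- ord f z).

Definition closed_disk r : set C := [set z | normc z <= r].

(* For a meromorphic function that is not identically zero the zeros and poles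
   are isolated, so the finitely supported sums below range over all of them. *)
Definition n_poles f r : int := \sum_(z \in closed_disk r) pole_mult f z.

Definition n_gcd f g r : int :=
  \sum_(z \in closed_disk r) Num.min (zero_mult f z) (zero_mult g z).

Definition integrated_counting (n : R -> int) r : R :=
  \int[lebesgue_measure]_(t in `[0, r]) ((n t - n 0)%:~R / t)
  + (n 0)%:~R * ln r.

Definition N_poles f r : R := integrated_counting (n_poles f) r.

Definition N_gcd f g r : R := integrated_counting (n_gcd f g) r.

(* The library has ln 0 = 0, so this also gives log^+ 0 = 0. *)
Definition lnplus (x : R) : R := Num.max 0 (ln x).

Definition expi (t : R) : C := cos t +i* sin t.

Definition proximity f r : R :=
  \int[lebesgue_measure]_(t in `[0, 2 * pi])
    (lnplus (normc (f (r%:C * expi t))) / (2 * pi)).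

Definition characteristic f r : R := proximity f r + N_poles f r.

Definition le_exc (u v : R -> R) :=
  exists E : set R, [/\ measurable E, (lebesgue_measure E < +oo)%E &
    forall r, 0 < r -> ~ E r -> u r <= v r].

End nevanlinna.

(* Main.v *)
Require Import Defs.
From mathcomp Require Import all_boot all_order all_algebra complex perm.
From mathcomp Require Import all_classical all_reals all_analysis.
From mathcomp Require Import ring lra.

(** For exponents 0 <= i, j <= q the functions f^i g^j are zero-free. If no
    nontrivial f^i g^j is constant, Borel's theorem makes them linearly
    independent, so the Wronskian W of the M = q (q + 2) functions f^i g^j - 1,
    (i, j) <> (0, 0), does not vanish identically. At a common zero of f - 1 and
    g - 1 of multiplicity mu each of these functions is divisible by (z - a)^mu,
    hence W by (z - a)^(M mu), and Jensen's inequality bounds M N_gcd(r) by the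
    mean of log |W| over the circle |z| = r, up to a constant. Dividing the
    columns of W by f^i g^j, the logarithmic derivative lemma bounds this mean by
    q (T_f + T_g) plus a small error, because log |f^i g^j| has constant mean.
    The ratio q / M = 1 / (q + 2) is as small as desired. If instead some
    nontrivial f^i g^j is a constant c, then c <> 1 and f - 1, g - 1 have no
    common zero.

    The analysis is done with means over equidistributed points of a circle:
    products of z - a over roots of unity are explicit, which gives Jensen's
    inequality for polynomials and then for entire functions by approximation.
    A zero-free function is written as the exponential of a primitive of its
    logarithmic derivative, and the Taylor coefficients of that logarithm are
    controlled by the characteristic; Borel's growth lemma turns this into the
    logarithmic derivative lemma outside a set of finite measure. *)

Set Implicit Arguments.
Unset Strict Implicit.
Unset Printing Implicit Defensive.

Import Order.TTheory GRing.Theory Num.Theory.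
Import numFieldNormedType.Exports.
Import ComplexField.Normc.

Local Open Scope classical_set_scope.
Local Open Scope ring_scope.
Local Open Scope complex_scope.

Local Notation Re := complex.Re.
Local Notation Im := complex.Im.

(** * Complex derivatives *)

Section complex_basics.
Variable R : realType.
Local Notation C := R[i].
Implicit Types (f g : C -> C) (z w d : C).

(** The ratio q / M comes from the shape of W: the subtracted 1 survives only in the row of order 0,
    because the other rows hold derivatives. After division of the columns by u = f^i g^j, those
    rows are controlled by the logarithmic derivative lemma, while the row of order 0 has entries 1
    - 1/u, of size at most 2 exp (q (log+ |1/f| + log+ |1/g|)). This factor enters the determinant
    once, whereas a common zero is counted M times.

    Only lower bounds for means of log |W| are needed, so Jensen's formula is replaced by an
    inequality. Radii of circles that meet a zero of W form a countable set and go into the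
    exceptional set; on the other circles log |W| is continuous and no singular integral occurs. For
    zero-free functions, equality follows by applying the inequality to the function and to its
    inverse.

    The logarithmic derivative lemma is needed for a whole finite family at the same radius. The
    growth lemma is therefore applied to one common majorant of all the logarithms. The lemma serves
    twice: in Borel's theorem, where it is applied to quotients of the given functions, and in the
    final bound. *)

Lemma normcE' z : `|z| = (normc z)%:C.
Proof. by case: z. Qed.

Lemma normc_ge0 z : 0 <= normc z.
Proof. by case: z => a b; rewrite sqrtr_ge0. Qed.

Lemma normc_eq0 z : (normc z == 0) = (z == 0).
Proof.
apply/eqP/eqP => [/eq0_normc //|->]; exact: normc0.
Qed.

Lemma normc_gt0 z : (0 < normc z) = (z != 0).
Proof. by rewrite lt_def normc_ge0 andbT normc_eq0. Qed.

Lemma normcD z w : normc (z + w) <= normc z + normc w.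
Proof. exact: le_normcD. Qed.

Lemma normcB z w : normc (z - w) <= normc z + normc w.
Proof. by rewrite (le_trans (normcD _ _))// normcN. Qed.

Lemma normc_distC z w : normc (z - w) = normc (w - z).
Proof. by rewrite -normcN opprB. Qed.

Lemma normc_subD z v w : normc (z - w) <= normc (z - v) + normc (v - w).
Proof. by rewrite (le_trans _ (normcD _ _))// addrA subrK. Qed.

Lemma normcX z n : normc (z ^+ n) = normc z ^+ n.
Proof. by elim: n => [|n IH]; rewrite ?expr0 ?normc1// !exprS normcM IH. Qed.

Lemma normc_real (x : R) : normc x%:C = `|x|.
Proof. by rewrite /= expr0n/= addr0 sqrtr_sqr. Qed.

Lemma realC_neq0 (x : R) : 0 < x -> x%:C != 0.
Proof. by move=> x0; rewrite -normc_gt0 normc_real normr_gt0 lt0r_neq0. Qed.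

Lemma normc_sum I (r : seq I) (P : pred I) (F : I -> C) :
  normc (\sum_(i <- r | P i) F i) <= \sum_(i <- r | P i) normc (F i).
Proof.
elim/big_rec2: _ => [|i x y _ h]; first by rewrite normc0.
by rewrite (le_trans (normcD _ _))// lerD2l.
Qed.

Lemma normc_prod I (r : seq I) (P : pred I) (F : I -> C) :
  normc (\prod_(i <- r | P i) F i) = \prod_(i <- r | P i) normc (F i).
Proof.
by elim/big_rec2: _ => [|i x y _ <-]; rewrite ?normc1// normcM.
Qed.

Lemma ReR_le_normc z : `|Re z| <= normc z.
Proof. by have := normc_ge_Re z; rewrite normcE' lecR. Qed.

Lemma ImR_le_normc z : `|Im z| <= normc z.
Proof.
case: z => a b /=; rewrite -[`|b|]sqrtr_sqr ler_sqrt ?addr_ge0 ?sqr_ge0//.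
by rewrite lerDr sqr_ge0.
Qed.

Lemma normc_le_ReIm z : normc z <= `|Re z| + `|Im z|.
Proof.
case: z => a b /=; rewrite -[leRHS]ger0_norm ?addr_ge0// -sqrtr_sqr.
rewrite ler_sqrt ?sqr_ge0// sqrrD !real_normK ?num_real//.
by rewrite addrAC lerDl mulrn_wge0// mulr_ge0.
Qed.

Lemma ler_normc_dist z w : `|normc z - normc w| <= normc (z - w).
Proof.
have h (u v : C) : normc u - normc v <= normc (u - v).
  by rewrite lerBlDr (le_trans _ (normcD _ _))// subrK.
by rewrite ler_norml h lerNl opprB normc_distC h.
Qed.

Lemma normc_small z : (forall e : R, 0 < e -> normc z <= e) -> z = 0.
Proof.
move=> h; apply/eqP; rewrite -normc_eq0; apply/eqP/le_anti; rewrite normc_ge0 andbT.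
by apply/ler_addgt0Pr => e e0; rewrite add0r; exact: h.
Qed.

Lemma eq_ler (x y : R) : x = y -> x <= y.
Proof. by move=> ->. Qed.

(** Balls of [C^o] have radii in [C], and a positive element of [C] is real. Passing to its real
    part turns filter statements into epsilon-delta statements over [R], the form used
    throughout. *)
Lemma nearCP (P : C -> Prop) z :
  (\forall w \near (z : C^o), P w) <->
  exists2 d : R, 0 < d & forall w, normc (w - z) < d -> P w.
Proof.
split.
  move=> /nbhs_ballP[e /= e0 h].
  move: e0; rewrite ltcE /= => /andP[/eqP e2 e1].
  exists (Re e) => // w wd; apply: h; rewrite /ball /= normcE' normc_distC.
  by rewrite ltcE /= e2 eqxx.
move=> [d d0 h]; apply/nbhs_ballP; exists d%:C => /=; first by rewrite ltcR.
move=> w; rewrite /ball /= normcE' ltcR normc_distC; exact: h.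
Qed.

Lemma dnearCP (P : C -> Prop) z :
  (\forall w \near (z : C^o)^', P w) <->
  exists2 d : R, 0 < d & forall w, w != z -> normc (w - z) < d -> P w.
Proof.
split=> [|[d d0 h]].
  rewrite near_withinE => /nearCP[d d0 h]; exists d => // w wz wd; exact: h.
by rewrite near_withinE; apply/nearCP; exists d => // w wd wz; apply: h.
Qed.

(** Complex differentiability as a first-order expansion: no quotient, so h = 0 is no special case,
    and carrying the derivative [d] avoids separate differentiability goals. *)
Definition cdiff f z d := forall e : R, 0 < e -> exists2 t : R, 0 < t &
  forall h, normc h < t -> normc (f (z + h) - f z - d * h) <= e * normc h.

Definition ccont f z := forall e : R, 0 < e -> exists2 t : R, 0 < t &
  forall w, normc (w - z) < t -> normc (f w - f z) < e.

Lemma cdiffE f z d : cdiff f z d <-> is_derive (z : C^o) 1 (f : C^o -> C^o) d.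
Proof.
split=> [hd|[/cvg_ex[l hl] <-]]; last first.
  rewrite /derive (cvg_lim _ hl)// => e e0.
  have /cvgrPdist_lt/(_ e%:C) := hl; rewrite ltcR => /(_ e0).
  move=> /dnearCP[t t0 h]; exists t => // k kt.
  have [->|k0] := eqVneq k 0; first by rewrite addr0 subrr mulr0 subr0 normc0 mulr0.
  have := h k k0; rewrite subr0 => /(_ kt).
  rewrite normcE' ltcR /= => /ltW h1.
  rewrite -[f (z + k) - _ - _](_ : - k * (l - k^-1 *: (f (k *: (1 : C^o) + z) - f z)) = _).
    by rewrite normcM normcN mulrC ler_wpM2r// normc_ge0.
  rewrite /GRing.scale /= mulr1 mulrBr !mulNr mulrA divff// mul1r opprK (addrC k z).
  by rewrite [LHS]addrC; congr (_ - _); exact: mulrC.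
have cv : h^-1 *: ((f : C^o -> C^o) (h *: (1 : C^o) + z) - f z) @[h --> (0 : C^o)^'] --> (d : C^o).
  apply/cvgrPdist_le => /= e.
  rewrite ltcE /= => /andP[/eqP e2 e1].
  have [t t0 h] := hd _ e1.
  apply/dnearCP; exists t => // k k0; rewrite subr0 => /h h1.
  rewrite normcE' lecE /= e2 eqxx /=.
  rewrite -(ler_pM2r (_ : 0 < normc k)) ?normc_gt0// (le_trans _ h1)//.
  rewrite -normcM normc_distC mulrBl /GRing.scale /= mulr1 mulrAC mulVf// mul1r.
  by rewrite (addrC k).
by split; [apply/cvg_ex; exists d|apply/cvg_lim].
Qed.

Lemma derivable_cdiff f z : derivable (f : C^o -> C^o) z 1 <-> exists d, cdiff f z d.
Proof.
split=> [fz|[d /cdiffE[]]//].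
by exists ('D_1 (f : C^o -> C^o) z); apply/cdiffE; exact: derivableP.
Qed.

Lemma cdiff_cont f z d : cdiff f z d -> ccont f z.
Proof.
move=> hd e e0.
have [t t0 h] := hd 1 ltr01.
have K0 : 0 < 1 + normc d by rewrite ltr_wpDr// normc_ge0.
exists (Num.min t (e / (1 + normc d))); first by rewrite lt_min t0 divr_gt0.
move=> w; rewrite lt_min => /andP[/h h1 h2].
rewrite [z + _]addrC subrK in h1.
have -> : f w - f z = (f w - f z - d * (w - z)) + d * (w - z) by rewrite subrK.
rewrite (le_lt_trans (normcD _ _))// normcM.
rewrite (le_lt_trans (lerD h1 (lexx _)))// -mulrDl -ltr_pdivlMl//.
by rewrite mulrC.
Qed.

Lemma cdiff_unique f z d1 d2 : cdiff f z d1 -> cdiff f z d2 -> d1 = d2.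
Proof. by move=> /cdiffE[_ <-] /cdiffE[_ <-]. Qed.

Lemma cdiff_cst (c : C) z : cdiff (fun=> c) z 0.
Proof. by apply/cdiffE; exact: is_derive_cst. Qed.

Lemma cdiff_id z : cdiff id z 1.
Proof. by apply/cdiffE; exact: is_derive_id. Qed.

Lemma cdiffD f g z d1 d2 : cdiff f z d1 -> cdiff g z d2 ->
  cdiff (fun w => f w + g w) z (d1 + d2).
Proof. by move=> /cdiffE h1 /cdiffE h2; apply/cdiffE; exact: is_deriveD. Qed.

Lemma cdiffM f g z d1 d2 : cdiff f z d1 -> cdiff g z d2 ->
  cdiff (fun w => f w * g w) z (d1 * g z + f z * d2).
Proof.
move=> /cdiffE h1 /cdiffE h2; apply/cdiffE.
by rewrite addrC [d1 * _]mulrC; exact: (@is_deriveM C C^o f g z 1 d1 d2).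
Qed.

Lemma cdiffV f z d : f z != 0 -> cdiff f z d ->
  cdiff (fun w => (f w)^-1) z (- d / f z ^+ 2).
Proof.
move=> fz0 /cdiffE[fd <-]; apply/cdiffE; split.
  exact: (@derivableV C C^o f z 1 fz0 fd).
by rewrite (@deriveV C C^o f z 1 fz0 fd) mulrC mulrN -mulNr.
Qed.

Lemma cdiff_shift f (a : C) z d : cdiff f (a + z) d <-> cdiff (fun w => f (a + w)) z d.
Proof. by split=> h e /h[t t0 H]; exists t => // k /H; rewrite addrA. Qed.

Lemma cdiff_ext f g z d : f =1 g -> cdiff f z d -> cdiff g z d.
Proof. by move=> /funext ->. Qed.

Lemma cdiffN f z d : cdiff f z d -> cdiff (fun w => - f w) z (- d).
Proof. by move=> /cdiffE h; apply/cdiffE; exact: is_deriveN. Qed.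

Lemma cdiffB f g z d1 d2 : cdiff f z d1 -> cdiff g z d2 ->
  cdiff (fun w => f w - g w) z (d1 - d2).
Proof. by move=> h1 /cdiffN; apply: cdiffD. Qed.

Lemma cdiffX f z d n : cdiff f z d ->
  cdiff (fun w => f w ^+ n) z (n%:R * f z ^+ n.-1 * d).
Proof.
move=> h; elim: n => [|n IH] /=; first by rewrite mulr0n !mul0r; exact: cdiff_cst.
have -> : n.+1%:R * f z ^+ n * d = d * f z ^+ n + f z * (n%:R * f z ^+ n.-1 * d).
  case: n {IH} => [|n] /=; first by rewrite expr0; ring.
  by rewrite exprS -[n.+2%:R]natr1; ring.
by apply: cdiff_ext (cdiffM h IH) => w; rewrite exprS.
Qed.

Definition holo f := forall z, exists d, cdiff f z d.
(* The value is junk (0) where f is not differentiable. *)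
Definition D f z : C := xget 0 [set d | cdiff f z d].

Lemma DP f z : holo f -> cdiff f z (D f z).
Proof. by move=> /(_ z)[d h]; rewrite /D; case: xgetP => [x _ //|/(_ d)]. Qed.

Lemma D_eq f z d : cdiff f z d -> D f z = d.
Proof.
move=> h; rewrite /D; case: xgetP => [x _ /cdiff_unique|/(_ d)//]; exact.
Qed.

Lemma entireE f : entire f <-> holo f.
Proof. by split=> h z; apply/derivable_cdiff/h. Qed.

(** * Compactness and uniform continuity *)

Lemma square_compact (M : R) :
  compact ([set z : C^o | `|Re z| <= M /\ `|Im z| <= M]).
Proof.
pose F (p : R * R) : C^o := p.1 +i* p.2.
have -> : [set z : C^o | `|Re z| <= M /\ `|Im z| <= M] =
    F @` (`[-M, M] `*` `[-M, M]).
  apply/seteqP; split=> [[a b] /= []|z [[a b] /= [ha hb] <-]] /=.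
    by rewrite !ler_norml => ha hb; exists (a, b) => //=; rewrite !in_itv.
  by move: ha hb; rewrite !in_itv/= -!ler_norml.
apply: continuous_compact; last by apply: compact_setX; exact: segment_compact.
apply: continuous_subspaceT => -[a b]; apply/cvgrPdist_lt => /= e.
rewrite ltcE /= => /andP[/eqP e2 e1].
have e20 : 0 < Re e / 2 by rewrite divr_gt0.
exists (ball a (Re e / 2), ball b (Re e / 2)).
  by split; apply: nbhsx_ballx.
move=> p [/= h1 h2]; rewrite normcE' ltcE /= e2 eqxx /=.
rewrite (le_lt_trans (normc_le_ReIm ((a - p.1) +i* (b - p.2))))//=.
by rewrite [ltRHS]splitr ltrD.
Qed.

Arguments square_compact : clear implicits.

(** Compactness in near-covering form: x within t / 2 of a centre and a radius below t / 2 keep [w]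
    within t of that centre. Only [z] has to lie in the disc, so [w] may leave it. *)
Lemma heine f (M : R) : (forall z, ccont f z) -> forall e : R, 0 < e ->
  exists2 t : R, 0 < t & forall z w, normc z <= M -> normc (w - z) < t ->
    normc (f w - f z) < e.
Proof.
move=> fc e e0.
have e20 : 0 < e / 2 by rewrite divr_gt0.
have /compact_near_coveringP/near_covering_withinP := square_compact M.
move=> /(_ _ (0 : R)^'+ (fun t z => forall w, normc (w - z) < t -> normc (f w - f z) < e)).
case.
  move=> z zM; have [t t0 ht] := fc z _ e20.
  near=> x i => _ w wx.
  have xz : normc (x - z) < t / 2.
    near: x; apply/nearCP; exists (t / 2) => //; by rewrite divr_gt0.
  have it : i < t / 2.
    by near: i; apply: nbhs_right_lt; rewrite divr_gt0.
  have h1 : normc (f x - f z) < e / 2.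
    by apply: ht; rewrite (lt_trans xz)// ltr_pdivrMr// ltr_pMr// ltr1n.
  have h2 : normc (f w - f z) < e / 2.
    apply: ht; rewrite (le_lt_trans (normc_subD _ x _))// [t]splitr.
    by rewrite ltrD// (lt_trans wx).
  rewrite (le_lt_trans (normc_subD _ (f z) _))// [e]splitr ltrD// normc_distC//.
move=> t /= t0 /(_ (t / 2)).
have t20 : 0 < t / 2 by rewrite divr_gt0.
rewrite /ball /= sub0r normrN gtr0_norm// => h.
exists (t / 2) => // z w zM; apply: h => //.
  by rewrite ltr_pdivrMr// ltr_pMr// ltr1n.
by split; rewrite (le_trans _ zM)// ?ReR_le_normc ?ImR_le_normc.
Unshelve. all: by end_near. Qed.

Lemma ccont_bounded f (M : R) : (forall z, ccont f z) ->
  exists K : R, 0 < K /\ forall z, normc z <= M -> normc (f z) <= K.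
Proof.
move=> fc.
have /compact_near_coveringP/near_covering_withinP := square_compact M.
move=> /(_ _ (+oo : set_system R) (fun t z => normc (f z) <= t)).
case.
  move=> z zM; have [t t0 ht] := fc z _ ltr01.
  near=> x i => _.
  have h1 : normc (f x - f z) < 1 by apply: ht; near: x; apply/nearCP; exists t.
  have -> : f x = (f x - f z) + f z by rewrite subrK.
  apply: (le_trans (normcD _ _)); apply: (le_trans (lerD (ltW h1) (lexx _))) => /=.
  near: i; apply: nbhs_pinfty_ge; exact: num_real.
move=> t /= [_ h].
exists (Num.max 1 (t + 1)); split; first by rewrite lt_max ltr01.
move=> z zM; apply: h; first by rewrite lt_max ltrDl ltr01 orbT.
by split; rewrite (le_trans _ zM)// ?ReR_le_normc ?ImR_le_normc.
Unshelve. all: by end_near. Qed.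

(** * Paths in the plane and real integration *)

Definition rccont (p : R -> C) := forall t (e : R), 0 < e ->
  exists2 d : R, 0 < d & forall s, `|s - t| < d -> normc (p s - p t) < e.

Lemma rccont_comp_at f (p : R -> C) : (forall t, ccont f (p t)) -> rccont p ->
  rccont (f \o p).
Proof.
move=> fc pc t e e0; have [d d0 hd] := fc t _ e0.
by have [t' t'0 ht] := pc t _ d0; exists t' => // s /ht /hd.
Qed.

Lemma rccont_comp f p : (forall z, ccont f z) -> rccont p -> rccont (f \o p).
Proof. by move=> fc; apply: rccont_comp_at. Qed.

Lemma rccontE (p : R -> C) (u : R -> R) : rccont p ->
  (forall t s, `|u s - u t| <= normc (p s - p t)) -> continuous u.
Proof.
move=> pc h t; apply/cvgrPdist_lt => e e0.
have [d d0 hd] := pc t _ e0.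
exists d => //= s ts; rewrite distrC; apply: (le_lt_trans (h _ _)).
by apply: hd; rewrite distrC.
Qed.

Lemma rccont_Re (p : R -> C) : rccont p -> continuous (fun t => Re (p t)).
Proof.
move=> pc; apply: (rccontE pc) => t s; rewrite (le_trans _ (ReR_le_normc _))//.
by case: (p t) (p s) => [a b] [c d].
Qed.

Lemma rccont_Im (p : R -> C) : rccont p -> continuous (fun t => Im (p t)).
Proof.
move=> pc; apply: (rccontE pc) => t s; rewrite (le_trans _ (ImR_le_normc _))//.
by case: (p t) (p s) => [a b] [c d].
Qed.

Lemma rccont_normc (p : R -> C) : rccont p -> continuous (fun t => normc (p t)).
Proof. by move=> pc; apply: (rccontE pc) => t s; exact: ler_normc_dist. Qed.

Lemma rccontI (u v : R -> R) : continuous u -> continuous v ->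
  rccont (fun t => u t +i* v t).
Proof.
move=> uc vc t e e0; have e20 : 0 < e / 2 by rewrite divr_gt0.
have [d1 /= d10 h1] := (cvgrPdist_lt _ _).1 (uc t) _ e20.
have [d2 /= d20 h2] := (cvgrPdist_lt _ _).1 (vc t) _ e20.
exists (Num.min d1 d2); first by rewrite lt_min d10.
move=> s; rewrite lt_min => /andP[s1 s2].
rewrite (le_lt_trans (normc_le_ReIm ((u s - u t) +i* (v s - v t))))//=.
rewrite [e]splitr ltrD//.
  by rewrite distrC; apply: h1; rewrite /= distrC.
by rewrite distrC; apply: h2; rewrite /= distrC.
Qed.

(** Reduces to [heine] by viewing [u] as a function of the real part on the plane. *)
Lemma continuous_heine (u : R -> R) (M : R) : continuous u -> forall e : R, 0 < e ->
  exists2 t : R, 0 < t & forall x y, `|x| <= M -> `|y - x| < t -> `|u y - u x| < e.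
Proof.
move=> uc e e0.
have fc z : ccont (fun w : C => (u (Re w))%:C) z.
  move=> d d0; have [t /= t0 h] := (cvgrPdist_lt _ _).1 (uc (Re z)) _ d0.
  exists t => // w wz /=; rewrite subrr expr0n/= addr0 sqrtr_sqr distrC; apply: h => /=.
  rewrite distrC (le_lt_trans _ wz)// (le_trans _ (ReR_le_normc _))//.
  by case: (z) (w) => [a b] [a' b'].
have [t t0 h] := heine M fc e0.
exists t => // x y xM yx; have := h x%:C y%:C.
by rewrite /= subrr expr0n/= !addr0 !sqrtr_sqr; apply.
Qed.

Lemma is_derive_cont (F : R -> R) (x d : R) : is_derive x 1 F d -> {for x, continuous F}.
Proof. by move=> [h _]; apply/differentiable_continuous/derivable1_diffP. Qed.

Lemma primitive_exists (u : R -> R) (a b : R) : continuous u ->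
  exists F : R -> R, forall x, a < x < b -> is_derive x 1 F (u x).
Proof.
move=> uc; exists (fun x => \int[lebesgue_measure]_(t in `[a, x]) u t).
move=> x /andP[ax xb].
have ui : lebesgue_measure.-integrable `[a, b] (EFin \o u).
  by apply: continuous_compact_integrable; [exact: segment_compact|exact: continuous_subspaceT].
have [h1 h2] := continuous_FTC1_closed xb ui ax (uc x).
by split; [exact: h1|rewrite -derive1E; exact: h2].
Qed.

Lemma Rintegral_primitive (u F : R -> R) (a b : R) : a < b -> continuous u ->
  (forall x, x \in `[a, b] -> is_derive x 1 F (u x)) ->
  \int[lebesgue_measure]_(x in `[a, b]) u x = F b - F a.
Proof.
move=> ab uc h; rewrite /Rintegral (@continuous_FTC2 _ u F)//.
- exact: continuous_subspaceT.
- split.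
  + by move=> x /subset_itv_oo_cc /h[].
  + apply: cvg_at_right_filter; apply: is_derive_cont (h a _).
    by rewrite in_itv /= lexx ltW.
  + apply: cvg_at_left_filter; apply: is_derive_cont (h b _).
    by rewrite in_itv /= lexx ltW.
- by move=> x /subset_itv_oo_cc /h[_]; rewrite derive1E.
Qed.

Lemma mvt (F u : R -> R) (a b : R) : a < b ->
  (forall x, a <= x <= b -> is_derive x 1 F (u x)) ->
  exists2 c, a < c < b & F b - F a = u c * (b - a).
Proof.
move=> ab h.
have h1 x : x \in `]a, b[ -> is_derive x 1 F (u x).
  by rewrite in_itv /= => /andP[x0 x1]; apply: h; rewrite !ltW.
have h2 : {within `[a, b], continuous F}.
  apply: derivable_within_continuous => x; rewrite in_itv /= => /h hx.
  by case: hx.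
have [c] := MVT ab h1 h2; rewrite in_itv /= => hc ->.
by exists c.
Qed.

Lemma lt_bound (x : R) : x < (Num.bound x)%:R.
Proof.
rewrite (le_lt_trans (ler_norm _))// (_ : Num.bound x = Num.bound `|x|) ?archi_boundP//.
by rewrite /Num.bound normr_id.
Qed.

Lemma divnS_lt (c t : R) : 0 < t ->
  exists N, forall n, (N <= n)%N -> c / n.+1%:R < t.
Proof.
move=> t0; exists (Num.bound (c / t)) => n hn.
rewrite ltr_pdivrMr ?ltr0n// mulrC -ltr_pdivrMr//.
by rewrite (lt_le_trans (lt_bound _))// ler_nat leqW.
Qed.

(** Level [n] has n + 1 equidistributed nodes, so the division is always legitimate; [node n n.+1]
    is 2 pi and closes the circle. *)
Definition node (n k : nat) : R := 2 * pi * k%:R / n.+1%:R.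
Definition avg (u : R -> R) (n : nat) : R := (\sum_(k < n.+1) u (node n k)) / n.+1%:R.
Definition mean (u : R -> R) : R :=
  (\int[lebesgue_measure]_(t in `[0, 2 * pi]) u t) / (2 * pi).

Lemma twopi_gt0 : 0 < 2 * pi :> R.
Proof. by rewrite mulr_gt0// pi_gt0. Qed.

(** On each subinterval the mean value theorem writes the increment of a primitive as the length
    times a value of [u] at an interior point; uniform continuity compares it with the value at the
    left node. *)
Lemma avg_cvg (u : R -> R) : continuous u -> avg u n @[n --> \oo] --> mean u.
Proof.
move=> uc; have p0 := twopi_gt0.
(* The interval is enlarged so that the primitive is differentiable at both endpoints 0 and 2 pi. *)
have [F hF] := primitive_exists (-1) (2 * pi + 1) uc.
have hF' x : x \in `[0, 2 * pi] -> is_derive x 1 F (u x).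
  rewrite in_itv /= => /andP[x0 x1]; apply: hF.
  by rewrite (lt_le_trans _ x0)//= (le_lt_trans x1)// ltrDl.
rewrite /mean (Rintegral_primitive p0 uc hF').
apply/cvgrPdist_le => /= e e0.
have [t t0 ht] := continuous_heine (2 * pi) uc e0.
have [N hN] := divnS_lt (2 * pi) t0.
exists N => // n /= /hN hn.
have n0 : 0 < n.+1%:R :> R by rewrite ltr0n.
have nd k : node n k.+1 - node n k = 2 * pi / n.+1%:R.
  by rewrite /node -[k.+1%:R]natr1; field; rewrite lt0r_neq0.
have -> : F (2 * pi) - F 0 = \sum_(k < n.+1) (F (node n k.+1) - F (node n k)).
  rewrite -(big_mkord xpredT (fun k => F (node n k.+1) - F (node n k))).
  by rewrite telescope_sumr// /node mulr0 mul0r mulfK// lt0r_neq0.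
have h0 : 0 < 2 * pi / n.+1%:R :> R by rewrite divr_gt0.
have key (k : 'I_n.+1) : `|F (node n k.+1) - F (node n k) - 2 * pi / n.+1%:R * u (node n k)|
    <= 2 * pi / n.+1%:R * e.
  have k0 : 0 <= node n k by rewrite divr_ge0 ?mulr_ge0 ?pi_ge0.
  have k1 : node n k.+1 <= 2 * pi.
    by rewrite ler_pdivrMr// ler_pM2l// ler_nat.
  have kk : node n k < node n k.+1 by rewrite -subr_gt0 nd.
  have [x /andP[x0 x1]|c /andP[c0 c1] ->] := mvt kk (u := u) (F := F).
    by apply: hF'; rewrite in_itv /= (le_trans k0)//= (le_trans x1).
  rewrite nd mulrC -mulrBr normrM gtr0_norm// ler_pM2l// ltW// ht//.
    by rewrite ger0_norm// (le_trans (ltW kk)).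
  by rewrite gtr0_norm ?subr_gt0// (lt_trans _ hn)// -(nd k) ltrD2r.
have -> : (\sum_(k < n.+1) (F (node n k.+1) - F (node n k))) / (2 * pi) - avg u n
  = (\sum_(k < n.+1) (F (node n k.+1) - F (node n k) - 2 * pi / n.+1%:R * u (node n k))) / (2 * pi).
  have aux (q m a b : R) : q != 0 -> m != 0 -> a / q - b / m = (a - q / m * b) / q.
    by move=> q0 m0; field; rewrite q0 m0.
  by rewrite [in RHS]sumrB -mulr_sumr /avg aux// lt0r_neq0.
rewrite normrM (gtr0_norm (_ : 0 < (2 * pi)^-1)) ?invr_gt0// ler_pdivrMr//.
rewrite (le_trans (ler_norm_sum _ _ _))//.
rewrite (le_trans (ler_sum _ (fun i _ => key i)))//.
rewrite sumr_const card_ord -[leLHS]mulr_natr mulrAC divfK ?lt0r_neq0//.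
by rewrite mulrC.
Qed.

End complex_basics.

(** * Goursat's theorem and primitives *)

Section goursat.
Variable R : realType.
Local Notation C := R[i].
Implicit Types (f g : C -> C) (z w d : C).

Definition line (a b : C) (t : R) : C := a + t%:C * (b - a).

Lemma line_rccont a b : rccont (line a b).
Proof.
move=> t e e0; have K0 : 0 < 1 + normc (b - a) by rewrite ltr_wpDr// normc_ge0.
exists (e / (1 + normc (b - a))); first by rewrite divr_gt0.
move=> s st; have -> : line a b s - line a b t = (s - t)%:C * (b - a).
  by rewrite /line rmorphB; ring.
rewrite normcM normc_real; move: st; rewrite ltr_pdivlMr//; apply: le_lt_trans.
by rewrite ler_wpM2l// lerDr.
Qed.

(** The contour integral along the segment; real and imaginary parts are integrated separately
    because the integral used is real-valued. *)
Definition segint f a b : C :=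
  ((\int[lebesgue_measure]_(t in `[0, 1]) Re (f (line a b t))) +i*
   (\int[lebesgue_measure]_(t in `[0, 1]) Im (f (line a b t)))) * (b - a).

Lemma segint_prim f a b (U V : R -> R) : (forall z, ccont f z) ->
  (forall t : R, 0 <= t <= 1 -> is_derive t 1 U (Re (f (line a b t)))) ->
  (forall t : R, 0 <= t <= 1 -> is_derive t 1 V (Im (f (line a b t)))) ->
  segint f a b = ((U 1 - U 0) +i* (V 1 - V 0)) * (b - a).
Proof.
move=> fc hU hV; have pc := rccont_comp fc (line_rccont a b).
rewrite /segint (Rintegral_primitive (F := U))//.
- rewrite (Rintegral_primitive (F := V))//; first exact: (rccont_Im pc).
- exact: (rccont_Re pc).
Qed.

Lemma line_prim f a b : (forall z, ccont f z) -> exists U V : R -> R,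
  (forall t : R, 0 <= t <= 1 -> is_derive t 1 U (Re (f (line a b t)))) /\
  (forall t : R, 0 <= t <= 1 -> is_derive t 1 V (Im (f (line a b t)))).
Proof.
move=> fc; have pc := rccont_comp fc (line_rccont a b).
have [U hU] := primitive_exists (-1) 2 (rccont_Re pc).
have [V hV] := primitive_exists (-1) 2 (rccont_Im pc).
exists U, V; split=> t /andP[t0 t1].
  by apply: hU; lra.
by apply: hV; lra.
Qed.

Lemma is_derive_affine (U : R -> R) (c p q t d : R) : is_derive (p + q * t) 1 U d ->
  is_derive t 1 (fun s => c * U (p + q * s)) (c * q * d).
Proof.
move=> h.
have h1 : is_derive t 1 (fun s : R => p + q * s) q.
  apply: is_derive_eq; rewrite /GRing.scale /=; ring.
have := @is_derive1_comp _ U (fun s : R => p + q * s) t d q h h1.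
move=> h2; have := @is_deriveZ _ _ _ _ c t 1 _ h2.
move=> h3; apply: (is_derive_eq h3).
by rewrite /GRing.scale/=; ring.
Qed.

(** A primitive along a segment, composed with t -> p + q t and rescaled, is a primitive along the
    reparametrized one. The case q = 1/2 gives bisection, q = -1 reversal. *)
Lemma segint_reparam f a b a' b' (p q : R) (U V : R -> R) :
  (forall z, ccont f z) -> q != 0 ->
  (forall t, 0 <= t <= 1 -> 0 <= p + q * t <= 1) ->
  (forall t, line a' b' t = line a b (p + q * t)) ->
  (forall t : R, 0 <= t <= 1 -> is_derive t 1 U (Re (f (line a b t)))) ->
  (forall t : R, 0 <= t <= 1 -> is_derive t 1 V (Im (f (line a b t)))) ->
  segint f a' b' =
    (q^-1 * (U (p + q) - U p) +i* (q^-1 * (V (p + q) - V p))) * (b' - a').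
Proof.
move=> fc q0 hpq hl hU hV.
have H1 (W : R -> R) (w : C -> R) :
    (forall t : R, 0 <= t <= 1 -> is_derive t 1 W (w (line a b t))) ->
    forall t : R, 0 <= t <= 1 ->
    is_derive t 1 (fun s => q^-1 * W (p + q * s)) (w (line a' b' t)).
  move=> h t ht; rewrite hl.
  have := is_derive_affine q^-1 (h _ (hpq _ ht)).
  by rewrite mulVf// mul1r.
rewrite (segint_prim fc (H1 U (fun z => Re (f z)) hU) (H1 V (fun z => Im (f z)) hV)).
by rewrite !mulr1 !mulr0 !addr0 !mulrBr.
Qed.

Lemma segint_mid f a b : (forall z, ccont f z) ->
  segint f a b = segint f a ((a + b) / 2) + segint f ((a + b) / 2) b.
Proof.
move=> fc; have [U [V [hU hV]]] := line_prim a b fc.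
have e1 t : line a ((a + b) / 2) t = line a b (0 + 2^-1 * t).
  by rewrite add0r /line rmorphM fmorphV rmorph_nat; field.
have e2 t : line ((a + b) / 2) b t = line a b (2^-1 + 2^-1 * t).
  by rewrite /line rmorphD rmorphM fmorphV rmorph_nat; field.
rewrite (segint_prim fc hU hV) (segint_reparam fc _ _ e1 hU hV)//; last by move=> t; lra.
rewrite (segint_reparam fc _ _ e2 hU hV)//; last by move=> t; lra.
rewrite add0r (_ : 2^-1 + 2^-1 = 1 :> R); last by lra.
move: (U 1) (U 0) (U _) (V 1) (V 0) (V _) => u1 u0 uh v1 v0 vh.
have -> : (a + b) / 2 - a = 2^-1%:C * (b - a) by rewrite fmorphV rmorph_nat; field.
have -> : b - (a + b) / 2 = 2^-1%:C * (b - a) by rewrite fmorphV rmorph_nat; field.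
rewrite !mulrA -mulrDl; congr (_ * _).
by apply/eqP; rewrite eq_complex /=; apply/andP; split; apply/eqP; field.
Qed.

Lemma segint_rev f a b : (forall z, ccont f z) -> segint f b a = - segint f a b.
Proof.
move=> fc; have [U [V [hU hV]]] := line_prim a b fc.
have e1 t : line b a t = line a b (1 + -1 * t).
  by rewrite /line rmorphD rmorphM rmorphN rmorph1; ring.
rewrite (segint_prim fc hU hV) (segint_reparam fc _ _ e1 hU hV); last 2 first.
- by rewrite oppr_eq0 oner_eq0.
- by move=> t; lra.
rewrite subrr -(opprB b a) mulrN; congr (- (_ * _)).
by apply/eqP; rewrite eq_complex /=; apply/andP; split; apply/eqP; field.
Qed.

(* The subtracted term is the integral of [al + be * z] along the segment. *)
Lemma segint_bound f a b (al be : C) (K : R) : (forall z, ccont f z) ->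
  (forall t : R, 0 <= t <= 1 -> normc (f (line a b t) - al - be * line a b t) <= K) ->
  normc (segint f a b - (al * (b - a) + be * ((b ^+ 2 - a ^+ 2) / 2))) <=
    2 * K * normc (b - a).
Proof.
move=> fc hK; have [U [V [hU hV]]] := line_prim a b fc.
rewrite (segint_prim fc hU hV).
pose c0 := al + be * a; pose c1 := be * (b - a).
have hl t : al + be * line a b t = c0 + t%:C * c1 by rewrite /line /c0 /c1; ring.
have -> : ((U 1 - U 0) +i* (V 1 - V 0)) * (b - a)
   - (al * (b - a) + be * ((b ^+ 2 - a ^+ 2) / 2)) =
   (((U 1 - U 0) +i* (V 1 - V 0)) - (c0 + c1 / 2)) * (b - a).
  by rewrite /c0 /c1; field.
rewrite normcM ler_wpM2r ?normc_ge0// (le_trans (normc_le_ReIm _))//.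
(* The mean value theorem for [W] minus the antiderivative of x + t y. It is used for the real and
   for the imaginary part, whence the factor 2. *)
have H (W w : R -> R) (x y : R) :
    (forall t : R, 0 <= t <= 1 -> is_derive t 1 W (w t)) ->
    (forall t : R, 0 <= t <= 1 -> `|w t - (x + t * y)| <= K) ->
    `|W 1 - W 0 - (x + y / 2)| <= K.
  move=> hW hw.
  have [|c /andP[c0' c1'] hc] := @mvt R (fun t => W t - (x * t + y / 2 * (t * t)))
     (fun t => w t - (x + t * y)) 0 1 ltr01.
    move=> t /hW h; apply: is_derive_eq.
    by rewrite /GRing.scale /=; field.
  move: hc; rewrite !(mulr0, mulr1, subr0, addr0, oppr0) => hc.
  rewrite (_ : W 1 - W 0 - _ = w c - (x + c * y)); last by rewrite -hc; ring.
  by apply: hw; rewrite !ltW.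
rewrite mulr2n mulrDl mul1r lerD//.
  have := H U (fun t => Re (f (line a b t))) (Re c0) (Re c1) hU.
  rewrite (_ : Re (_ - _) = U 1 - U 0 - (Re c0 + Re c1 / 2)); last first.
    by case: (c0) (c1) => [? ?] [? ?]; rewrite /=; field.
  apply=> t /hK; rewrite -addrA -opprD hl; apply: le_trans.
  rewrite (le_trans _ (ReR_le_normc _))//.
  by case: (f _) (c0) (c1) => [? ?] [? ?] [? ?]; rewrite /= mul0r ?subr0 ?addr0.
have := H V (fun t => Im (f (line a b t))) (Im c0) (Im c1) hV.
rewrite (_ : Im (_ - _) = V 1 - V 0 - (Im c0 + Im c1 / 2)); last first.
  by case: (c0) (c1) => [? ?] [? ?]; rewrite /=; field.
apply=> t /hK; rewrite -addrA -opprD hl; apply: le_trans.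
rewrite (le_trans _ (ImR_le_normc _))//.
by case: (f _) (c0) (c1) => [? ?] [? ?] [? ?]; rewrite /= mul0r ?subr0 ?addr0.
Qed.

(** The limit is a cluster point in a compact square; the geometric tail bound then holds for the
    distance to it, with room to spare in the factor 4. *)
Lemma geometric_limit (z : nat -> C) (K : R) : 0 <= K ->
  (forall n, normc (z n.+1 - z n) <= K / 2 ^+ n) ->
  exists l, forall n, normc (z n - l) <= 4 * K / 2 ^+ n.
Proof.
move=> K0 h; have Kn n : 0 <= K / 2 ^+ n by rewrite divr_ge0// exprn_ge0.
have dz n m : normc (z (n + m)%N - z n) <= 2 * K / 2 ^+ n - 2 * K / 2 ^+ (n + m).
  elim: m => [|m IH]; first by rewrite addn0 !subrr normc0.
  rewrite addnS; apply: le_trans (normc_subD _ (z (n + m)%N) _) _.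
  apply: le_trans (lerD (h _) IH) _; apply: eq_ler.
  by rewrite exprS; field; rewrite !expf_neq0.
have {}dz n m : (n <= m)%N -> normc (z m - z n) <= 2 * K / 2 ^+ n.
  move=> nm; have := dz n (m - n)%N; rewrite subnKC// => /le_trans; apply.
  by rewrite gerBl -mulrA mulr_ge0.
have [|l [_ cl]] := @square_compact R (normc (z 0%N) + 2 * K) ((z : nat -> C^o) @ \oo).
  exists 0%N => // m _ /=; have := dz 0%N m isT; rewrite expr0 divr1 => dm.
  have zm : normc (z m) <= normc (z 0%N) + 2 * K.
    by rewrite -[z m](subrK (z 0%N)) addrC (le_trans (normcD _ _))// lerD2l.
  by split; apply: le_trans zm; [exact: ReR_le_normc|exact: ImR_le_normc].
exists l => n; apply/ler_addgt0Pr => e e0.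
have [||w [/= wn wl]] := cl [set w | normc (w - z n) <= 2 * K / 2 ^+ n] [set w | normc (w - l) < e].
- by exists n => // m /=; exact: dz.
- by apply/nearCP; exists e.
have := normc_subD (z n) w l; rewrite (normc_distC (z n) w).
by have := Kn n; move: wn wl; rewrite -!mulrA; lra.
Qed.

Lemma holo_ccont f : holo f -> forall z, ccont f z.
Proof. by move=> h z; have [d /cdiff_cont] := h z. Qed.

Definition triint f (t : C * C * C) : C :=
  segint f t.1.1 t.1.2 + segint f t.1.2 t.2 + segint f t.2 t.1.1.

Definition perim (t : C * C * C) : R :=
  normc (t.1.2 - t.1.1) + normc (t.2 - t.1.2) + normc (t.1.1 - t.2).

(** Bisecting the sides gives four triangles whose inner sides cancel in pairs, so one of them
    carries at least a quarter of the integral. The bound on the first vertex makes the nested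
    triangles converge. *)
Lemma triint_split f t : (forall z, ccont f z) -> exists t' : C * C * C,
  [/\ normc (triint f t) <= 4 * normc (triint f t'), perim t' = perim t / 2 &
      normc (t'.1.1 - t.1.1) <= perim t].
Proof.
move=> fc; case: t => [[a b] c].
pose mab : C := (a + b) / 2; pose mbc : C := (b + c) / 2; pose mca : C := (c + a) / 2.
pose t1 : C * C * C := (a, mab, mca); pose t2 : C * C * C := (mab, b, mbc).
pose t3 : C * C * C := (mca, mbc, c); pose t4 : C * C * C := (mab, mbc, mca).
have rv u v : segint f u v = - segint f v u by rewrite segint_rev.
have E : triint f (a, b, c) = triint f t1 + triint f t2 + triint f t3 + triint f t4.
  rewrite /triint /= (segint_mid a b)// (segint_mid b c)// (segint_mid c a)//.
  rewrite -/mab -/mbc -/mca (rv mab mca) (rv mbc mab) (rv mca mbc); ring.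
have half (u : C) : normc (u / 2) = normc u / 2.
  by rewrite normcM normcV (_ : 2 = (2 : R)%:C) ?normc_real ?ger0_norm// rmorph_nat.
have P : [/\ perim t1 = perim (a, b, c) / 2, perim t2 = perim (a, b, c) / 2,
   perim t3 = perim (a, b, c) / 2 & perim t4 = perim (a, b, c) / 2].
  have e1 : mab - a = (b - a) / 2 by rewrite /mab; field.
  have e2 : mca - mab = (c - b) / 2 by rewrite /mab /mca; field.
  have e3 : a - mca = (a - c) / 2 by rewrite /mab /mca; field.
  have e4 : b - mab = (b - a) / 2 by rewrite /mab; field.
  have e5 : mbc - b = (c - b) / 2 by rewrite /mab /mbc; field.
  have e6 : mab - mbc = (a - c) / 2 by rewrite /mab /mbc; field.
  have e7 : mbc - mca = (b - a) / 2 by rewrite /mbc /mca; field.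
  have e8 : c - mbc = (c - b) / 2 by rewrite /mbc; field.
  have e9 : mca - c = (a - c) / 2 by rewrite /mca; field.
  have f1 : normc (mbc - mab) = normc (a - c) / 2 by rewrite (normc_distC mbc mab) e6 half.
  have f2 : normc (mca - mbc) = normc (b - a) / 2 by rewrite (normc_distC mca mbc) e7 half.
  have f3 : normc (mab - mca) = normc (c - b) / 2 by rewrite (normc_distC mab mca) e2 half.
  by split; rewrite /perim /= ?e1 ?e2 ?e3 ?e4 ?e5 ?e6 ?e7 ?e8 ?e9 ?f1 ?f2 ?f3 ?half; field.
case: P => P1 P2 P3 P4.
have n1 := normc_ge0 (b - a); have n2 := normc_ge0 (c - b); have n3 := normc_ge0 (a - c).
have D1 : normc (mab - a) <= perim (a, b, c).
  by rewrite (_ : mab - a = (b - a) / 2) ?half /perim /=; [lra|rewrite /mab; field].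
have D2 : normc (mca - a) <= perim (a, b, c).
  by rewrite (normc_distC mca a) (_ : a - mca = (a - c) / 2) ?half /perim /=; [lra|rewrite /mca; field].
have D0 : normc (a - a) <= perim (a, b, c).
  by rewrite subrr normc0 /perim /=; lra.
have S := le_trans (normcD (triint f t1 + triint f t2 + triint f t3) (triint f t4))
  (lerD (le_trans (normcD _ _) (lerD (normcD _ _) (lexx _))) (lexx _)).
rewrite -E in S.
have [L1|L1] := leP (normc (triint f (a, b, c))) (4 * normc (triint f t1)).
  by exists t1.
have [L2|L2] := leP (normc (triint f (a, b, c))) (4 * normc (triint f t2)).
  by exists t2.
have [L3|L3] := leP (normc (triint f (a, b, c))) (4 * normc (triint f t3)).
  by exists t3.
exists t4; split => //; by lra.
Qed.

(** The exact integrals of an affine function over the three sides add up to zero, so only the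
    deviation of [f] from it contributes. *)
Lemma triint_small f t (z al be : C) (r e : R) : (forall z, ccont f z) ->
  0 <= e ->
  normc (t.1.1 - z) <= r ->
  (forall w, normc (w - z) <= r + perim t -> normc (f w - al - be * w) <= e) ->
  normc (triint f t) <= 2 * e * perim t.
Proof.
move=> fc e0; case: t => [[a b] c] /= az h.
have n1 := normc_ge0 (b - a); have n2 := normc_ge0 (c - b); have n3 := normc_ge0 (a - c).
have hl x y (t : R) : normc (x - a) + normc (y - x) <= perim (a, b, c) -> 0 <= t <= 1 ->
    normc (f (line x y t) - al - be * line x y t) <= e.
  move=> hx /andP[t0 t1]; apply: h.
  rewrite (le_trans (normc_subD _ a _))// addrC lerD// (le_trans _ hx)//.
  have -> : line x y t - a = (x - a) + t%:C * (y - x) by rewrite /line; ring.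
  rewrite (le_trans (normcD _ _))// lerD2l normcM normc_real ger0_norm//.
  by rewrite ler_piMl// normc_ge0.
have b1 := segint_bound fc (hl a b ^~ _).
have b2 := segint_bound fc (hl b c ^~ _).
have b3 := segint_bound fc (hl c a ^~ _).
have {}b1 : normc (segint f a b - (al * (b - a) + be * ((b ^+ 2 - a ^+ 2) / 2))) <=
    2 * e * normc (b - a).
  by apply: b1; rewrite subrr normc0 /perim /=; lra.
have {}b2 : normc (segint f b c - (al * (c - b) + be * ((c ^+ 2 - b ^+ 2) / 2))) <=
    2 * e * normc (c - b).
  by apply: b2; rewrite /perim /=; lra.
have {}b3 : normc (segint f c a - (al * (a - c) + be * ((a ^+ 2 - c ^+ 2) / 2))) <=
    2 * e * normc (a - c).
  by apply: b3; have := normc_subD c b a; rewrite /perim /=; lra.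
rewrite /triint /perim /=.
set s1 := segint f a b in b1 *; set s2 := segint f b c in b2 *; set s3 := segint f c a in b3 *.
have -> : s1 + s2 + s3 =
  (s1 - (al * (b - a) + be * ((b ^+ 2 - a ^+ 2) / 2))) +
  (s2 - (al * (c - b) + be * ((c ^+ 2 - b ^+ 2) / 2))) +
  (s3 - (al * (a - c) + be * ((a ^+ 2 - c ^+ 2) / 2))) by field.
apply: le_trans (normcD _ _) _; rewrite [leRHS]mulrDr; apply: lerD => //.
by apply: le_trans (normcD _ _) _; rewrite [leRHS]mulrDr; exact: lerD.
Qed.

Lemma goursat f t : holo f -> triint f t = 0.
Proof.
move=> fh; have fc := holo_ccont fh.
have [next hnext] := choice (fun t => triint_split t fc).
pose tt n := iter n next t.
have pn n : perim (tt n) = perim t / 2 ^+ n.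
  elim: n => [|n IH]; first by rewrite expr0 divr1.
  have [_ h _] := hnext (tt n).
  by rewrite /tt iterS -/(tt n) h IH exprS invfM; ring.
have tn n : normc (triint f t) <= 4 ^+ n * normc (triint f (tt n)).
  elim: n => [|n IH]; first by rewrite expr0 mul1r.
  have [h _ _] := hnext (tt n).
  rewrite (le_trans IH)// exprSr -mulrA ler_pM2l ?exprn_gt0//.
have p0 : 0 <= perim t by rewrite /perim !addr_ge0 ?normc_ge0.
have [z hz] : exists l, forall n, normc ((tt n).1.1 - l) <= 4 * perim t / 2 ^+ n.
  apply: geometric_limit => // n; have [_ _ h] := hnext (tt n).
  by rewrite -pn.
have [d hd] := fh z.
apply: normc_small => e e0.
(* The n-th triangle lies within 5 perim / 2^n of [z]; with precision e / K there, the factor 4^n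
   cancels and the final bound is e times 10 perim^2 / K = (K - 1) / K. *)
pose K := 1 + 10 * perim t ^+ 2.
have K0 : 0 < K by rewrite ltr_pwDl// mulr_ge0// sqr_ge0.
have eK : 0 < e / K by rewrite divr_gt0.
have [s s0 hs] := hd _ eK.
have [n hn] : exists n, 5 * perim t / 2 ^+ n < s.
  have [N hN] := divnS_lt (5 * perim t) s0.
  exists N; apply: le_lt_trans (hN _ (leqnn _)).
  rewrite ler_wpM2l ?mulr_ge0// lef_pV2 ?posrE ?ltr0n ?exprn_gt0//.
  by rewrite -natrX ler_nat ltn_expl.
have q0 : 0 < (2 ^+ n)^-1 :> R by rewrite invr_gt0 exprn_gt0.
apply: le_trans (tn n) _.
have := @triint_small f (tt n) z (f z - d * z) d (4 * perim t / 2 ^+ n)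
  (e / K * (5 * perim t / 2 ^+ n)) fc.
rewrite pn => H.
have {}H : normc (triint f (tt n)) <= 2 * (e / K * (5 * perim t / 2 ^+ n)) * (perim t / 2 ^+ n).
  apply: H => //.
    by apply: mulr_ge0; [exact: ltW|apply: mulr_ge0; [exact: mulr_ge0|exact: ltW]].
  move=> w; rewrite -mulrDl (_ : 4 * perim t + perim t = 5 * perim t); last by ring.
  move=> hw; have := hs (w - z) (le_lt_trans hw hn).
  rewrite [z + _]addrC subrK => h1.
  rewrite (_ : f w - _ - _ = f w - f z - d * (w - z)); last by ring.
  by rewrite (le_trans h1)// ler_pM2l.
apply: le_trans (_ : 4 ^+ n * (2 * (e / K * (5 * perim t / 2 ^+ n)) * (perim t / 2 ^+ n)) <= _).
  by rewrite ler_pM2l// exprn_gt0.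
have -> : 4 ^+ n * (2 * (e / K * (5 * perim t / 2 ^+ n)) * (perim t / 2 ^+ n)) =
  e * ((K - 1) / K).
  have -> : 4 = 2 ^+ 2 :> R by rewrite expr2; ring.
  have h2 : 2 ^+ n != 0 :> R by rewrite expf_neq0.
  rewrite -exprM mulnC exprM expr2 /K; field.
  by rewrite h2 lt0r_neq0.
by rewrite ler_piMr ?ltW// ltr_pdivrMr// mul1r; lra.
Qed.

(** Integrate along segments from 0. Goursat's theorem on the triangle 0, z, z + h reduces the
    increment to the integral over the short side, where [f] is nearly constant. *)
Lemma holo_primitive f : holo f -> exists F, forall z, cdiff F z (f z).
Proof.
move=> fh; have fc := holo_ccont fh; exists (segint f 0) => z e e0.
have e2 : 0 < e / 2 by rewrite divr_gt0.
have [t t0 ht] := fc z _ e2.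
exists t => // h hh.
have := goursat (0, z, z + h) fh; rewrite /triint /= (segint_rev 0 (z + h))// => E.
have -> : segint f 0 (z + h) - segint f 0 z = segint f z (z + h).
  by move/eqP: E; rewrite subr_eq0 => /eqP <-; rewrite addrAC subrr add0r.
have := @segint_bound f z (z + h) (f z) 0 (e / 2) fc.
rewrite (addrC z) addrK mul0r addr0 (_ : 2 * (e / 2) = e); last by field.
apply=> s /andP[s0 s1]; rewrite mul0r subr0 ltW// ht//.
rewrite /line addrK (addrC z) addrK normcM normc_real ger0_norm//.
by rewrite (le_lt_trans _ hh)// ler_piMl// normc_ge0.
Qed.

Lemma cdiff_affine F (a b s d : C) : cdiff F (a + b * s) d ->
  cdiff (fun w => F (a + b * w)) s (d * b).
Proof.
move=> h e e0; have K0 : 0 < 1 + normc b by rewrite ltr_wpDr// normc_ge0.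
have eK : 0 < e / (1 + normc b) by rewrite divr_gt0.
have [t t0 ht] := h _ eK.
exists (t / (1 + normc b)); first by rewrite divr_gt0.
move=> k; rewrite ltr_pdivlMr// => kt.
have bk : normc (b * k) <= normc k * (1 + normc b).
  by rewrite normcM mulrC ler_wpM2l ?normc_ge0// lerDr.
have := ht (b * k) (le_lt_trans bk kt).
rewrite (_ : a + b * (s + k) = a + b * s + b * k); last by ring.
rewrite mulrA => /le_trans; apply.
by rewrite mulrAC ler_pdivrMr// -mulrA ler_pM2l.
Qed.

Lemma cdiff_sum I (r : seq I) (P : pred I) (F : I -> C -> C) z (d : I -> C) :
  (forall i, P i -> cdiff (F i) z (d i)) ->
  cdiff (fun w => \sum_(i <- r | P i) F i w) z (\sum_(i <- r | P i) d i).
Proof.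
move=> h; elim: r => [|i r IH].
  by rewrite big_nil; apply: cdiff_ext (cdiff_cst 0 z) => w; rewrite big_nil.
rewrite big_cons; case: ifP => Pi.
  apply: cdiff_ext (cdiffD (h i Pi) IH) => w; by rewrite big_cons Pi.
by apply: cdiff_ext IH => w; rewrite big_cons Pi.
Qed.

Lemma cdiffZ (c : C) f z d : cdiff f z d -> cdiff (fun w => c * f w) z (c * d).
Proof.
by move=> h; have := cdiffM (cdiff_cst c z) h; rewrite mul0r add0r.
Qed.

Lemma is_deriveP (u : R -> R) (t d : R) :
  (forall e : R, 0 < e -> exists2 s : R, 0 < s & forall h, `|h| < s ->
     `|u (t + h) - u t - d * h| <= e * `|h|) -> is_derive t 1 u d.
Proof.
move=> H.
have cv : h^-1 *: (u (h *: (1:R) + t) - u t) @[h --> (0:R)^'] --> d.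
  apply/cvgrPdist_le => e e0; have [s s0 hs] := H _ e0.
  near=> h.
  have h0 : h != 0 by near: h; exact: nbhs_dnbhs_neq.
  have := hs h; rewrite (addrC t) => hs'.
  have hp : 0 < `|h| by rewrite normr_gt0.
  rewrite -(ler_pM2r hp) -normrM -normrN -mulNr opprB mulrBl.
  rewrite /GRing.scale /= mulr1 mulrAC mulVf// mul1r; apply: hs'.
  near: h; exact: dnbhs0_lt.
split; first by apply/cvg_ex; exists d.
by rewrite /derive; apply/cvg_lim.
Unshelve. all: by end_near. Qed.

Lemma cdiff_is_derive_Re f (t : R) d : cdiff f t%:C d ->
  is_derive t 1 (fun s : R => Re (f s%:C)) (Re d).
Proof.
move=> h; apply: is_deriveP => e /h[s s0 hs]; exists s => // k ks.
have := hs k%:C; rewrite normc_real => /(_ ks); apply: le_trans.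
rewrite (le_trans _ (ReR_le_normc _))// -rmorphD.
by case: (f _) (f _) (d) => [? ?] [? ?] [? ?]; rewrite /= mulr0 subr0.
Qed.

Lemma cdiff_is_derive_Im f (t : R) d : cdiff f t%:C d ->
  is_derive t 1 (fun s : R => Im (f s%:C)) (Im d).
Proof.
move=> h; apply: is_deriveP => e /h[s s0 hs]; exists s => // k ks.
have := hs k%:C; rewrite normc_real => /(_ ks); apply: le_trans.
rewrite (le_trans _ (ImR_le_normc _))// -rmorphD.
by case: (f _) (f _) (d) => [? ?] [? ?] [? ?]; rewrite /= mulr0 add0r.
Qed.

Lemma cdiff_mvt f (d : C -> C) (K : R) :
  (forall s : R, 0 <= s <= 1 -> cdiff f s%:C (d s%:C)) ->
  (forall s : R, 0 < s <= 1 -> normc (d s%:C) <= K) ->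
  normc (f 1 - f 0) <= 2 * K.
Proof.
move=> fd dK.
have [|x /andP[x0 x1] hx] := @mvt R (fun s => Re (f s%:C)) (fun s => Re (d s%:C)) 0 1 ltr01.
  by move=> x /fd /cdiff_is_derive_Re.
have [|y /andP[y0 y1] hy] := @mvt R (fun s => Im (f s%:C)) (fun s => Im (d s%:C)) 0 1 ltr01.
  by move=> y /fd /cdiff_is_derive_Im.
rewrite (le_trans (normc_le_ReIm _))// mulr2n mulrDl mul1r.
apply: lerD.
  rewrite (_ : Re _ = Re (d x%:C)).
    by rewrite (le_trans (ReR_le_normc _))// dK// x0 ltW.
  by move: hx; rewrite subr0 mulr1 => <-; case: (f 1) (f 0) => ? ? [].
rewrite (_ : Im _ = Im (d y%:C)).
  by rewrite (le_trans (ImR_le_normc _))// dK// y0 ltW.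
by move: hy; rewrite subr0 mulr1 => <-; case: (f 1) (f 0) => ? ? [].
Qed.

Definition clim (u : nat -> C) (l : C) := forall e : R, 0 < e ->
  exists N, forall n, (N <= n)%N -> normc (u n - l) <= e.

Lemma climD u v l m : clim u l -> clim v m -> clim (fun n => u n + v n) (l + m).
Proof.
move=> h1 h2 e e0; have e2 : 0 < e / 2 by rewrite divr_gt0.
have [N1 H1] := h1 _ e2; have [N2 H2] := h2 _ e2.
exists (maxn N1 N2) => n; rewrite geq_max => /andP[n1 n2].
rewrite (_ : u n + v n - _ = (u n - l) + (v n - m)); last by ring.
by rewrite (le_trans (normcD _ _))// [e]splitr lerD ?H1 ?H2.
Qed.

Lemma climZ u l (c : C) : clim u l -> clim (fun n => c * u n) (c * l).
Proof.
move=> h e e0; have K0 : 0 < 1 + normc c by rewrite ltr_wpDr// normc_ge0.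
have eK : 0 < e / (1 + normc c) by rewrite divr_gt0.
have [N H] := h _ eK; exists N => n /H; rewrite ler_pdivlMr// -mulrBr normcM.
apply: le_trans; rewrite mulrC ler_wpM2l ?normc_ge0// lerDr//.
Qed.

Lemma clim_cst (c : C) : clim (fun=> c) c.
Proof. by move=> e e0; exists 0%N => n _; rewrite subrr normc0 ltW. Qed.

Lemma clim_sum n (u : nat -> nat -> C) (l : nat -> C) :
  (forall i, clim (u i) (l i)) ->
  clim (fun k => \sum_(i < n) u i k) (\sum_(i < n) l i).
Proof.
move=> h; elim: n => [|n IH].
  by rewrite big_ord0 (_ : (fun _ => _) = fun=> 0);
    [exact: clim_cst|apply/funext => k; rewrite big_ord0].
rewrite big_ord_recr/= (_ : (fun _ => _) = fun k => \sum_(i < n) u i k + u n k).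
  exact: climD.
by apply/funext => k; rewrite big_ord_recr.
Qed.

Lemma clim_le u l (B : R) : clim u l -> (forall n, normc (u n) <= B) -> normc l <= B.
Proof.
move=> h hB; apply/ler_addgt0Pr => e e0; have [N H] := h _ e0.
have -> : l = u N - (u N - l) by ring.
by rewrite (le_trans (normcB _ _))// lerD// H.
Qed.

End goursat.

(** * Means over circles *)

Section circle_means.
Variable R : realType.
Local Notation C := R[i].
Local Notation expi := (@expi R).
Implicit Types (f g : C -> C) (z w d : C).

Lemma expiD (s t : R) : expi (s + t) = expi s * expi t.
Proof. by rewrite /expi cosD sinD; simpc; congr (_ +i* _); rewrite addrC. Qed.

Lemma expi0 : expi 0 = 1.
Proof. by rewrite /expi cos0 sin0. Qed.

Lemma normc_expi (t : R) : normc (expi t) = 1.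
Proof. by rewrite /= cos2Dsin2 sqrtr1. Qed.

Lemma expi_neq0 (t : R) : expi t != 0.
Proof. by rewrite -normc_gt0 normc_expi. Qed.

Lemma expiX (t : R) n : expi (t * n%:R) = expi t ^+ n.
Proof.
elim: n => [|n IH]; first by rewrite mulr0 expi0 expr0.
by rewrite -natr1 mulrDr mulr1 expiD IH exprSr.
Qed.

Lemma expi_2pi : expi (2 * pi) = 1.
Proof.
rewrite mulrDl mul1r expiD /expi cospi sinpi; by simpc.
Qed.

(** Because cos t = 1 - 2 sin^2 (t / 2), and the sine is positive on the open interval from 0 to
    pi. *)
Lemma expi_eq1 (t : R) : 0 < t < 2 * pi -> expi t != 1.
Proof.
move=> /andP[t0 t1]; apply/eqP => -[hc _].
have h2 : 0 < sin (t / 2).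
  by apply: sin_gt0_pi; rewrite divr_gt0//= ltr_pdivrMr// mulrC.
move: hc; have {1}-> : t = t / 2 + t / 2 by rewrite -splitr.
rewrite cosD -!expr2 cos2sin2 => /eqP.
rewrite -subr_eq0 (_ : _ - 1 = - (2 * sin (t / 2) ^+ 2)); last by ring.
by rewrite oppr_eq0 mulf_eq0 pnatr_eq0 /= expf_eq0 /= gt_eqF.
Qed.

Definition omega n : C := expi (node R n 1).

Lemma expi_node n k : expi (node R n k) = omega n ^+ k.
Proof.
by rewrite /omega -expiX /node; congr (expi _); rewrite mulr1 mulrAC.
Qed.

Lemma omega_prim n : n.+1.-primitive_root (omega n).
Proof.
have n0 : n.+1%:R != 0 :> R by rewrite pnatr_eq0.
apply/andP; split => //; apply/forallP => i; apply/eqP.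
rewrite unity_rootE -expi_node.
have [ein|nin] := eqVneq i.+1 n.+1.
  by rewrite ein /node -mulrA divff// mulr1 expi_2pi eqxx.
have ltin : (i.+1 < n.+1)%N by rewrite ltn_neqAle nin ltn_ord.
apply/negbTE/expi_eq1; rewrite /node divr_gt0 ?ltr0n// ?mulr_gt0 ?pi_gt0//=.
  by rewrite ltr_pdivrMr ?ltr0n// ltr_pM2l ?mulr_gt0 ?pi_gt0// ltr_nat.
Qed.

Lemma omega_neq0 n : omega n != 0.
Proof. exact: expi_neq0. Qed.

Lemma omegaX n : omega n ^+ n.+1 = 1.
Proof. exact: prim_expr_order (omega_prim n). Qed.

Lemma sum_root_unity n (x : C) : x ^+ n.+1 = 1 -> x != 1 ->
  \sum_(j < n.+1) x ^+ j = 0.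
Proof.
move=> x1 xn1; apply/eqP; have := subrX1 x n.+1.
rewrite x1 subrr => /esym/eqP; rewrite mulf_eq0 subr_eq0 (negbTE xn1) //.
Qed.

Definition cavg (p : R -> C) n : C := (\sum_(k < n.+1) p (node R n k)) / n.+1%:R.
Definition cmean (p : R -> C) : C :=
  mean (fun t => Re (p t)) +i* mean (fun t => Im (p t)).

Lemma natr_complex n : n%:R = (n%:R : R)%:C :> C.
Proof. by rewrite rmorph_nat. Qed.

Lemma sum_ReIm I (r : seq I) (P : pred I) (F : I -> C) :
  \sum_(i <- r | P i) F i =
  (\sum_(i <- r | P i) Re (F i)) +i* (\sum_(i <- r | P i) Im (F i)).
Proof.
elim/big_rec3: _ => // i x y z _ ->.
by case: (F i).
Qed.

Lemma cavgE p n : cavg p n = avg (fun t => Re (p t)) n +i* avg (fun t => Im (p t)) n.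
Proof.
rewrite /cavg /avg natr_complex -fmorphV sum_ReIm.
by apply/eqP; rewrite eq_complex /= !mulr0 subr0 add0r !eqxx.
Qed.

Lemma cavg_clim p : rccont p -> clim (cavg p) (cmean p).
Proof.
move=> pc e e0; have e2 : 0 < e / 2 by rewrite divr_gt0.
have [N1 _ H1] := (cvgrPdist_le _ _).1 (avg_cvg (rccont_Re pc)) _ e2.
have [N2 _ H2] := (cvgrPdist_le _ _).1 (avg_cvg (rccont_Im pc)) _ e2.
exists (maxn N1 N2) => n; rewrite geq_max => /andP[/H1 /= n1 /H2 /= n2].
rewrite cavgE normc_distC (le_trans (normc_le_ReIm _))//= [e]splitr.
exact: lerD.
Qed.

Lemma cavg_le p (B : R) n : (forall t, normc (p t) <= B) -> normc (cavg p n) <= B.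
Proof.
move=> h; rewrite /cavg normcM normcV natr_complex normc_real ger0_norm//.
rewrite ler_pdivrMr ?ltr0n// (le_trans (normc_sum _ _ _))//.
rewrite (le_trans (ler_sum _ (fun i _ => h _)))//.
by rewrite sumr_const card_ord mulr_natr.
Qed.

(** Discrete orthogonality: it is exact, without any limit, as soon as both exponents lie below the
    number n + 1 of nodes. *)
Lemma cavg_expi n k l : (k <= n)%N -> (l <= n)%N ->
  cavg (fun t => expi t ^+ k / expi t ^+ l) n = (k == l)%:R.
Proof.
move=> kn ln; rewrite /cavg.
under eq_bigr do rewrite expi_node -!exprM ![(_ * k)%N]mulnC ![(_ * l)%N]mulnC !exprM -expr_div_n.
have w0 := omega_neq0 n.
have [->|kl] := eqVneq k l.
  rewrite divff ?expf_neq0//; under eq_bigr do rewrite expr1n.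
  by rewrite sumr_const card_ord divff// pnatr_eq0.
rewrite sum_root_unity ?mul0r//.
  by rewrite expr_div_n -!exprM ![(_ * n.+1)%N]mulnC !exprM omegaX !expr1n divr1.
apply/eqP => h.
have /eqP : omega n ^+ k = omega n ^+ l.
  by rewrite -[LHS](divfK (expf_neq0 l w0)) h mul1r.
rewrite (eq_prim_root_expr (omega_prim n)) !modn_small// (negbTE kl)//.
Qed.

Lemma expi_rccont : rccont expi.
Proof. by apply: rccontI; [exact: continuous_cos|exact: continuous_sin]. Qed.

Definition circ (r t : R) : C := r%:C * expi t.

Lemma normc_circ r t : 0 <= r -> normc (circ r t) = r.
Proof. by move=> r0; rewrite normcM normc_expi mulr1 normc_real ger0_norm. Qed.

Lemma circ_sub_ge r z t : 0 <= r -> r - normc z <= normc (circ r t - z).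
Proof.
move=> r0; rewrite -{1}(normc_circ t r0).
exact: le_trans (ler_norm _) (ler_normc_dist _ _).
Qed.

Lemma circ_rccont r : rccont (circ r).
Proof.
have := rccont_comp (f := fun z => r%:C * z) _ expi_rccont; apply => z.
exact: cdiff_cont (cdiffZ r%:C (cdiff_id z)).
Qed.

End circle_means.

(** * Cauchy's formula as a limit of averages over nodes *)

Section cauchy_coefficients.
Variable R : realType.
Local Notation C := R[i].
Local Notation expi := (@expi R).
Implicit Types (f g : C -> C) (z w d : C).

Lemma expr_small (x e : R) : 0 <= x < 1 -> 0 < e ->
  exists N, forall n, (N <= n)%N -> x ^+ n <= e.
Proof.
move=> /andP[x0 x1] e0.
have /cvgrPdist_le/(_ _ e0) := @cvg_expr _ x (ltac:(by rewrite ger0_norm)).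
move=> [N _ h]; exists N => n /h /=.
by rewrite sub0r normrN ger0_norm// exprn_ge0.
Qed.

Lemma unif_diff F f (r e : R) : (forall w, cdiff F w (f w)) ->
  (forall w, ccont f w) -> 0 < e ->
  exists2 t : R, 0 < t & forall w h, normc w <= r -> normc h < t ->
    normc (F (w + h) - F w - f w * h) <= e * normc h.
Proof.
move=> Fd fc e0; have e20 : 0 < e / 2 by rewrite divr_gt0.
have [t t0 ht] := heine r fc e20.
exists t => // w h wr hh.
have := @cdiff_mvt _ (fun s => F (w + h * s) - f w * h * s)
   (fun s => f (w + h * s) * h - f w * h * 1) (e / 2 * normc h).
rewrite !mulr1 !mulr0 subr0 addr0 (_ : 2 * (_ * _) = e * normc h); last by field.
rewrite (_ : F (w + h) - f w * h - F w = F (w + h) - F w - f w * h); last by ring.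
apply.
  move=> s hs; apply: cdiffB.
    by apply: cdiff_affine; exact: Fd.
  have := cdiffZ (f w * h) (cdiff_id s%:C).
  by rewrite mulr1.
move=> s /andP[s0 s1]; rewrite -mulrBl normcM ler_wpM2r ?normc_ge0// ltW//.
apply: ht => //; rewrite addrAC subrr add0r normcM normc_real gtr0_norm//.
by rewrite (le_lt_trans _ hh)// ler_piMr// normc_ge0.
Qed.

(** At a node c one has c^(n+1) = r^(n+1), so the factor is 1 - (z/c)^(n+1), and its product with c
    / (c - z) is a finite geometric sum in z/c whose positive powers average to zero. *)
Lemma cavg_geom (r : R) z n : 0 < r -> normc z < r ->
  cavg (fun t => circ r t / (circ r t - z)) n * (1 - (z / r%:C) ^+ n.+1) = 1.
Proof.
move=> r0 zr.
have rC0 : r%:C != 0 by exact: realC_neq0.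
have c0 t : circ r t != 0 by rewrite -normc_gt0 normc_circ ?(ltW r0).
have cz t : circ r t - z != 0.
  by rewrite -normc_gt0 (lt_le_trans _ (circ_sub_ge z t (ltW r0)))// subr_gt0.
rewrite /cavg mulrAC mulr_suml.
have E (j : 'I_n.+1) : circ r (node R n j) / (circ r (node R n j) - z) *
     (1 - (z / r%:C) ^+ n.+1) =
    \sum_(k < n.+1) (z / r%:C) ^+ k * (expi (node R n j) ^+ 0 / expi (node R n j) ^+ k).
  set c := circ r _.
  have -> : (z / r%:C) ^+ n.+1 = (z / c) ^+ n.+1.
    rewrite /c /circ !expr_div_n exprMn expi_node -exprM mulnC exprM omegaX expr1n.
    by rewrite mulr1.
  have -> : c / (c - z) * (1 - (z / c) ^+ n.+1) =
     c / (c - z) * (1 - z / c) * \sum_(k < n.+1) (z / c) ^+ k.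
    by rewrite -[RHS]mulrA; congr (_ * _); rewrite -[LHS]opprB subrX1 -mulNr opprB.
  rewrite (_ : c / (c - z) * (1 - z / c) = 1); last by field; rewrite cz c0.
  rewrite mul1r; apply: eq_bigr => k _.
  by rewrite expr0 mul1r -exprVn -exprMn /c /circ invfM mulrA.
rewrite (eq_bigr _ (fun j _ => E j)) exchange_big /=.
rewrite (eq_bigr (fun k : 'I_n.+1 => (z / r%:C) ^+ k * (n.+1%:R * (0%N == k)%:R))).
  rewrite big_ord_recl /= expr0 mul1r mulr1 big1 ?addr0 ?divff ?pnatr_eq0//.
  by move=> i _; rewrite mulr0 mulr0.
move=> k _; rewrite -mulr_sumr; congr (_ * _).
rewrite -(@cavg_expi R n 0 k)//; last by rewrite -ltnS.
by rewrite /cavg mulrC divfK// pnatr_eq0.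
Qed.

(* With c_j the nodes of the circle, put
   H n s = average of F (z + s (c_j - z)) c_j / (c_j - z).
   Then H n 0 tends to F z, and H n 1 - H n 0 tends to 0 because the derivative
   in s is, up to a small error, a telescoping sum over the nodes. *)
Lemma cauchy_disc F f (r : R) z : (forall w, cdiff F w (f w)) ->
  (forall w, ccont f w) -> normc z < r ->
  clim (cavg (fun t => F (circ r t) * (circ r t / (circ r t - z)))) (F z).
Proof.
move=> Fd fc zr; have r0 : 0 < r by rewrite (le_lt_trans (normc_ge0 z)).
have cz t : circ r t - z != 0.
  by rewrite -normc_gt0 (lt_le_trans _ (circ_sub_ge z t (ltW r0)))// subr_gt0.
pose A n := cavg (fun t => circ r t / (circ r t - z)) n.
have zr1 : 0 <= normc z / r < 1.
  by rewrite divr_ge0 ?normc_ge0 ?(ltW r0)//= ltr_pdivrMr// mul1r.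
have hA : clim A 1.
  move=> e e0.
  pose K := r / (r - normc z).
  have K0 : 0 < K by rewrite divr_gt0// subr_gt0.
  have AK n : normc (A n) <= K.
    apply: cavg_le => t; rewrite normcM normcV normc_circ ?(ltW r0)//.
    rewrite ler_pM2l// lef_pV2 ?posrE ?subr_gt0 ?normc_gt0//.
    exact: circ_sub_ge (ltW r0).
  have [N hN] := expr_small zr1 (divr_gt0 e0 K0).
  exists N => n nN; have := cavg_geom n r0 zr; rewrite -/(A n) => E.
  have -> : A n - 1 = A n * (z / r%:C) ^+ n.+1 by rewrite -[X in _ - X]E; ring.
  have hq : normc (z / r%:C) = normc z / r.
    by rewrite [LHS]normcM normcV normc_real (gtr0_norm r0).
  rewrite normcM normcX hq.
  have h1 := hN n.+1 (leqW nN).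
  rewrite (le_trans (ler_pM (normc_ge0 _) _ (AK n) h1))//.
    by rewrite exprn_ge0//; case/andP: zr1.
  by rewrite mulrC divfK// lt0r_neq0.
pose H n s := cavg (fun t => F (z + s * (circ r t - z)) * (circ r t / (circ r t - z))) n.
have H0 n : H n 0 = F z * A n.
  rewrite /H /A /cavg mulrA mulr_sumr; congr (_ / _); apply: eq_bigr => j _.
  by rewrite mul0r addr0.
have H1 n : H n 1 = cavg (fun t => F (circ r t) * (circ r t / (circ r t - z))) n.
  rewrite /H /cavg; congr (_ / _); apply: eq_bigr => j _.
  by rewrite mul1r (addrC z) subrK.
have key : clim (fun n => H n 1 - H n 0) 0.
  move=> e e0; pose eta := e / (4 * r).
  have eta0 : 0 < eta by rewrite divr_gt0// mulr_gt0.
  have [t t0 ht] := unif_diff r Fd fc eta0.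
  have [s s0 hs] := @expi_rccont R 0 _ (divr_gt0 t0 r0).
  have [N hN] := divnS_lt (2 * pi) s0.
  exists N.+1 => n nN.
  have n0 : (0 < n)%N by rewrite (leq_trans _ nN).
  have wn : normc (omega R n - 1) < t / r.
    have := hs (node R n 1); rewrite expi0 subr0; apply.
    rewrite /node mulr1 ger0_norm; first exact: hN _ (ltnW nN).
    by rewrite divr_ge0// mulr_ge0// pi_ge0.
  have w1 : 0 < normc (omega R n - 1).
    rewrite normc_gt0 subr_eq0.
    have := eq_prim_root_expr (omega_prim R n) 1 0; rewrite expr0 expr1 => ->.
    by rewrite mod0n modn_small.
  rewrite subr0 (_ : e = 2 * (2 * eta * r)); last by rewrite /eta; field; rewrite lt0r_neq0.
  apply: (@cdiff_mvt _ (H n) (fun s => cavg (fun t => f (z + s * (circ r t - z)) * circ r t) n)).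
    move=> x _; rewrite /H /cavg.
    apply: cdiff_ext (_ : forall x, n.+1%:R^-1 * _ = _) _; first by move=> y; rewrite mulrC.
    rewrite [X in cdiff _ _ X]mulrC; apply: cdiffZ; apply: cdiff_sum => j _.
    set c := circ r _.
    have -> : f (z + x%:C * (c - z)) * c = (c / (c - z)) * (f (z + (c - z) * x%:C) * (c - z)).
      by rewrite [_ * x%:C]mulrC; field; exact: cz.
    apply: cdiff_ext (_ : forall x, c / (c - z) * F (z + (c - z) * x) = _) _.
      by move=> y; rewrite [_ * y]mulrC [LHS]mulrC.
    by apply: cdiffZ; apply: cdiff_affine; exact: Fd.
  move=> x /andP[x0 x1].
  rewrite /cavg normcM normcV natr_complex normc_real ger0_norm//.
  rewrite ler_pdivrMr ?ltr0n//.
  (* Increments of [w] share the factor x (omega - 1) up to a rotation. Dividing by it at the end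
     needs x > 0 and omega <> 1, hence n > 0. *)
  pose w j := z + x%:C * (circ r (node R n j) - z).
  have wS j : w j.+1 = w j + x%:C * circ r (node R n j) * (omega R n - 1).
    by rewrite /w /circ !expi_node exprS; ring.
  have wr j : normc (w j) <= r.
    have -> : w j = (1 - x)%:C * z + x%:C * circ r (node R n j).
      by rewrite /w rmorphB; ring.
    rewrite (le_trans (normcD _ _))//.
    have -> : normc ((1 - x)%:C * z) = (1 - x) * normc z.
      by rewrite [LHS]normcM normc_real ger0_norm// subr_ge0.
    have -> : normc (x%:C * circ r (node R n j)) = x * r.
      by rewrite [LHS]normcM normc_real normc_circ ?(ltW r0)// gtr0_norm.
    have := ler_wpM2l (_ : 0 <= 1 - x) (ltW zr); rewrite subr_ge0 => /(_ x1).
    by move=> hh; rewrite (le_trans (lerD hh (lexx _)))// -mulrDl subrK mul1r.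
  have tel : \sum_(j < n.+1) (F (w j.+1) - F (w j)) = 0.
    rewrite -(big_mkord xpredT (fun j => F (w j.+1) - F (w j))) telescope_sumr//.
    by rewrite /w /circ !expi_node omegaX expr0 subrr.
  have nh j : normc (x%:C * circ r (node R n j) * (omega R n - 1)) =
     x * r * normc (omega R n - 1).
    by rewrite !normcM normc_real normc_expi mulr1 normc_real !gtr0_norm.
  have est : normc (\sum_(j < n.+1) (F (w j.+1) - F (w j)
      - f (w j) * (x%:C * circ r (node R n j) * (omega R n - 1)))) <=
      n.+1%:R * (eta * (x * r * normc (omega R n - 1))).
    rewrite (le_trans (normc_sum _ _ _))// mulr_natl.
    have hx j : normc (x%:C * circ r (node R n j) * (omega R n - 1)) < t.
      rewrite nh; move: wn; rewrite ltr_pdivlMr// mulrC => /(le_lt_trans _); apply.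
      by rewrite ler_pM2r// ler_piMl// ltW.
    rewrite (le_trans (ler_sum _ (fun j _ => _ :
       _ <= eta * (x * r * normc (omega R n - 1)))))//.
      by move=> j _; rewrite wS -(nh j); apply: ht.
    by rewrite sumr_const card_ord.
  move: est; rewrite sumrB tel sub0r normcN.
  rewrite (eq_bigr (fun j : 'I_n.+1 => (f (w j) * circ r (node R n j)) * (x%:C * (omega R n - 1)))); last first.
    by move=> j _; ring.
  rewrite -mulr_suml normcM normcM normc_real gtr0_norm// => est.
  rewrite -(ler_pM2r (mulr_gt0 x0 w1)) (le_trans est)//.
  rewrite (_ : n.+1%:R * _ = (eta * r * n.+1%:R) * (x * normc (omega R n - 1))); last by ring.
  have h0 : 0 <= eta * r * n.+1%:R * (x * normc (omega R n - 1)).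
    by rewrite mulr_ge0 ?normc_ge0// mulr_ge0// ltW// mulr_gt0.
  by rewrite -!(mulrA 2) (mulr_natl _ 2) mulr2n lerDl.
have := climD key (climZ (F z) hA); rewrite add0r mulr1.
have -> : (fun n => H n 1 - H n 0 + F z * A n) =
  cavg (fun t => F (circ r t) * (circ r t / (circ r t - z))).
  by apply/funext => n; rewrite H0 H1; ring.
by [].
Qed.

End cauchy_coefficients.

(** * Power series and zeros of entire functions *)

Section power_series.
Variable R : realType.
Local Notation C := R[i].
Implicit Types (f g : C -> C) (z w d : C).

(** Cauchy's integral for the k-th Taylor coefficient at 0; independence of [r] comes from
    uniqueness of expansions, in [C1_PS]. *)
Definition coef F (r : R) (k : nat) : C :=
  cmean (fun t => F (circ r t) / circ r t ^+ k).

Lemma cdiff_expn z n : cdiff (fun w => w ^+ n) z (n%:R * z ^+ n.-1).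
Proof. by have := cdiffX n (cdiff_id z); rewrite mulr1. Qed.

Lemma ccont_expnV z n : z != 0 -> ccont (fun w => (w ^+ n)^-1) z.
Proof.
move=> z0; have zn : z ^+ n != 0 by rewrite expf_neq0.
have := @cdiffV R (fun w => w ^+ n) z _ zn (cdiff_expn z n).
exact: cdiff_cont.
Qed.

Lemma rccontM (p q : R -> C) : rccont p -> rccont q -> rccont (fun t => p t * q t).
Proof.
move=> pc qc; rewrite (_ : (fun t => _) = fun t =>
  (Re (p t) * Re (q t) - Im (p t) * Im (q t)) +i* (Re (p t) * Im (q t) + Im (p t) * Re (q t))); last first.
  by apply/funext => t; case: (p t) (q t) => [a b] [c d]; simpc.
apply: rccontI => t; [apply: cvgB|apply: cvgD]; apply: cvgM.
all: first [exact: (rccont_Re pc)|exact: (rccont_Im pc)|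
  exact: (rccont_Re qc)|exact: (rccont_Im qc)].
Qed.

Lemma coef_clim F (r : R) (k : nat) : 0 < r -> (forall z, ccont F z) ->
  clim (cavg (fun t => F (circ r t) / circ r t ^+ k)) (coef F r k).
Proof.
move=> r0 Fc; apply: cavg_clim.
have h1 := rccont_comp Fc (circ_rccont r).
have h2 : rccont ((fun z => (z ^+ k)^-1) \o circ r).
  apply: rccont_comp_at (circ_rccont r) => s; apply: ccont_expnV.
  by rewrite -normc_gt0 normc_circ ?(ltW r0).
exact: (rccontM h1 h2).
Qed.

(** Splitting the Cauchy kernel as a finite geometric sum plus remainder (z/c)^n c / (c - z) already
    works for the averages. On |z| <= r/2 the last factor is at most 2. *)
Lemma taylor_circle F f (r B : R) z n : (forall w, cdiff F w (f w)) ->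
  (forall w, ccont f w) -> 0 < r -> (forall t, normc (F (circ r t)) <= B) ->
  normc z <= r / 2 ->
  normc (F z - \sum_(k < n) coef F r k * z ^+ k) <= 2 * B * (normc z / r) ^+ n.
Proof.
move=> Fd fc r0 hB zr.
have Fc w : ccont F w by exact: cdiff_cont (Fd w).
have zr' : normc z < r by rewrite (le_lt_trans zr)// ltr_pdivrMr// ltr_pMr// ltr1n.
have c0 t : circ r t != 0 by rewrite -normc_gt0 normc_circ ?(ltW r0).
have cz t : r / 2 <= normc (circ r t - z).
  by apply: le_trans (circ_sub_ge z t (ltW r0)); lra.
have cz0 t : circ r t - z != 0.
  by rewrite -normc_gt0 (lt_le_trans _ (cz t))// divr_gt0.
have h1 := cauchy_disc Fd fc zr'.
have h2 : clim (fun m => \sum_(k < n) z ^+ k *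
     cavg (fun t => F (circ r t) / circ r t ^+ k) m) (\sum_(k < n) z ^+ k * coef F r k).
  by apply: (@clim_sum R n (fun k m => z ^+ k * cavg (fun t => F (circ r t) / circ r t ^+ k) m)
    (fun k => z ^+ k * coef F r k)) => k; apply: climZ; exact: coef_clim.
have := climD h1 (climZ (-1) h2).
rewrite mulN1r (eq_bigr (fun k : 'I_n => coef F r k * z ^+ k)); last by move=> k _; rewrite mulrC.
move=> /clim_le; apply => m.
have -> : cavg (fun t => F (circ r t) * (circ r t / (circ r t - z))) m +
   -1 * \sum_(k < n) z ^+ k * cavg (fun t => F (circ r t) / circ r t ^+ k) m =
   cavg (fun t => F (circ r t) * (z / circ r t) ^+ n * (circ r t / (circ r t - z))) m.
  rewrite /cavg mulN1r.
  rewrite [X in _ - X](eq_bigr (fun k : 'I_n => (\sum_(j < m.+1) z ^+ k *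
    (F (circ r (node R m j)) / circ r (node R m j) ^+ k)) / m.+1%:R)); last first.
    by move=> k _; rewrite mulrA mulr_sumr.
  rewrite -mulr_suml -mulrBl; congr (_ / _).
  rewrite exchange_big /= -sumrB; apply: eq_bigr => j _.
  set c := circ r _.
  rewrite (eq_bigr (fun i : 'I_n => F c * (z / c) ^+ i)); last first.
    by move=> i _; rewrite expr_div_n; ring.
  rewrite -mulr_sumr.
  have -> : (z / c) ^+ n = 1 - (1 - z / c) * \sum_(i < n) (z / c) ^+ i.
    have := subrX1 (z / c) n; move: (\sum_(i < n) _) => S E.
    by rewrite -[LHS](subrK 1) E; ring.
  by field; rewrite c0 cz0.
apply: cavg_le => t.
move: (cz t) (hB t) (normc_circ t (ltW r0)); move: (circ r t) => c czt hBt nc.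
rewrite !normcM normcX normcM !normcV nc.
have -> : 2 * B * (normc z / r) ^+ n = B * (normc z / r) ^+ n * (r / (r / 2)).
  by field; rewrite lt0r_neq0.
have B0 : 0 <= B by rewrite (le_trans (normc_ge0 _) hBt).
have q0 : 0 <= normc z / r by rewrite divr_ge0 ?normc_ge0 ?(ltW r0).
apply: ler_pM.
- by rewrite mulr_ge0 ?normc_ge0// exprn_ge0.
- by rewrite divr_ge0 ?normc_ge0// (ltW r0).
- by rewrite ler_wpM2r// exprn_ge0.
- rewrite ler_pM2l// lef_pV2 ?posrE ?divr_gt0//.
  by rewrite (lt_le_trans _ czt)// divr_gt0.
Qed.

(* Convergence on the whole plane, phrased as a uniform remainder bound. *)
Definition PS f (a : nat -> C) := forall rho : R, 0 < rho -> exists2 K : R, 0 <= K &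
  forall z n, normc z <= rho / 2 ->
    normc (f z - \sum_(k < n) a k * z ^+ k) <= K * (normc z / rho) ^+ n.

(** Strong induction on the index: once the lower coefficients agree, comparing both expansions at a
    small real x and dividing by x^n leaves a difference of order x. *)
Lemma expansion_unique f (a b : nat -> C) (rho rho' K K' : R) : 0 < rho -> 0 < rho' ->
  0 <= K -> 0 <= K' ->
  (forall z n, normc z <= rho / 2 ->
    normc (f z - \sum_(k < n) a k * z ^+ k) <= K * (normc z / rho) ^+ n) ->
  (forall z n, normc z <= rho' / 2 ->
    normc (f z - \sum_(k < n) b k * z ^+ k) <= K' * (normc z / rho') ^+ n) ->
  a =1 b.
Proof.
move=> r0 r0' K0 K0' ha hb n; elim/ltn_ind: n => n IH.
apply/eqP; rewrite -subr_eq0; apply/eqP/normc_small => e e0.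
pose M := 1 + K / rho ^+ n.+1 + K' / rho' ^+ n.+1.
have M0 : 0 < M by rewrite /M -addrA ltr_wpDr// addr_ge0// divr_ge0// exprn_ge0// ltW.
pose x := Num.min (e / M) (Num.min (rho / 2) (rho' / 2)).
have x0 : 0 < x by rewrite !lt_min !divr_gt0.
have xe : x <= e / M by rewrite ge_min lexx.
have x1 : x <= rho / 2 by rewrite !ge_min lexx orbT.
have x2 : x <= rho' / 2 by rewrite !ge_min lexx !orbT.
have nx : normc x%:C = x by rewrite normc_real gtr0_norm.
have := ha x%:C n.+1; rewrite nx => /(_ x1) h1.
have := hb x%:C n.+1; rewrite nx => /(_ x2) h2.
have h3 : normc ((a n - b n) * x%:C ^+ n) <= (K / rho ^+ n.+1 + K' / rho' ^+ n.+1) * x ^+ n.+1.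
  rewrite (_ : _ * _ = (f x%:C - \sum_(k < n.+1) b k * x%:C ^+ k) -
     (f x%:C - \sum_(k < n.+1) a k * x%:C ^+ k)).
    rewrite (le_trans (normcB _ _))// (le_trans (lerD h2 h1))//.
    by rewrite !expr_div_n; apply: eq_ler; ring.
  have S : \sum_(i < n) a i * x%:C ^+ i = \sum_(i < n) b i * x%:C ^+ i.
    by apply: eq_bigr => i _; rewrite IH.
  by rewrite !big_ord_recr /= S; ring.
move: h3; rewrite normcM normcX nx (exprS x) mulrA ler_pM2r ?exprn_gt0// => h3.
apply: le_trans h3 _; apply: le_trans (ler_wpM2l _ xe) _.
  by rewrite addr_ge0// divr_ge0// exprn_ge0// ltW.
rewrite mulrC -mulrA ler_piMr ?(ltW e0)// mulrC ler_pdivrMr// mul1r.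
by rewrite /M -addrA lerDr.
Qed.

(** Each radius yields its own expansion; uniqueness identifies all of them with that of radius
    1. *)
Lemma C1_PS F f : (forall w, cdiff F w (f w)) -> (forall w, ccont f w) ->
  PS F (coef F 1).
Proof.
move=> Fd fc.
have Fc w : ccont F w by exact: cdiff_cont (Fd w).
have H (r : R) : 0 < r -> exists2 K : R, 0 <= K & forall z n, normc z <= r / 2 ->
    normc (F z - \sum_(k < n) coef F r k * z ^+ k) <= K * (normc z / r) ^+ n.
  move=> r0; have [B [B0 hB]] := ccont_bounded r Fc.
  exists (2 * B); first by rewrite mulr_ge0// ltW.
  move=> z n; apply: (taylor_circle n Fd fc r0) => t.
  by apply: hB; rewrite normc_circ// ltW.
move=> rho rho0; have [K K0 h] := H _ rho0; exists K; first exact: K0.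
move=> z n zr.
have [K' K0' h'] := H 1 ltr01.
have E := expansion_unique rho0 ltr01 K0 K0' h h'.
rewrite (eq_bigr (fun k : 'I_n => coef F rho k * z ^+ k)); first exact: h.
by move=> k _; rewrite -E.
Qed.

End power_series.

(** * Analyticity, factorization and isolation of zeros *)

Section entire_functions.
Variable R : realType.
Local Notation C := R[i].
Local Notation expi := (@expi R).
Implicit Types (f g : C -> C) (z w d : C).

Definition analytic f := forall z, exists a, PS (fun w => f (z + w)) a.

Lemma PS_ext f g a : f =1 g -> PS f a -> PS g a.
Proof. by move=> /funext ->. Qed.

Lemma PS_ball f a (r e : R) : PS f a -> 0 <= r -> 0 < e ->
  exists n, forall m, (n <= m)%N -> forall z, normc z <= r ->
    normc (f z - \sum_(k < m) a k * z ^+ k) <= e.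
Proof.
move=> fa r0 e0.
(* With this radius the ratio in the remainder is at most 1/2 on the disc |z| <= r. *)
have r10 : 0 < 2 * r + 1 by rewrite ltr_wpDl// mulr_ge0.
have [K K0 hK] := fa _ r10.
have h2 : 0 <= (2^-1 : R) < 1 by rewrite invr_ge0 ler0n/= invf_lt1// ltr1n.
have K10 : 0 < K + 1 by rewrite ltr_wpDl.
have [n hn] := expr_small h2 (divr_gt0 e0 K10).
exists n => m nm z zr.
have zr' : normc z <= (2 * r + 1) / 2.
  by rewrite (le_trans zr)// ler_pdivlMr// mulrC lerDl.
apply: le_trans (hK z m zr') _.
apply: le_trans (_ : K * 2^-1 ^+ m <= _).
  apply: ler_wpM2l => //; apply: lerXn2r.
  - by rewrite nnegrE divr_ge0 ?normc_ge0// ltW.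
  - by rewrite nnegrE invr_ge0.
  - by rewrite ler_pdivrMr// mulrC.
have := hn m nm; rewrite ler_pdivlMr// => h.
by rewrite (le_trans _ h)// mulrC ler_wpM2l// lerDl.
Qed.

(** On a partial sum discrete orthogonality returns the coefficient exactly once there are enough
    nodes; the uniform remainder on the circle is the only error. *)
Lemma PS_clim f a (r : R) k : PS f a -> 0 < r ->
  clim (cavg (fun t => f (circ r t) / circ r t ^+ k)) (a k).
Proof.
move=> fa r0 e e0.
have [n hn] := PS_ball fa (ltW r0) (mulr_gt0 e0 (exprn_gt0 k r0)).
pose N := maxn n k.+1.
have {}hn := hn N (leq_maxl _ _).
exists N => m Nm.
have rC0 : r%:C != 0 by exact: realC_neq0.
have E : cavg (fun t => (\sum_(j < N) a j * circ r t ^+ j) / circ r t ^+ k) m = a k.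
  have -> : cavg (fun t => (\sum_(j < N) a j * circ r t ^+ j) / circ r t ^+ k) m =
     \sum_(j < N) a j * r%:C ^+ j / r%:C ^+ k *
        cavg (fun t => expi t ^+ j / expi t ^+ k) m.
    rewrite /cavg.
    rewrite [RHS](eq_bigr (fun j : 'I_N => (\sum_(i < m.+1) a j * r%:C ^+ j / r%:C ^+ k *
       (expi (node R m i) ^+ j / expi (node R m i) ^+ k)) / m.+1%:R)); last first.
      by move=> j _; rewrite mulrA mulr_sumr.
    rewrite -mulr_suml; congr (_ / _); rewrite exchange_big /=.
    apply: eq_bigr => i _; rewrite mulr_suml; apply: eq_bigr => j _.
    rewrite /circ !exprMn invfM.
    by move: (expi _ ^+ j) (expi _ ^+ k)^-1 (r%:C ^+ j) (r%:C ^+ k)^-1 => u v p q; ring.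
  have kN : (k < N)%N by rewrite leq_max leqnn orbT.
  rewrite (bigD1 (Ordinal kN))//= cavg_expi//.
  - rewrite eqxx mulr1 mulfK ?expf_neq0// big1 ?addr0// => j jk.
    rewrite cavg_expi//; last 2 first.
    + exact: leq_trans (ltnW (ltn_ord j)) Nm.
    + exact: leq_trans (ltnW kN) Nm.
    rewrite (_ : (j == k :> nat) = false) ?mulr0//.
    by apply: contraNF jk => /eqP jk; apply/eqP/val_inj.
  - exact: leq_trans (ltnW kN) Nm.
  - exact: leq_trans (ltnW kN) Nm.
rewrite -[X in _ - X]E.
have -> : cavg (fun t => f (circ r t) / circ r t ^+ k) m -
   cavg (fun t => (\sum_(j < N) a j * circ r t ^+ j) / circ r t ^+ k) m =
   cavg (fun t => (f (circ r t) - \sum_(j < N) a j * circ r t ^+ j) / circ r t ^+ k) m.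
  rewrite /cavg -mulrBl; congr (_ / _); rewrite -sumrB; apply: eq_bigr => i _.
  by rewrite mulrBl.
apply: cavg_le => t; rewrite normcM normcV normcX normc_circ ?(ltW r0)//.
by rewrite ler_pdivrMr ?exprn_gt0// hn// normc_circ// ltW.
Qed.

Lemma PS_coef_le f a (r B : R) k : PS f a -> 0 < r ->
  (forall t, normc (f (circ r t)) <= B) -> normc (a k) <= B / r ^+ k.
Proof.
move=> fa r0 hB; apply: clim_le (PS_clim k fa r0) _ => n.
apply: cavg_le => t; rewrite normcM normcV normcX normc_circ ?(ltW r0)//.
by rewrite ler_pM2r// invr_gt0 exprn_gt0.
Qed.

Lemma PS_0 f a : PS f a -> f 0 = a 0%N.
Proof.
move=> /(_ 1 ltr01)[K K0 /(_ 0 1%N)]; rewrite normc0 => /(_ _).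
rewrite big_ord1 expr0 mulr1 mul0r expr1 mulr0 => h.
apply/eqP; rewrite -subr_eq0 -normc_eq0; apply/eqP/le_anti.
by rewrite normc_ge0 andbT h// divr_ge0.
Qed.

Lemma PS_cdiff f a : PS f a -> cdiff f 0 (a 1%N).
Proof.
move=> fa e e0; have [K K0 hK] := fa 1 ltr01.
have K10 : 0 < K + 1 by rewrite ltr_wpDl.
exists (Num.min (1 / 2) (e / (K + 1))); first by rewrite lt_min !divr_gt0.
move=> h; rewrite lt_min => /andP[h1 h2].
have := hK h 2 (ltW h1); rewrite !big_ord_recl big_ord0 /= expr0 expr1 mulr1 addr0.
rewrite (PS_0 fa) add0r divr1 => H; rewrite -addrA -opprD (le_trans H)//.
rewrite expr2 mulrA ler_wpM2r ?normc_ge0//.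
rewrite (le_trans (ler_wpM2l K0 (ltW h2)))// mulrCA ler_piMr ?(ltW e0)//.
by rewrite ler_pdivrMr// mul1r lerDl.
Qed.

Lemma PS_B f g a b : PS f a -> PS g b -> PS (fun z => f z - g z) (fun k => a k - b k).
Proof.
move=> fa gb rho r0; have [K K0 hK] := fa _ r0; have [M M0 hM] := gb _ r0.
exists (K + M); first exact: addr_ge0.
move=> z n zr.
rewrite (_ : _ - _ = (f z - \sum_(k < n) a k * z ^+ k) - (g z - \sum_(k < n) b k * z ^+ k)).
  by rewrite (le_trans (normcB _ _))// mulrDl lerD ?hK ?hM.
by rewrite (eq_bigr (fun k : 'I_n => a k * z ^+ k - b k * z ^+ k)) ?sumrB;
  [ring|move=> k _; rewrite mulrBl].
Qed.

Lemma analyticB f g : analytic f -> analytic g -> analytic (fun z => f z - g z).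
Proof.
move=> fa gb z; have [a ha] := fa z; have [b hb] := gb z.
by exists (fun k => a k - b k); exact: PS_B.
Qed.

Lemma analytic_holo f : analytic f -> holo f.
Proof.
move=> fa z; have [a ha] := fa z; exists (a 1%N).
by rewrite -[z]addr0; apply/cdiff_shift; exact: PS_cdiff.
Qed.

Lemma C1_analytic F f : (forall w, cdiff F w (f w)) -> (forall w, ccont f w) ->
  analytic F.
Proof.
move=> Fd fc z; exists (coef (fun w => F (z + w)) 1).
apply: (@C1_PS _ _ (fun w => f (z + w))).
  by move=> w; apply/cdiff_shift.
move=> w e e0; have [t t0 h] := fc (z + w) _ e0.
by exists t => // x xw; apply: h; rewrite opprD addrACA subrr add0r.
Qed.

Lemma holoD f g : holo f -> holo g -> holo (fun z => f z + g z).
Proof.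
by move=> hf hg z; exists (D f z + D g z); apply: cdiffD; exact: DP.
Qed.

Lemma holoB f g : holo f -> holo g -> holo (fun z => f z - g z).
Proof.
by move=> hf hg z; exists (D f z - D g z); apply: cdiffB; exact: DP.
Qed.

Lemma holoM f g : holo f -> holo g -> holo (fun z => f z * g z).
Proof.
by move=> hf hg z; exists (D f z * g z + f z * D g z); apply: cdiffM; exact: DP.
Qed.

Lemma holo_cst (c : C) : holo (fun=> c).
Proof. by move=> z; exists 0; exact: cdiff_cst. Qed.

Lemma holo_id : holo (id : C -> C).
Proof. by move=> z; exists 1; exact: cdiff_id. Qed.

Lemma holo_subc (a : C) : holo (fun w => w - a).
Proof. by apply: holoB; [exact: holo_id|exact: holo_cst]. Qed.

Lemma holoX f n : holo f -> holo (fun z => f z ^+ n).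
Proof.
by move=> hf z; exists (n%:R * f z ^+ n.-1 * D f z); apply: cdiffX; exact: DP.
Qed.

Lemma holoV f : holo f -> (forall z, f z != 0) -> holo (fun z => (f z)^-1).
Proof.
by move=> hf f0 z; exists (- D f z / f z ^+ 2); apply: cdiffV => //; exact: DP.
Qed.

Lemma holo_sum I (r : seq I) (P : pred I) (F : I -> C -> C) :
  (forall i, P i -> holo (F i)) -> holo (fun w => \sum_(i <- r | P i) F i w).
Proof.
move=> h z; exists (\sum_(i <- r | P i) D (F i) z).
by apply: cdiff_sum => i Pi; apply: DP; exact: h.
Qed.

Lemma holo_prod I (r : seq I) (P : pred I) (F : I -> C -> C) :
  (forall i, P i -> holo (F i)) -> holo (fun w => \prod_(i <- r | P i) F i w).
Proof.
move=> h; elim: r => [|i r IH].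
  rewrite (_ : (fun _ => _) = fun=> 1); first exact: holo_cst.
  by apply/funext => w; rewrite big_nil.
case Pi: (P i).
  rewrite (_ : (fun _ => _) = fun w => F i w * \prod_(i <- r | P i) F i w).
    by apply: holoM => //; exact: h.
  by apply/funext => w; rewrite big_cons Pi.
rewrite (_ : (fun _ => _) = fun w => \prod_(i <- r | P i) F i w)//.
by apply/funext => w; rewrite big_cons Pi.
Qed.

Lemma holo_shift f z : holo f -> holo (fun w => f (z + w)).
Proof. by move=> h w; have [d hd] := h (z + w); exists d; exact/cdiff_shift. Qed.

Lemma D_shift f z w : holo f -> D (fun x => f (z + x)) w = D f (z + w).
Proof. by move=> h; apply: D_eq; apply/cdiff_shift; exact: DP. Qed.

Lemma cdiff_poly (a : nat -> C) n z :
  cdiff (fun w => \sum_(k < n) a k * w ^+ k) z (\sum_(k < n) a k * (k%:R * z ^+ k.-1)).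
Proof. by apply: cdiff_sum => k _; apply: cdiffZ; exact: cdiff_expn. Qed.

Lemma analytic_poly (a : nat -> C) n : analytic (fun w => \sum_(k < n) a k * w ^+ k).
Proof.
apply: (C1_analytic (fun w => cdiff_poly a n w)) => w.
apply: holo_ccont; apply: holo_sum => k _; apply: holoM; first exact: holo_cst.
by apply: holoM; [exact: holo_cst|apply: holoX; exact: holo_id].
Qed.

Lemma analytic_cauchy_D f z (r B : R) : analytic f -> 0 < r ->
  (forall t, normc (f (z + circ r t)) <= B) -> normc (D f z) <= B / r.
Proof.
move=> fa r0 hB; have [a ha] := fa z.
have -> : D f z = a 1%N.
  by apply: D_eq; rewrite -[z]addr0; apply/cdiff_shift; exact: PS_cdiff.
by have := PS_coef_le 1 ha r0 hB; rewrite expr1.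
Qed.

(** The remainder of [f] is differentiated by Cauchy's estimate on the circle around z of radius
    |z|, which reaches 2 |z|; hence the expansion of [f] is taken with radius 2 rho. *)
Lemma PS_D f a : analytic f -> PS f a -> PS (D f) (fun k => k.+1%:R * a k.+1).
Proof.
move=> fan fa rho r0.
have r20 : 0 < 2 * rho by rewrite mulr_gt0.
have [K K0 hK] := fa _ r20.
exists (K / rho + normc (a 1%N)); first by rewrite addr_ge0 ?normc_ge0// divr_ge0// ltW.
move=> z n zr.
have q0 : 0 <= normc z / rho by rewrite divr_ge0 ?normc_ge0// ltW.
(* At 0 that circle degenerates; the summand |a 1| of the constant covers the case n = 0 there. *)
have [z0|z0] := eqVneq z 0.
  have -> : D f z = a 1%N by apply: D_eq; rewrite z0; exact: PS_cdiff.
  rewrite z0 normc0 mul0r; case: n => [|n].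
    by rewrite big_ord0 subr0 expr0 mulr1 lerDr divr_ge0// ltW.
  rewrite big_ord_recl /= expr0 mulr1 mul1r big1 => [|i _].
    by rewrite addr0 subrr normc0 expr0n mulr0.
  by rewrite expr0n mulr0.
rewrite mulrDl; apply: ler_wpDr; first by rewrite mulr_ge0 ?normc_ge0 ?exprn_ge0.
pose S w := \sum_(k < n.+1) a k * w ^+ k.
have -> : D f z - \sum_(k < n) k.+1%:R * a k.+1 * z ^+ k = D (fun w => f w - S w) z.
  apply/esym/D_eq; apply: cdiffB; first by apply: DP; exact: analytic_holo.
  rewrite (_ : \sum_(k < n) _ = \sum_(k < n.+1) a k * (k%:R * z ^+ k.-1)); first exact: cdiff_poly.
  rewrite big_ord_recl /= mul0r mulr0 add0r; apply: eq_bigr => i _.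
  by rewrite /bump /=; ring.
have nz : 0 < normc z by rewrite normc_gt0.
have := @analytic_cauchy_D (fun w => f w - S w) z (normc z) (K * (normc z / rho) ^+ n.+1).
rewrite (_ : K * (normc z / rho) ^+ n.+1 / normc z = K / rho * (normc z / rho) ^+ n); last first.
  by rewrite exprS; field; rewrite !lt0r_neq0.
apply => //.
  by apply: analyticB => //; exact: analytic_poly.
move=> t; have h2 : normc (z + circ (normc z) t) <= 2 * normc z.
  by rewrite (le_trans (normcD _ _))// normc_circ ?normc_ge0// mulr2n mulrDl mul1r.
apply: le_trans (hK _ n.+1 _) _.
  by lra.
apply: ler_wpM2l => //; apply: lerXn2r.
- by rewrite nnegrE divr_ge0 ?normc_ge0// ltW.
- by rewrite nnegrE.
- rewrite ler_pdivrMr// (le_trans h2)// mulrCA divfK ?lt0r_neq0//.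
Qed.

Lemma analytic_D f : analytic f -> analytic (D f).
Proof.
move=> fa z; have [a ha] := fa z; exists (fun k => k.+1%:R * a k.+1).
have fs : analytic (fun w => f (z + w)).
  move=> w; have [b hb] := fa (z + w); exists b.
  by apply: PS_ext hb => x; rewrite addrA.
apply: PS_ext (PS_D fs ha) => w; apply: D_shift; exact: analytic_holo.
Qed.

(* A primitive of f is continuously differentiable, hence analytic, and so is its
   derivative f. *)
Lemma holo_analytic f : holo f -> analytic f.
Proof.
move=> fh; have [F hF] := holo_primitive fh.
have Fa := C1_analytic hF (holo_ccont fh).
by rewrite (_ : f = D F); [exact: analytic_D|apply/funext => z; rewrite (D_eq (hF z))].
Qed.

Lemma holo_Dfun f : holo f -> holo (D f).
Proof. by move=> /holo_analytic/analytic_D/analytic_holo. Qed.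

Lemma holo_PS f : holo f -> exists a, PS f a.
Proof.
move=> /holo_analytic/(_ 0)[a ha]; exists a.
by apply: PS_ext ha => z; rewrite add0r.
Qed.

Lemma PS_zero f a : PS f a -> (forall k, a k = 0) -> forall z, f z = 0.
Proof.
move=> fa a0 z; apply: normc_small => e e0.
have [n hn] := PS_ball fa (normc_ge0 z) e0.
have := hn n (leqnn _) z (lexx _); rewrite big1 ?subr0// => k _.
by rewrite a0 mul0r.
Qed.

Lemma cdiff_near f g z d (r : R) : 0 < r ->
  (forall w, normc (w - z) < r -> f w = g w) -> cdiff f z d -> cdiff g z d.
Proof.
move=> r0 fg h e /h[t t0 ht]; exists (Num.min t r); first by rewrite lt_min t0.
move=> k; rewrite lt_min => /andP[k1 k2].
rewrite -!fg; first exact: ht.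
- by rewrite subrr normc0.
- by rewrite (addrC z) addrK.
Qed.

(** The quotient has the shifted coefficients, so it is differentiable at 0 by its expansion, and
    elsewhere as a quotient. *)
Lemma PS_divX f a m : holo f -> PS f a -> (forall k, (k < m)%N -> a k = 0) ->
  exists g, [/\ holo g, g 0 = a m & forall z, f z = z ^+ m * g z].
Proof.
move=> fh fa am.
pose g z := if z == 0 then a m else f z / z ^+ m.
have gE z : f z = z ^+ m * g z.
  rewrite /g; case: eqVneq => [->|z0]; last by rewrite mulrC divfK// expf_neq0.
  rewrite expr0n (PS_0 fa); have [->|m0] := posnP m; first by rewrite mul1r.
  by rewrite am// mul0r.
exists g; split => //; last by rewrite /g eqxx.
have gPS : PS g (fun k => a (m + k)%N).
  move=> rho r0; have [K K0 hK] := fa _ r0.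
  exists (K / rho ^+ m + normc (a m)).
    by rewrite addr_ge0 ?normc_ge0// divr_ge0// exprn_ge0// ltW.
  move=> z n zr.
  have [->|z0] := eqVneq z 0.
    rewrite /g eqxx normc0 mul0r; case: n => [|n].
      by rewrite big_ord0 subr0 expr0 mulr1 lerDr divr_ge0// exprn_ge0// ltW.
    rewrite big_ord_recl /= expr0 mulr1 addn0 big1 => [|i _].
      by rewrite addr0 subrr normc0 expr0n mulr0.
    by rewrite expr0n mulr0.
  rewrite mulrDl; apply: ler_wpDr.
    by rewrite mulr_ge0 ?normc_ge0// exprn_ge0// divr_ge0 ?normc_ge0// ltW.
  have zm : 0 < normc z ^+ m by rewrite exprn_gt0// normc_gt0.
  rewrite -(ler_pM2l zm) -normcX -normcM mulrBr -gE normcX.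
  have := hK z (m + n)%N zr; rewrite big_split_ord /= big1 ?add0r; last first.
    by move=> i _; rewrite am// mul0r.
  rewrite (eq_bigr (fun i : 'I_n => z ^+ m * (a (m + i)%N * z ^+ i))); last first.
    by move=> i _; rewrite exprD mulrCA.
  rewrite -mulr_sumr => h; rewrite (le_trans h)// exprD expr_div_n.
  by apply: eq_ler; ring.
move=> z; have [->|z0] := eqVneq z 0; first by exists (a (m + 1)%N); exact: PS_cdiff gPS.
have zm0 : z ^+ m != 0 by rewrite expf_neq0.
eexists; apply: (@cdiff_near (fun w => f w * (w ^+ m)^-1) _ _ _ (normc z)).
- by rewrite normc_gt0.
- move=> w wz; rewrite /g; case: eqVneq => // w0.
  by move: wz; rewrite w0 sub0r normcN ltxx.
- apply: cdiffM (DP z fh) _.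
  exact: (@cdiffV R (fun w => w ^+ m) z _ zm0 (cdiff_expn z m)).
Qed.

(** The exponent is the index of the first nonzero Taylor coefficient at [z], which exists unless
    [f] vanishes identically. *)
Lemma holo_factor f z : holo f -> (exists w, f w != 0) ->
  exists m g, [/\ holo g, g z != 0 & forall w, f w = (w - z) ^+ m * g w].
Proof.
move=> fh [w fw].
have fs := holo_shift z fh; have [a ha] := holo_PS fs.
have : exists m, a m != 0.
  apply: contrapT => H; move/eqP: fw; apply.
  have := PS_zero ha _ (w - z); rewrite (addrC z) subrK; apply => k.
  by apply/eqP/negPn/negP => ak; apply: H; exists k.
move=> exm; case: (ex_minnP exm) => m am hm.
have [|g [gh g0 gE]] := @PS_divX _ a m fs ha.
  move=> k km; apply/eqP/negPn/negP => /hm; by rewrite leqNgt km.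
exists m, (fun w => g (- z + w)); split.
- exact: holo_shift.
- by rewrite addNr g0.
- by move=> x; rewrite (addrC (- z)) -gE addrC subrK.
Qed.

Lemma ccont_neq0 f z : ccont f z -> f z != 0 ->
  exists2 t : R, 0 < t & forall w, normc (w - z) < t -> f w != 0.
Proof.
move=> fc fz; have n0 : 0 < normc (f z) by rewrite normc_gt0.
have [t t0 ht] := fc _ n0; exists t => // w /ht h; apply/eqP => fw.
by move: h; rewrite fw sub0r normcN ltxx.
Qed.

Lemma holo_isolated f z : holo f -> (exists w, f w != 0) ->
  exists2 t : R, 0 < t & forall w, w != z -> normc (w - z) < t -> f w != 0.
Proof.
move=> fh fw; have [m [g [gh g0 gE]]] := holo_factor z fh fw.
have [t t0 ht] := ccont_neq0 (holo_ccont gh z) g0.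
exists t => // w wz /ht gw; rewrite gE mulf_neq0// expf_neq0// subr_eq0 //.
Qed.

Lemma small_complex (t : R) : 0 < t -> exists2 w : C, w != 0 & normc w < t.
Proof.
move=> t0; exists (t / 2)%:C; last first.
  by rewrite normc_real gtr0_norm ?divr_gt0// ltr_pdivrMr// ltr_pMr// ltr1n.
by rewrite -normc_gt0 normc_real gtr0_norm ?divr_gt0.
Qed.

Lemma holo_mul_eq0 f g : holo f -> holo g -> (forall z, f z * g z = 0) ->
  (forall z, f z = 0) \/ (forall z, g z = 0).
Proof.
move=> fh gh fg; apply: contrapT => /not_orP[/existsNP[x /eqP fx] /existsNP[y /eqP gy]].
have [t t0 ht] := holo_isolated 0 fh (ex_intro _ x fx).
have [s s0 hs] := holo_isolated 0 gh (ex_intro _ y gy).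
have ts0 : 0 < Num.min t s by rewrite lt_min t0.
have [w w0] := small_complex ts0; rewrite lt_min => /andP[wt ws].
have /eqP := fg w; rewrite mulf_eq0 => /orP[]; apply/negP.
  by apply: ht => //; rewrite subr0.
by apply: hs => //; rewrite subr0.
Qed.

(** Turns a local factorization, whose cofactor is only continuous at [z], into a global holomorphic
    one. If the exact order m were below k, division by (w - z)^m would show that the cofactor g of
    [holo_factor] tends to 0 at [z], against g(z) <> 0. *)
Lemma holo_order_ge f z k : holo f ->
  (exists h, ccont h z /\ exists2 t : R, 0 < t & forall w, w != z -> normc (w - z) < t ->
    f w = (w - z) ^+ k * h w) ->
  exists g, holo g /\ forall w, f w = (w - z) ^+ k * g w.
Proof.
move=> fh [h [hc [t t0 ht]]].
have [fw|f0] := pselect (exists w, f w != 0); last first.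
  exists (fun=> 0); split; first exact: holo_cst.
  by move=> w; rewrite mulr0; apply/eqP/negPn/negP => fw; apply: f0; exists w.
have [m [g [gh g0 gE]]] := holo_factor z fh fw.
have [km|mk] := leqP k m.
  exists (fun w => (w - z) ^+ (m - k) * g w); split.
    by apply: holoM => //; apply: holoX; exact: holo_subc.
  by move=> w; rewrite mulrA -exprD subnKC.
exfalso.
have n0 : 0 < normc (g z) / 2 by rewrite divr_gt0// normc_gt0.
have [t1 t10 h1] := holo_ccont gh z n0.
have [t2 t20 h2] := hc _ ltr01.
pose K := normc (h z) + 1.
have K0 : 0 < K by rewrite ltr_wpDl// normc_ge0.
(* A single point suffices: so close that g has changed by less than |g z| / 2, while |w| K is at
   most |g z| / 2. *)
pose s := Num.min (Num.min t t1) (Num.min t2 (Num.min 1 (normc (g z) / 2 / K))).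
have s0 : 0 < s by rewrite !lt_min t0 t10 t20 ltr01 divr_gt0.
have [w w0] := small_complex s0.
rewrite !lt_min => /andP[/andP[wt wt1] /andP[wt2 /andP[w1 wK]]].
have e1 : z + w - z = w by rewrite addrAC subrr add0r.
have zw : z + w != z by rewrite -subr_eq0 e1.
have := ht _ zw; rewrite gE e1 => /(_ wt).
rewrite -(subnKC mk) addSnnS exprD -mulrA => /(mulfI (expf_neq0 _ w0)) E.
have : normc (g (z + w)) <= normc (g z) / 2.
  rewrite E normcM normcX exprS -mulrA.
  have h3 : normc (h (z + w)) <= K.
    have := h2 (z + w); rewrite e1 => /(_ wt2) hw.
    have -> : h (z + w) = (h (z + w) - h z) + h z by rewrite subrK.
    by rewrite (le_trans (normcD _ _))// addrC lerD2l ltW.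
  apply: le_trans (_ : normc w * (1 * K) <= _).
    apply: ler_wpM2l; first exact: normc_ge0.
    apply: ler_pM => //; rewrite ?exprn_ge0 ?normc_ge0//.
    by rewrite exprn_ile1 ?normc_ge0// ltW.
  by rewrite mul1r -ler_pdivlMr// ltW.
have := h1 (z + w); rewrite e1 => /(_ wt1) h4.
have := ler_normc_dist (g z) (g (z + w)); rewrite normc_distC ler_norml => /andP[_ h5].
lra.
Qed.

(** Cover a compact square by discs in which only the centre can be a zero; the zeros are then among
    the centres of a finite subcover. *)
Lemma holo_zeros_finite f (r : R) : holo f -> (exists w, f w != 0) ->
  finite_set [set z | normc z <= r /\ f z = 0].
Proof.
move=> fh fw.
have iso z : exists t : R, 0 < t /\ forall w, w != z -> normc (w - z) < t -> f w != 0.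
  by have [t t0 ht] := holo_isolated z fh fw; exists t.
have [t ht] := choice iso.
have := @square_compact R r; rewrite compact_cover => /(_ C setT
  (fun z => [set w : C^o | normc (w - z) < t z])).
case.
- move=> i _; rewrite openE => w /= wi; apply/nearCP.
  exists (t i - normc (w - i)); first by rewrite subr_gt0.
  move=> x; rewrite ltrBrDr => /(le_lt_trans _); apply; exact: normc_subD.
- by move=> x _; exists x => //=; rewrite subrr normc0; case: (ht x).
- move=> S _ cov.
  apply: sub_finite_set (finite_fset S).
  move=> z [zr fz].
  have [|i iS /= zi] := cov z.
    by split; rewrite (le_trans _ zr)// ?ReR_le_normc ?ImR_le_normc.
  have [<-//|iz] := eqVneq i z.
  have [_ /(_ z)] := ht i; rewrite eq_sym iz fz eqxx => /(_ isT zi).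
  by [].
Qed.

End entire_functions.

(** * Jensen's inequality *)

Section jensen.
Variable R : realType.
Local Notation C := R[i].
Local Notation expi := (@expi R).
Implicit Types (f g : C -> C) (z w d : C).

Definition lnc z : R := ln (normc z).

Lemma lncM z w : z != 0 -> w != 0 -> lnc (z * w) = lnc z + lnc w.
Proof. by move=> z0 w0; rewrite /lnc normcM lnM// posrE normc_gt0. Qed.

Lemma lncX z n : z != 0 -> lnc (z ^+ n) = n%:R * lnc z.
Proof. by move=> z0; rewrite /lnc normcX lnXn ?normc_gt0// mulr_natl. Qed.

Lemma lncV z : z != 0 -> lnc z^-1 = - lnc z.
Proof. by move=> z0; rewrite /lnc normcV lnV// posrE normc_gt0. Qed.

Lemma prodC_neq0 I (r : seq I) (P : pred I) (F : I -> C) :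
  (forall i, P i -> F i != 0) -> \prod_(i <- r | P i) F i != 0.
Proof.
by move=> h; apply: (big_ind (fun x => x != 0)); [exact: oner_neq0|exact: mulf_neq0|exact: h].
Qed.

Lemma lnc_prod I (r : seq I) (P : pred I) (F : I -> C) :
  (forall i, P i -> F i != 0) ->
  lnc (\prod_(i <- r | P i) F i) = \sum_(i <- r | P i) lnc (F i).
Proof.
move=> h; elim: r => [|i r IH]; first by rewrite !big_nil /lnc normc1 ln1.
rewrite !big_cons; case: ifP => // Pi; rewrite lncM ?IH ?h//.
exact: prodC_neq0.
Qed.

Lemma lnc_real (x : R) : 0 < x -> lnc x%:C = ln x.
Proof. by move=> x0; rewrite /lnc normc_real gtr0_norm. Qed.

Lemma rccont_lnc (p : R -> C) : rccont p -> (forall t, p t != 0) ->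
  continuous (fun t => lnc (p t)).
Proof.
move=> pc p0 t; apply: (@continuous_comp _ _ _ (fun s => normc (p s)) (@ln R)).
  exact: (rccont_normc pc).
by apply: continuous_ln; rewrite normc_gt0.
Qed.

Lemma circ_surj z : exists2 t : R, - pi <= t <= pi & z = circ (normc z) t.
Proof.
have [->|z0] := eqVneq z 0.
  exists 0; last by rewrite normc0 /circ mul0r.
  by rewrite oppr_le0 pi_ge0.
have n0 : 0 < normc z by rewrite normc_gt0.
pose x := Re z / normc z; pose y := Im z / normc z.
have xy : x ^+ 2 + y ^+ 2 = 1.
  have h : Re z ^+ 2 + Im z ^+ 2 = normc z ^+ 2.
    by case: z {z0 n0 x y} => a b /=; rewrite sqr_sqrtr// addr_ge0 ?sqr_ge0.
  by rewrite /x /y !expr_div_n -mulrDl h divff// expf_neq0// lt0r_neq0.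
have zE : z = (normc z * x) +i* (normc z * y).
  by rewrite /x /y !mulrA ![normc z * _]mulrC !mulfK ?lt0r_neq0//; case: (z).
have x1 : -1 <= x <= 1.
  rewrite -ler_norml -(ler_pXn2r (n := 2)) ?nnegrE// expr1n real_normK ?num_real//.
  by rewrite -xy lerDl sqr_ge0.
have a0 := acos_ge0 x1; have api := acos_lepi x1.
have ca : cos (acos x) = x by apply: acosK; rewrite in_itv.
have sa : sin (acos x) = `|y|.
  by rewrite sin_acos// -xy addrAC subrr add0r sqrtr_sqr.
have E (t : R) : cos t = x -> sin t = y -> z = circ (normc z) t.
  by move=> ct st; rewrite {1}zE /circ /expi ct st; simpc.
have [y0|y0] := leP 0 y.
  exists (acos x); first by rewrite api andbT (le_trans _ a0)// oppr_le0 pi_ge0.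
  by apply: E => //; rewrite sa ger0_norm.
exists (- acos x); first by rewrite lerN2 api/= (le_trans _ (pi_ge0 R))// oppr_le0.
by apply: E; rewrite ?cosN// sinN sa ltr0_norm// opprK.
Qed.

Lemma normc_circle_lb f (r : R) : (forall z, ccont f z) -> 0 <= r ->
  (forall z, normc z = r -> f z != 0) ->
  exists2 d : R, 0 < d & forall z, normc z = r -> d <= normc (f z).
Proof.
move=> fc r0 f0.
have pc := rccont_comp fc (circ_rccont r).
have [||c _ hc] := @EVT_min R (fun t => normc (f (circ r t))) (- pi) pi.
- by rewrite (le_trans _ (pi_ge0 R))// oppr_le0 pi_ge0.
- by apply: continuous_subspaceT; exact: (rccont_normc pc).
exists (normc (f (circ r c))); first by rewrite normc_gt0 f0// normc_circ.
move=> z zr; have [t ht ->] := circ_surj z; rewrite zr.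
by apply: hc; rewrite in_itv.
Qed.

(** The points are r times the (n+1)-th roots of unity, so this is the factorization of X^(n+1) - 1
    evaluated at a / r. *)
Lemma prod_circ_sub (r : R) a n : 0 < r ->
  normc (\prod_(k < n.+1) (circ r (node R n k) - a)) = normc (a ^+ n.+1 - r%:C ^+ n.+1).
Proof.
move=> r0; have rC0 : r%:C != 0 by exact: realC_neq0.
pose x : C := a / r%:C.
have E : \prod_(k < n.+1) (x - omega R n ^+ k) = x ^+ n.+1 - 1.
  have -> : x ^+ n.+1 - 1 = ('X^(n.+1) - 1%:P : {poly C}).[x] by rewrite hornerD hornerXn hornerN hornerC.
  rewrite polyC1 -(factor_Xn_sub_1 (omega_prim R n)) big_mkord horner_prod.
  by apply: eq_bigr => k _; rewrite hornerXsubC.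
have -> : a ^+ n.+1 - r%:C ^+ n.+1 = r%:C ^+ n.+1 * (x ^+ n.+1 - 1).
  by rewrite mulrBr mulr1 expr_div_n mulrCA divff ?mulr1// expf_neq0.
rewrite -E normcM normcX !normc_prod.
have -> : normc r%:C ^+ n.+1 = \prod_(k < n.+1) normc r%:C by rewrite prodr_const card_ord.
rewrite -big_split; apply: eq_bigr => k _.
rewrite [RHS](_ : _ = normc (r%:C * (x - omega R n ^+ k))); last by rewrite normcM.
rewrite normc_distC; congr normc.
by rewrite mulrBr /x mulrCA divff// mulr1 /circ expi_node.
Qed.

(** The average is ln |a^(n+1) - r^(n+1)| / (n + 1), where the larger modulus dominates. For |a| < r
    the true limit is ln r; the weaker bound is enough, since [jensen_zeros] recovers the
    contribution of zeros in another way. *)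
Lemma avg_root (r : R) a : 0 < r -> a != 0 -> normc a != r ->
  exists c : R, forall n, lnc a + c / n.+1%:R <= avg (fun t => lnc (circ r t - a)) n.
Proof.
move=> r0 a0 ar; have na : 0 < normc a by rewrite normc_gt0.
have ca t : circ r t - a != 0.
  by rewrite subr_eq0; apply: contraNneq ar => <-; rewrite normc_circ// ltW.
have [k [k0 hk]] : exists k : R, 0 < k /\ forall n,
    k * normc a ^+ n.+1 <= normc (a ^+ n.+1 - r%:C ^+ n.+1).
  have key (x y : R) n : 0 < x -> x < y -> (1 - x / y) * y ^+ n.+1 <= y ^+ n.+1 - x ^+ n.+1.
    move=> x0 xy; have y0 := lt_trans x0 xy.
    rewrite mulrBl mul1r lerB// [y ^+ n.+1]exprS mulrA divfK ?lt0r_neq0// exprS ler_pM2l//.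
    by apply: lerXn2r; rewrite ?nnegrE; exact: ltW.
  have nr : normc r%:C = r by rewrite normc_real gtr0_norm.
  move: ar; rewrite neq_lt => /orP[lt_ar|lt_ra].
    exists (1 - normc a / r); split; first by rewrite subr_gt0 ltr_pdivrMr// mul1r.
    move=> n; rewrite normc_distC.
    apply: le_trans (le_trans (ler_norm _) (ler_normc_dist _ _)).
    rewrite !normcX nr (le_trans _ (key _ _ n na lt_ar))//.
    rewrite ler_wpM2l//; first by rewrite subr_ge0 ler_pdivrMr// mul1r ltW.
    by apply: lerXn2r; rewrite ?nnegrE; exact: ltW.
  exists (1 - r / normc a); split; first by rewrite subr_gt0 ltr_pdivrMr// mul1r.
  move=> n; apply: le_trans (le_trans (ler_norm _) (ler_normc_dist _ _)).
  by rewrite !normcX nr key.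
exists (ln k) => n; rewrite /avg ler_pdivlMr ?ltr0n// mulrDl divfK ?pnatr_eq0//.
rewrite -lnc_prod// /lnc prod_circ_sub//.
rewrite mulrC mulr_natl -lnXn// addrC -lnM ?posrE ?exprn_gt0//.
have p0 : 0 < k * normc a ^+ n.+1 by rewrite mulr_gt0// exprn_gt0.
by rewrite ler_ln ?posrE// (lt_le_trans p0).
Qed.

Lemma avgD (u v : R -> R) n : avg (fun t => u t + v t) n = avg u n + avg v n.
Proof. by rewrite /avg big_split mulrDl. Qed.

Lemma avg_cst (c : R) n : avg (fun=> c) n = c.
Proof. by rewrite /avg sumr_const card_ord -(mulr_natr c) mulfK// pnatr_eq0. Qed.

Lemma ler_avg (u v : R -> R) n : (forall t, u t <= v t) -> avg u n <= avg v n.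
Proof. by move=> h; rewrite /avg ler_pM2r ?invr_gt0// ler_sum. Qed.

Lemma avg_roots (r : R) (s : seq C) : 0 < r -> all (fun a => (a != 0) && (normc a != r)) s ->
  exists c : R, forall n, lnc (\prod_(a <- s) (0 - a)) + c / n.+1%:R <=
    avg (fun t => lnc (\prod_(a <- s) (circ r t - a))) n.
Proof.
move=> r0; elim: s => [|a s IH] /=.
  move=> _; exists 0 => n; rewrite mul0r addr0 big_nil.
  rewrite (_ : (fun _ => _) = fun=> lnc 1) ?avg_cst//.
  by apply/funext => t; rewrite big_nil.
move=> /andP[/andP[a0 ar] sr].
have ne0 z : normc z = r \/ z = 0 -> all (fun a => (a != 0) && (normc a != r)) (a :: s) ->
    forall b, b \in a :: s -> z - b != 0.
  move=> hz /allP h b /h /andP[b0 br]; rewrite subr_eq0.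
  by case: hz => zr; [apply: contraNneq br => <-; rewrite zr|rewrite zr eq_sym].
have al : all (fun a => (a != 0) && (normc a != r)) (a :: s) by rewrite /= a0 ar.
have ps z : normc z = r \/ z = 0 -> \prod_(b <- s) (z - b) != 0.
  move=> hz; rewrite big_seq; apply: prodC_neq0 => b bs.
  by apply: (ne0 z hz al); rewrite inE bs orbT.
have pa z : normc z = r \/ z = 0 -> z - a != 0.
  by move=> hz; apply: (ne0 z hz al); rewrite inE eqxx.
have [c1 h1] := IH sr; have [c2 h2] := avg_root r0 a0 ar.
exists (c1 + c2) => n.
have -> : avg (fun t => lnc (\prod_(b <- a :: s) (circ r t - b))) n =
    avg (fun t => lnc (circ r t - a)) n + avg (fun t => lnc (\prod_(b <- s) (circ r t - b))) n.
  rewrite -avgD; congr avg; apply/funext => t; rewrite big_cons lncM//.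
    by apply: pa; left; rewrite normc_circ// ltW.
  by apply: ps; left; rewrite normc_circ// ltW.
rewrite big_cons lncM; [|by apply: pa; right|by apply: ps; right].
rewrite mulrDl [c1 / _ + _]addrC addrACA lerD//.
by rewrite sub0r /lnc normcN; exact: h2.
Qed.

(* Replace f by a Taylor polynomial that is uniformly close on the circle; its
   linear factors are handled by [avg_roots]. *)
Lemma jensen_entire f (r : R) : holo f -> 0 < r -> f 0 != 0 ->
  (forall z, normc z = r -> f z != 0) -> lnc (f 0) <= mean (fun t => lnc (f (circ r t))).
Proof.
move=> fh r0 f0 fr.
have fc := holo_ccont fh.
have [d d0 hd] := normc_circle_lb fc (ltW r0) fr.
have nc t : normc (circ r t) = r by rewrite normc_circ// ltW.
have pc : continuous (fun t => lnc (f (circ r t))).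
  by apply: (rccont_lnc (rccont_comp fc (circ_rccont r))) => t; exact: fr.
have cv := avg_cvg pc.
apply/ler_addgt0Pr => e e0.
(* Relative error of the Taylor polynomial: being below 1 it keeps the polynomial nonzero on the
   circle, and ln (1 + e1) <= e1 costs e / 2. The terms c / (n + 1) and the convergence of averages
   cost e / 4 each. *)
pose e1 := Num.min (e / 2) (1 / 2).
have e10 : 0 < e1 by rewrite lt_min !divr_gt0.
have e1e : e1 <= e / 2 by rewrite ge_min lexx.
have e11 : e1 < 1 by rewrite gt_min; apply/orP; right; lra.
have [a ha] := holo_PS fh.
have [n0 hn0] := PS_ball ha (ltW r0) (mulr_gt0 d0 e10).
pose S w := \sum_(k < n0.+1) a k * w ^+ k.
have hS z : normc z = r -> normc (f z - S z) <= e1 * normc (f z).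
  move=> zr; rewrite (le_trans (hn0 n0.+1 (leqnSn _) z _)) ?zr//.
  by rewrite mulrC ler_pM2l// hd.
have S0 : S 0 = f 0.
  by rewrite /S big_ord_recl big1 ?addr0 ?expr0 ?mulr1 ?(PS_0 ha)// => i _; rewrite expr0n mulr0.
have Sn0 z : normc z = r -> S z != 0.
  move=> zr; apply/eqP => Sz; have := hS z zr; rewrite Sz subr0 -subr_ge0.
  rewrite -{2}[normc (f z)]mul1r -mulrBl pmulr_lge0 ?normc_gt0 ?fr//.
  by rewrite subr_ge0 leNgt e11.
have SU z : normc z = r -> lnc (S z) <= lnc (f z) + e1.
  move=> zr; have fz : 0 < normc (f z) by rewrite normc_gt0 fr.
  rewrite /lnc; have e1p : 0 < 1 + e1 by rewrite addr_gt0.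
  apply: le_trans (_ : ln ((1 + e1) * normc (f z)) <= _).
    have Sz : 0 < normc (S z) by rewrite normc_gt0 Sn0.
    rewrite ler_ln ?posrE ?mulr_gt0//.
    rewrite (_ : S z = f z - (f z - S z)); last by ring.
    by rewrite (le_trans (normcB _ _))// mulrDl mul1r lerD2l hS.
  rewrite lnM ?posrE// addrC lerD2l le_ln1Dx// (lt_trans _ e10)// oppr_lt0 ltr01//.
have [c hc] : exists c : R, forall n, lnc (f 0) + c / n.+1%:R <= avg (fun t => lnc (S (circ r t))) n.
  pose p := \poly_(k < n0.+1) a k.
  have pE z : S z = p.[z] by rewrite horner_poly.
  have [s sE] := closed_field_poly_normal p.
  have SE z : S z = lead_coef p * \prod_(b <- s) (z - b).
    rewrite pE {1}sE hornerZ horner_prod; congr (_ * _).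
    by apply: eq_bigr => b _; rewrite hornerXsubC.
  have root b : b \in s -> S b = 0.
    move=> bs; rewrite SE (big_rem b)//= subrr mul0r mulr0//.
  have l0 : lead_coef p != 0.
    by apply: contraNneq f0 => l0; rewrite -S0 SE l0 mul0r.
  have al : all (fun b => (b != 0) && (normc b != r)) s.
    apply/allP => b /root Sb; apply/andP; split.
      by apply/eqP => b0; move: f0 Sb; rewrite -S0 b0 => /eqP.
    by apply/eqP => /Sn0; rewrite Sb eqxx.
  have [c hc] := avg_roots r0 al.
  exists c => n; rewrite -S0.
  have -> : avg (fun t => lnc (S (circ r t))) n = lnc (lead_coef p) +
     avg (fun t => lnc (\prod_(b <- s) (circ r t - b))) n.
    rewrite -[lnc (lead_coef p)](avg_cst _ n) -avgD; congr avg; apply/funext => t.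
    have := Sn0 _ (nc t); rewrite SE mulf_eq0 negb_or => /andP[_ h].
    by rewrite lncM.
  have := f0; rewrite -S0 SE mulf_eq0 negb_or => /andP[_ h].
  by rewrite lncM// -addrA lerD2l.
have e4 : 0 < e / 4 by rewrite divr_gt0.
have [N hN] := divnS_lt (- c) e4.
have [M _ hM] := (cvgrPdist_le _ _).1 cv _ e4.
pose n := maxn N M.
have h1 := hN n (leq_maxl _ _).
have h2 := hM n (leq_maxr _ _).
have h3 := hc n.
have h4 : avg (fun t => lnc (S (circ r t))) n <= avg (fun t => lnc (f (circ r t))) n + e1.
  rewrite -[X in _ + X](avg_cst e1 n) -avgD; apply: ler_avg => t; exact: SU.
move: h2 h4 h3; move: (avg _ n) (avg _ n) (mean _) => A B m.
rewrite distrC ler_norml => /andP[_ h2] h4 h3.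
move: h1 h3; rewrite mulNr; move: (c / n.+1%:R) => q h1 h3.
move: (lnc (f 0)) h3 => L h3; clear - h1 h2 h3 h4 e1e; move: e1 e1e h4 => x e1e h4.
lra.
Qed.

Lemma mean_unique (u : R -> R) l : continuous u -> avg u n @[n --> \oo] --> l -> mean u = l.
Proof. by move=> /avg_cvg uc; apply: cvg_unique uc. Qed.

Lemma continuous_addR (u v : R -> R) : continuous u -> continuous v ->
  continuous (fun t => u t + v t).
Proof. by move=> uc vc t; apply: cvgD; [exact: uc|exact: vc]. Qed.

Lemma continuous_mulR (u v : R -> R) : continuous u -> continuous v ->
  continuous (fun t => u t * v t).
Proof. by move=> uc vc t; apply: cvgM; [exact: uc|exact: vc]. Qed.

Lemma continuous_cstR (c : R) : continuous (fun _ : R => c).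
Proof. by move=> t; exact: cvg_cst. Qed.

Lemma meanD (u v : R -> R) : continuous u -> continuous v ->
  mean (fun t => u t + v t) = mean u + mean v.
Proof.
move=> uc vc; apply: mean_unique; first exact: continuous_addR.
rewrite (_ : (fun n => _) = fun n => avg u n + avg v n); last first.
  by apply/funext => n; rewrite avgD.
by apply: cvgD; exact: avg_cvg.
Qed.

Lemma meanZ (c : R) (u : R -> R) : continuous u -> mean (fun t => c * u t) = c * mean u.
Proof.
move=> uc; apply: mean_unique; first by apply: continuous_mulR => //; exact: continuous_cstR.
rewrite (_ : (fun n => _) = fun n => c * avg u n); last first.
  by apply/funext => n; rewrite /avg -mulr_sumr mulrA.
by apply: cvgM; [exact: cvg_cst|exact: avg_cvg].
Qed.

Lemma mean_cst (c : R) : mean (fun=> c) = c.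
Proof.
apply: mean_unique; first exact: continuous_cstR.
rewrite (_ : (fun n => _) = fun=> c); first exact: cvg_cst.
by apply/funext => n; rewrite avg_cst.
Qed.

Lemma ler_mean (u v : R -> R) : continuous u -> continuous v ->
  (forall t, u t <= v t) -> mean u <= mean v.
Proof.
move=> uc vc uv.
rewrite -(cvg_lim (@Rhausdorff R) (avg_cvg uc)) -(cvg_lim (@Rhausdorff R) (avg_cvg vc)).
apply: ler_lim.
- by apply/cvg_ex; exists (mean u); exact: avg_cvg.
- by apply/cvg_ex; exists (mean v); exact: avg_cvg.
- by near=> n; exact: ler_avg.
Unshelve. all: by end_near. Qed.

Lemma mean_sum I (s : seq I) (u : I -> R -> R) : (forall i, continuous (u i)) ->
  continuous (fun t => \sum_(i <- s) u i t) /\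
  mean (fun t => \sum_(i <- s) u i t) = \sum_(i <- s) mean (u i).
Proof.
move=> uc; elim: s => [|i s [IH1 IH2]].
  rewrite big_nil (_ : (fun _ => _) = fun=> 0); last by apply/funext => t; rewrite big_nil.
  by split; [exact: continuous_cstR|exact: mean_cst].
rewrite big_cons (_ : (fun _ => _) = fun t => u i t + \sum_(i <- s) u i t); last first.
  by apply/funext => t; rewrite big_cons.
by split; [exact: continuous_addR|rewrite meanD// IH2].
Qed.

Lemma lnc_circ_cont f (r : R) : holo f -> 0 <= r -> (forall z, normc z = r -> f z != 0) ->
  continuous (fun t => lnc (f (circ r t))).
Proof.
move=> fh r0 fr; apply: (rccont_lnc (rccont_comp (holo_ccont fh) (circ_rccont r))) => t.
by apply: fr; rewrite normc_circ.
Qed.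

(** Jensen's inequality for [f] and for 1 / f gives the two directions. *)
Lemma mean_lnc_unit f (r : R) : holo f -> (forall z, f z != 0) -> 0 < r ->
  mean (fun t => lnc (f (circ r t))) = lnc (f 0).
Proof.
move=> fh f0 r0; apply/le_anti/andP; split; last exact: jensen_entire.
have := @jensen_entire _ r (holoV fh f0) r0.
rewrite invr_eq0 f0 => /(_ isT).
have h z : normc z = r -> (f z)^-1 != 0 by rewrite invr_eq0 f0.
move=> /(_ h); rewrite lncV//.
rewrite (_ : (fun _ => _) = fun t => -1 * lnc (f (circ r t))); last first.
  by apply/funext => t; rewrite lncV// mulN1r.
by rewrite meanZ ?mulN1r ?lerN2//; apply: lnc_circ_cont => //; exact: ltW.
Qed.

(** On the circle r^2 = z conj(z), so the numerator is z times the conjugate of z - a. *)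
Lemma blaschke_norm (r : R) a z : 0 < r -> normc z = r ->
  normc ((r%:C ^+ 2 - a^*%C * z) / r%:C) = normc (z - a).
Proof.
move=> r0 zr.
have rC : r%:C ^+ 2 = z^*%C * z.
  case: z zr => x y /= zr; apply/eqP; rewrite eq_complex /= -zr.
  rewrite expr2; apply/andP; split; apply/eqP => /=; last by ring.
  by rewrite mulr0 subr0 -expr2 sqr_sqrtr ?addr_ge0 ?sqr_ge0//; ring.
have J w : normc w^*%C = normc w by case: w => x y /=; rewrite sqrrN.
rewrite rC -mulrBl normcM normcM normcV normc_real gtr0_norm// zr.
rewrite mulfK ?lt0r_neq0//.
by rewrite (_ : z^*%C - a^*%C = (z - a)^*%C) ?J// rmorphB.
Qed.

(* The Blaschke factor (r^2 - conj(a) z) / r has modulus |z - a| on the circle and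
   the value r at 0. *)
Lemma jensen_zeros f U (s : seq C) (mu : C -> nat) (r : R) : holo f -> holo U -> 0 < r ->
  (forall z, f z = (\prod_(a <- s) (z - a) ^+ mu a) * U z) ->
  f 0 != 0 -> (forall z, normc z = r -> f z != 0) ->
  lnc (f 0) + \sum_(a <- s) (mu a)%:R * (ln r - lnc a) <=
    mean (fun t => lnc (f (circ r t))).
Proof.
move=> fh Uh r0 fE f0 fr.
have rC0 : r%:C != 0 by exact: realC_neq0.
pose B a z := (r%:C ^+ 2 - a^*%C * z) / r%:C.
pose V z := (\prod_(a <- s) B a z ^+ mu a) * U z.
have nV z : normc z = r -> normc (V z) = normc (f z).
  move=> zr; rewrite fE /V !normcM !normc_prod; congr (_ * _); apply: eq_bigr => a _.
  by rewrite !normcX blaschke_norm.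
have Vr z : normc z = r -> V z != 0.
  by move=> zr; rewrite -normc_gt0 nV// normc_gt0 fr.
have Vh : holo V.
  apply: holoM => //; apply: holo_prod => a _; apply: holoX; apply: holoM; last exact: holo_cst.
  apply: holoB; first exact: holo_cst.
  by apply: holoM; [exact: holo_cst|exact: holo_id].
have p0 : \prod_(a <- s) (0 - a) ^+ mu a != 0.
  by move: f0; rewrite fE mulf_eq0 negb_or => /andP[].
have U0 : U 0 != 0 by move: f0; rewrite fE mulf_eq0 negb_or => /andP[].
have a0 a : a \in s -> (0 - a) ^+ mu a != 0.
  move=> sa; apply: contraNneq p0 => h; by rewrite (big_rem a)//= h mul0r.
have B0 a : B a 0 = r%:C by rewrite /B mulr0 subr0 expr2 mulfK.
have V0 : V 0 != 0.
  rewrite /V mulf_neq0//; apply: prodC_neq0 => a _.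
  by rewrite B0 expf_neq0.
have := jensen_entire Vh r0 V0 Vr.
rewrite (_ : (fun t => lnc (V (circ r t))) = fun t => lnc (f (circ r t))); last first.
  by apply/funext => t; rewrite /lnc nV// normc_circ// ltW.
apply: le_trans; rewrite fE /V !lncM//; last first.
  by apply: prodC_neq0 => a _; rewrite B0 expf_neq0.
rewrite addrAC lerD2r.
have E1 : lnc (\prod_(a <- s) (0 - a) ^+ mu a) = \sum_(a <- s) lnc ((0 - a) ^+ mu a).
  by rewrite big_seq lnc_prod -?big_seq.
have E2 : lnc (\prod_(a <- s) B a 0 ^+ mu a) = \sum_(a <- s) lnc (B a 0 ^+ mu a).
  by rewrite lnc_prod// => a _; rewrite B0 expf_neq0.
rewrite E1 E2 -big_split /= big_seq [leRHS]big_seq ler_sum// => a sa.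
rewrite B0 lncX// lnc_real//.
have [->|m0] := posnP (mu a); first by rewrite expr0 !mul0r /lnc normc1 ln1 addr0.
have an0 : 0 - a != 0.
  by apply: contraNneq (a0 a sa) => ->; rewrite expr0n gtn_eqF.
rewrite lncX// (_ : lnc (0 - a) = lnc a); last by rewrite /lnc sub0r normcN.
by rewrite mulrBr addrC subrK.
Qed.

(** Dividing out the factor at one point leaves the divisibility at the other, distinct points
    intact, by [holo_order_ge]. *)
Lemma holo_div_prod f (s : seq C) (mu : C -> nat) : holo f -> uniq s ->
  (forall a, a \in s -> exists g, holo g /\ forall w, f w = (w - a) ^+ mu a * g w) ->
  exists U, holo U /\ forall z, f z = (\prod_(a <- s) (z - a) ^+ mu a) * U z.
Proof.
elim: s f => [|a s IH] f fh /=.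
  by move=> _ _; exists f; split => // z; rewrite big_nil mul1r.
move=> /andP[nas us] h.
have [g [gh gE]] := h a (mem_head _ _).
have [|U [Uh UE]] := IH g gh us; last first.
  by exists U; split => // z; rewrite gE UE big_cons mulrA.
move=> b bs; have [|k [kh kE]] := h b; first by rewrite inE bs orbT.
have ba : b != a by apply: contraNneq nas => <-.
apply: holo_order_ge gh _.
exists (fun w => k w * ((w - a) ^+ mu a)^-1); split.
  apply: cdiff_cont (cdiffM (DP b kh) (cdiffV _ (DP b (holoX (mu a) (@holo_subc R a))))).
  by rewrite expf_neq0// subr_eq0.
exists (normc (b - a)); first by rewrite normc_gt0 subr_eq0.
move=> w wb wba; have wa : w - a != 0.
  by apply: contraTneq wba => /eqP; rewrite subr_eq0 => /eqP ->; rewrite normc_distC ltxx.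
apply: (mulfI (expf_neq0 (mu a) wa)); rewrite -gE kE.
by rewrite mulrCA [X in _ = _ * X]mulrCA divff ?mulr1// expf_neq0.
Qed.

(** The whole zero at 0 is divided out, so the constant, the logarithm at 0 of the remaining
    cofactor, depends neither on [s] nor on [r]. The order at 0 may exceed [k0]; the surplus is
    dropped because ln r >= 0 for r >= 1. *)
Lemma jensen_counting f (k0 : nat) (mu : C -> nat) : holo f ->
  (exists w, f w != 0) ->
  (exists g, holo g /\ forall w, f w = (w - 0) ^+ k0 * g w) ->
  exists c, forall (s : seq C) r, 1 <= r -> uniq s -> (forall a, a \in s -> a != 0) ->
    (forall a, a \in s -> exists g, holo g /\ forall w, f w = (w - a) ^+ mu a * g w) ->
    (forall z, normc z = r -> f z != 0) ->
    c + \sum_(a <- s) (mu a)%:R * (ln r - lnc a) + k0%:R * ln r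
      <= mean (fun t => lnc (f (circ r t))).
Proof.
move=> fh [w0 fw0] [g [gh gE]].
have g0 : exists w, g w != 0.
  by exists w0; apply: contra_neq fw0 => gw; rewrite gE gw mulr0.
have [k1 [h [hh h0 hE]]] := holo_factor 0 gh g0.
have fE w : f w = w ^+ (k0 + k1) * h w by rewrite gE hE !subr0 mulrA exprD.
exists (lnc (h 0)) => s r r1 su s0 sd fr.
have r0 : 0 < r by apply: lt_le_trans r1.
have hr z : normc z = r -> h z != 0.
  by move=> /fr; apply: contra_neq => hz; rewrite fE hz mulr0.
have hd a : a \in s -> exists g, holo g /\ forall w, h w = (w - a) ^+ mu a * g w.
  move=> sa; have a0 := s0 _ sa; have [V [Vh VE]] := sd _ sa.
  apply: holo_order_ge => //; exists (fun w => V w * (w ^+ (k0 + k1))^-1); split.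
    apply: cdiff_cont; apply: cdiffM; first exact: DP.
    by apply: cdiffV; [rewrite expf_neq0|exact: cdiff_expn].
  exists (normc a); first by rewrite normc_gt0.
  move=> w wa wd; have wn0 : w != 0.
    by apply: contraTneq wd => ->; rewrite sub0r normcN ltxx.
  by rewrite mulrA -VE fE mulrAC mulfV ?mul1r// expf_neq0.
have [U [Uh UE]] := holo_div_prod hh su hd.
have := jensen_zeros hh Uh r0 UE h0 hr.
have hc := lnc_circ_cont hh (ltW r0) hr.
have -> : (fun t => lnc (f (circ r t))) =
    fun t => (k0 + k1)%:R * ln r + lnc (h (circ r t)).
  apply/funext => t; have nt := normc_circ t (ltW r0).
  rewrite fE lncM ?hr// ?lncX ?expf_neq0// -?normc_gt0 ?nt//.
  by rewrite /lnc nt.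
have cc : continuous (fun _ : R => (k0 + k1)%:R * ln r) by move=> t; exact: cvg_cst.
rewrite (meanD cc hc) mean_cst => le.
rewrite [leRHS]addrC; apply: lerD => //.
by rewrite ler_wpM2r ?ln_ge0// ler_nat leq_addr.
Qed.

End jensen.

(** * Zero-free entire functions *)

Section zero_free_entire.
Variable R : realType.
Local Notation C := R[i].
Implicit Types (f g : C -> C) (z w d : C).

Lemma is_derive_half_ln (a b : R -> R) (t a' b' : R) : is_derive t 1 a a' -> is_derive t 1 b b' ->
  0 < a t ^+ 2 + b t ^+ 2 ->
  is_derive t 1 (fun s => ln (a s ^+ 2 + b s ^+ 2) / 2)
    ((a t * a' + b t * b') / (a t ^+ 2 + b t ^+ 2)).
Proof.
move=> ha hb h0.
have h1 : is_derive t 1 (fun s => a s ^+ 2 + b s ^+ 2) (2 * (a t * a' + b t * b')).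
  by apply: is_derive_eq; rewrite /GRing.scale /=; ring.
have h2 := @is_derive1_comp _ (@ln R) (fun s => a s ^+ 2 + b s ^+ 2) t _ _ (is_derive1_ln h0) h1.
have h3 : is_derive t 1 (fun s => 2^-1 * ln (a s ^+ 2 + b s ^+ 2))
    (2^-1 * ((a t ^+ 2 + b t ^+ 2)^-1 * (2 * (a t * a' + b t * b')))).
  exact: (@is_deriveZ _ _ _ (fun s => ln (a s ^+ 2 + b s ^+ 2)) 2^-1 t 1 _ h2).
rewrite (_ : (fun s => _) = fun s => 2^-1 * ln (a s ^+ 2 + b s ^+ 2)); last first.
  by apply/funext => s; rewrite mulrC.
apply: (is_derive_eq h3); field; exact: lt0r_neq0.
Qed.

Lemma lncE z : lnc z = ln (Re z ^+ 2 + Im z ^+ 2) / 2.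
Proof.
rewrite /lnc; case: z => a b /=.
have h : 0 <= a ^+ 2 + b ^+ 2 by rewrite addr_ge0 ?sqr_ge0.
have [h0|h0] := leP (a ^+ 2 + b ^+ 2) 0.
  have -> : a ^+ 2 + b ^+ 2 = 0 by apply/le_anti; rewrite h0 h.
  by rewrite sqrtr0 ln0// mul0r.
by rewrite -{2}[a ^+ 2 + b ^+ 2]sqr_sqrtr// lnXn ?sqrtr_gt0// -[X in _ = X / _]mulr_natr mulfK//.
Qed.

(** [P] is a primitive of f' / f. The last identity is checked along the ray t -> z t, where the
    difference of both sides has derivative 0; no complex exponential is needed. *)
Lemma unit_log f : holo f -> (forall z, f z != 0) -> exists P,
  [/\ holo P, P 0 = 0, forall z, D P z = D f z / f z &
      forall z, lnc (f z) = lnc (f 0) + Re (P z)].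
Proof.
move=> fh f0.
have qh : holo (fun z => D f z * (f z)^-1) by apply: holoM; [exact: holo_Dfun|exact: holoV].
have [F hF] := holo_primitive qh.
have Pd z : cdiff (fun z => F z - F 0) z (D f z / f z).
  by have := cdiffB (hF z) (cdiff_cst (F 0) z); rewrite subr0.
exists (fun z => F z - F 0); split.
- by move=> z; exists (D f z / f z).
- by rewrite subrr.
- by move=> z; apply: D_eq.
move=> z.
pose u (t : R) : R := lnc (f (0 + z * t%:C)) - Re (F (0 + z * t%:C) - F 0).
have ud (t : R) : is_derive t 1 u 0.
  have h1 := cdiff_affine (DP (0 + z * t%:C) fh).
  have h2 := cdiff_affine (Pd (0 + z * t%:C)).
  have ha := cdiff_is_derive_Re h1; have hb := cdiff_is_derive_Im h1.
  have hc := cdiff_is_derive_Re h2.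
  have pos : 0 < Re (f (0 + z * t%:C)) ^+ 2 + Im (f (0 + z * t%:C)) ^+ 2.
    have := f0 (0 + z * t%:C); case: (f _) => x y /=.
    rewrite eq_complex /= negb_and => /orP[h|h].
      by rewrite ltr_wpDr ?sqr_ge0// lt_def sqrf_eq0 h sqr_ge0.
    by rewrite ltr_wpDl ?sqr_ge0// lt_def sqrf_eq0 h sqr_ge0.
  have hl := is_derive_half_ln ha hb pos.
  rewrite (_ : u = fun s => ln (Re (f (0 + z * s%:C)) ^+ 2 + Im (f (0 + z * s%:C)) ^+ 2) / 2 -
    Re (F (0 + z * s%:C) - F 0)); last by apply/funext => s; rewrite /u lncE.
  apply: (is_derive_eq (is_deriveB hl hc)).
  move: pos; move: (D f _) (f (0 + z * t%:C)) => [x y] [a b] /= pos; case: (z) => p q /=.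
  by field; rewrite lt0r_neq0.
have := @is_derive_0_is_cst R u 1 0 ud; rewrite /u !add0r mulr1 mulr0 subrr /=.
by rewrite subr0 => /eqP; rewrite subr_eq => /eqP.
Qed.

(* The characteristic of an entire function, see [characteristicE]. *)
Definition Tc f (r : R) : R := mean (fun t => lnplus (normc (f (circ r t)))).

Lemma lnplusE z : lnplus (normc z) = (`|lnc z| + lnc z) / 2.
Proof.
rewrite /lnplus -/(lnc z); move: (lnc z) => x.
have [x0|x0] := leP 0 x; first by rewrite ger0_norm//; lra.
by rewrite ltr0_norm//; lra.
Qed.

Lemma continuous_normR (u : R -> R) : continuous u -> continuous (fun t => `|u t|).
Proof. by move=> uc t; apply: cvg_norm; exact: uc. Qed.

Lemma clim_le_cvg (v : nat -> C) l (w : nat -> R) m : clim v l ->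
  (forall n, normc (v n) <= w n) -> w n @[n --> \oo] --> m -> normc l <= m.
Proof.
move=> hv vw wm; apply/ler_addgt0Pr => e e0; have e2 : 0 < e / 2 by rewrite divr_gt0.
have [N hN] := hv _ e2.
have [M _ hM] := (cvgrPdist_le _ _).1 wm _ e2.
have h1 := hN _ (leq_maxl N M); have /= h2 := hM _ (leq_maxr N M).
have h3 := vw (maxn N M).
have -> : l = v (maxn N M) - (v (maxn N M) - l) by ring.
apply: le_trans (normcB _ _) _.
move: h2; rewrite distrC ler_norml => /andP[_ h2]; lra.
Qed.

Section unit_function.
Variables (f : C -> C) (fh : holo f) (f0 : forall z, f z != 0).

Lemma unit_lnc_cont (r : R) : continuous (fun t => lnc (f (circ r t))).
Proof.
apply: (rccont_lnc (rccont_comp (holo_ccont fh) (circ_rccont r))) => t; exact: f0.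
Qed.

Lemma lnplus_cont (r : R) : continuous (fun t => lnplus (normc (f (circ r t)))).
Proof.
rewrite (_ : (fun t => _) = fun t => (`|lnc (f (circ r t))| + lnc (f (circ r t))) * 2^-1).
  apply: continuous_mulR; last exact: continuous_cstR.
  apply: continuous_addR; last exact: unit_lnc_cont.
  by apply: continuous_normR; exact: unit_lnc_cont.
by apply/funext => t; rewrite lnplusE.
Qed.

(** From |x| = 2 max (0, x) - x and the constancy of the mean of ln |f|. *)
Lemma mean_abs_lnc (r : R) : 0 < r ->
  mean (fun t => `|lnc (f (circ r t))|) = 2 * Tc f r - lnc (f 0).
Proof.
move=> r0; rewrite -(mean_lnc_unit fh f0 r0) /Tc -meanZ; last exact: lnplus_cont.
rewrite -mulN1r -meanZ; last exact: unit_lnc_cont.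
rewrite -meanD.
- by congr mean; apply/funext => t; rewrite lnplusE; field.
- by apply: continuous_mulR; [exact: continuous_cstR|exact: lnplus_cont].
- by apply: continuous_mulR; [exact: continuous_cstR|exact: unit_lnc_cont].
Qed.

Lemma Tc_ge0 (r : R) : 0 <= Tc f r.
Proof.
rewrite -(mean_cst 0) /Tc; apply: ler_mean; first exact: continuous_cstR.
  exact: lnplus_cont.
by move=> t; rewrite /lnplus le_max lexx.
Qed.

(* On the circle P + conj(P) = 2 Re P, and conj(P) does not contribute to the k-th
   coefficient when k > 0. *)
Lemma log_coef_bound P p (r : R) k : holo P -> P 0 = 0 ->
  (forall z, lnc (f z) = lnc (f 0) + Re (P z)) -> PS P p -> 0 < r ->
  normc (p k) * r ^+ k <= 4 * (Tc f r + `|lnc (f 0)|).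
Proof.
move=> Ph P0 hP Pp r0.
have T0 := Tc_ge0 r.
have [->|k0] := posnP k.
  by rewrite -(PS_0 Pp) P0 normc0 mul0r mulr_ge0// addr_ge0.
have rC0 : r%:C != 0 by exact: realC_neq0.
pose u t : R := `|Re (P (circ r t))|.
have uE t : u t = `|lnc (f (circ r t)) - lnc (f 0)| by rewrite /u hP addrAC subrr add0r.
have uc : continuous u.
  by apply: continuous_normR; exact: (rccont_Re (rccont_comp (holo_ccont Ph) (circ_rccont r))).
have um : mean u <= 2 * (Tc f r + `|lnc (f 0)|).
  apply: le_trans (_ : mean (fun t => `|lnc (f (circ r t))| + `|lnc (f 0)|) <= _).
    apply: ler_mean => //.
      apply: continuous_addR; last exact: continuous_cstR.
      by apply: continuous_normR; exact: unit_lnc_cont.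
    by move=> t; rewrite uE; exact: ler_normB.
  rewrite meanD ?mean_cst ?mean_abs_lnc//; last 2 first.
  - by apply: continuous_normR; exact: unit_lnc_cont.
  - exact: continuous_cstR.
  have := ler_norm (- lnc (f 0)); rewrite normrN; lra.
have h1 := PS_clim k Pp r0.
(* For c on the circle, conj(c)^k = r^(2k) / c^k. So the average of conj(P) / c^k is the conjugate
   of the average of P c^k, divided by r^(2k), and it tends to 0 with the value of P z^k at 0. *)
have Qh : holo (fun z => P z * z ^+ k) by apply: holoM => //; apply: holoX; exact: holo_id.
have [q hq] := holo_PS Qh.
have q0 : q 0%N = 0 by rewrite -(PS_0 hq) P0 mul0r.
have h2 := PS_clim 0 hq r0; rewrite q0 in h2.
have h3 : clim (fun n => cavg (fun t => P (circ r t) / circ r t ^+ k) n +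
    (cavg (fun t => (P (circ r t) * circ r t ^+ k) / circ r t ^+ 0) n)^*%C / (r%:C ^+ k * r%:C ^+ k))
    (p k).
  have h2' : clim (fun n => (r%:C ^+ k * r%:C ^+ k)^-1 *
     (cavg (fun t => (P (circ r t) * circ r t ^+ k) / circ r t ^+ 0) n)^*%C) 0.
    rewrite -(mulr0 (r%:C ^+ k * r%:C ^+ k)^-1); apply: climZ => e /h2[N hN].
    exists N => n /hN; rewrite !subr0; case: (cavg _ _) => a b /=.
    by rewrite sqrrN.
  have := climD h1 h2'; rewrite addr0.
  by congr clim; apply/funext => n; rewrite [X in _ + X = _]mulrC.
have bd n : normc (cavg (fun t => P (circ r t) / circ r t ^+ k) n +
    (cavg (fun t => (P (circ r t) * circ r t ^+ k) / circ r t ^+ 0) n)^*%C / (r%:C ^+ k * r%:C ^+ k))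
    <= 2 * avg u n / r ^+ k.
  have zk t : circ r t ^+ k != 0.
    by rewrite expf_neq0// -normc_gt0 normc_circ// ltW.
  have zz t : circ r t ^+ k * (circ r t ^+ k)^*%C = r%:C ^+ k * r%:C ^+ k.
    have h w : w * w^*%C = (normc w)%:C * (normc w)%:C.
      case: w => x y; apply/eqP; rewrite eq_complex /= !mul0r !mulr0 subr0 addr0.
      rewrite -!expr2 sqr_sqrtr ?addr_ge0 ?sqr_ge0//.
      by apply/andP; split; apply/eqP; ring.
    by rewrite h normcX normc_circ ?(ltW r0)// rmorphXn.
  have -> : cavg (fun t => P (circ r t) / circ r t ^+ k) n +
    (cavg (fun t => (P (circ r t) * circ r t ^+ k) / circ r t ^+ 0) n)^*%C / (r%:C ^+ k * r%:C ^+ k)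
    = cavg (fun t => (P (circ r t) + (P (circ r t))^*%C) / circ r t ^+ k) n.
    rewrite /cavg rmorphM fmorphV rmorph_nat rmorph_sum /= mulrAC -mulrDl.
    congr (_ / _); rewrite mulr_suml -big_split /=; apply: eq_bigr => j _.
    rewrite expr0 divr1 rmorphM -(zz (node R n j)) mulrDl; congr (_ + _).
    have aux (a b c : C) : b != 0 -> c != 0 -> a * b / (c * b) = a / c.
      by move=> b0 c0; field; rewrite b0 c0.
    by apply: aux (zk _); rewrite conjc_eq0 zk.
  rewrite /cavg normcM normcV natr_complex normc_real ger0_norm//.
  rewrite /avg !mulrA mulrAC ler_pM2r ?invr_gt0 ?ltr0n//.
  apply: le_trans (normc_sum _ _ _) _.
  rewrite mulr_sumr mulr_suml; apply: ler_sum => j _.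
  rewrite normcM normcV normcX normc_circ ?(ltW r0)// ler_pM2r ?invr_gt0 ?exprn_gt0//.
  rewrite /u; case: (P _) => x y /=.
  rewrite subrr expr0n addr0 sqrtr_sqr -mulr2n normrMn mulr_natl //.
have h4 : 2 * avg u n / r ^+ k @[n --> \oo] --> 2 * mean u / r ^+ k.
  apply: cvgM; last exact: cvg_cst.
  by apply: cvgM; [exact: cvg_cst|exact: avg_cvg].
have := clim_le_cvg h3 bd h4.
rewrite ler_pdivlMr ?exprn_gt0// => h5; apply: le_trans h5 _; lra.
Qed.

End unit_function.

End zero_free_entire.

(** * Exceptional sets and the logarithmic derivative lemma *)

Section logarithmic_derivatives.
Variable R : realType.
Local Notation C := R[i].
Implicit Types (f g : C -> C) (z w d : C).

Definition exc (P : R -> Prop) := exists E : set R, [/\ measurable E,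
  (lebesgue_measure E < +oo)%E & forall r, 0 < r -> ~ E r -> P r].

Lemma exc_and (P Q : R -> Prop) : exc P -> exc Q -> exc (fun r => P r /\ Q r).
Proof.
move=> [E [Em Ef EP]] [F [Fm Ff FQ]]; exists (E `|` F); split.
- exact: measurableU.
- apply: (@le_lt_trans _ _ (lebesgue_measure E + lebesgue_measure F)%E).
    exact: measureU2.
  by rewrite lte_add_pinfty.
- by move=> r r0 /not_orP[/EP hP /FQ hQ]; split; [exact: hP|exact: hQ].
Qed.

Lemma exc_imp (P Q : R -> Prop) : (forall r, 0 < r -> P r -> Q r) -> exc P -> exc Q.
Proof.
move=> PQ [E [Em Ef EP]]; exists E; split => // r r0 Er.
by apply: PQ => //; exact: EP.
Qed.

Lemma exc_large (P : R -> Prop) (r0 : R) : (forall r, r0 <= r -> P r) -> exc P.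
Proof.
move=> h; exists [set` `[0, `|r0| + 1]]; split.
- exact: measurable_itv.
- by rewrite lebesgue_measure_itv; case: ifP => _ //=; rewrite ?ltry//= sube0 ltry.
- move=> r rp /negP; rewrite /= in_itv /= (ltW rp) /= -ltNge => hr.
  by apply: h; rewrite (le_trans (ler_norm _))// ltW// (lt_trans _ hr)// ltrDl.
Qed.

Lemma exc_countable (A : set R) : countable A -> exc (fun r => ~ A r).
Proof.
move=> cA; exists A; split => //.
- exact: countable_measurable.
- by rewrite countable_lebesgue_measure0 ?ltry.
Qed.

(** Otherwise the exceptional set would contain intervals of every length n. *)
Lemma exc_unbounded (P : R -> Prop) (M : R) : exc P -> exists r, [/\ M < r, 0 < r & P r].
Proof.
move=> [E [Em Ef EP]]; apply: contrapT => H.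
have sub n : [set` `]`|M|, `|M| + n%:R]] `<=` E.
  move=> r; rewrite /= in_itv /= => /andP[r1 r2]; apply: contrapT => Er; apply: H.
  have r0 : 0 < r by rewrite (le_lt_trans _ r1).
  exists r; split => //; last exact: EP.
  by rewrite (le_lt_trans _ r1)// ler_norm.
have h n : (n%:R%:E <= lebesgue_measure E)%E.
  pose J : set R := [set` `]`|M|, `|M| + n%:R]].
  have h1 : (lebesgue_measure J <= lebesgue_measure E)%E.
    by apply: le_measure; [rewrite inE; exact: measurable_itv|rewrite inE|exact: sub].
  apply: le_trans h1; rewrite /J.
  rewrite lebesgue_measure_itv /= lte_fin ltrDl ltr0n.
  case: posnP => [->//|n0].
  by rewrite -EFinD lee_fin addrAC subrr add0r.
have Efin : lebesgue_measure E \is a fin_num.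
  by rewrite ge0_fin_numE// measure_ge0.
have := archi_boundP (fine_ge0 (measure_ge0 lebesgue_measure E)).
rewrite ltNge => /negP; apply.
by rewrite -lee_fin fineK.
Qed.

Lemma pow2_bracket (x : R) : 1 <= x -> exists n, 2 ^+ n <= x < 2 ^+ n.+1.
Proof.
move=> x1.
have ex : exists n, x < 2 ^+ n.
  exists (Num.bound x); rewrite (lt_trans (lt_bound x))//.
  by rewrite -natrX ltr_nat ltn_expl.
case: (ex_minnP ex) => -[|n] hn hmin; first by move: hn; rewrite expr0 ltNge x1.
by exists n; rewrite hn andbT leNgt; apply/negP => /hmin; rewrite ltnn.
Qed.

(* The exceptional set is covered by the intervals [s_n - 2^-n, s_n], where s_n is
   the radius at which tau reaches 2^(n+1). *)
Lemma borel_growth (tau : R -> R) :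
  (forall r s, 0 < r -> r <= s -> tau r <= tau s) ->
  (forall M, exists2 r, 0 < r & M <= tau r) ->
  exc (fun r => 1 <= tau r -> tau (r + (tau r)^-1) <= 2 * tau r).
Proof.
move=> mon unb.
pose A n := [set r | 0 < r /\ 2 ^+ n.+1 <= tau r].
pose s n := inf (A n).
have A0 n : A n !=set0 by have [r r0 hr] := unb (2 ^+ n.+1); exists r.
have Alb n : has_lbound (A n) by exists 0 => r [r0 _]; exact: ltW.
pose F n : set R := [set` `[s n - (2 ^+ n)^-1, s n]].
have Fv n : (lebesgue_measure (F n) <= (2 / (2 ^ n.+1)%:R)%:E)%E.
  rewrite lebesgue_measure_itv /= lte_fin ltrBlDr ltrDl invr_gt0 exprn_gt0//.
  rewrite -EFinB lee_fin opprB addrCA subrr addr0.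
  by rewrite natrX exprS invfM mulrA divff// mul1r.
have Fm n : measurable (F n) by exact: measurable_itv.
exists (\bigcup_n F n); split.
- exact: bigcupT_measurable.
- apply: le_lt_trans (measure_sigma_subadditive lebesgue_measure Fm
    (bigcupT_measurable F Fm) (@subset_refl _ _)) _.
  apply: le_lt_trans (_ : (\sum_(0 <= i <oo | true) (0 + (2 / (2 ^ i.+1)%:R)%:E) < +oo)%E).
    apply: lee_nneseries => [n _ _|n _]; first exact: measure_ge0.
    by rewrite add0r; exact: Fv.
  apply: le_lt_trans (epsilon_trick _ _ _) _ => //.
  by rewrite eseries0// add0r ltry.
move=> r r0 Er t1.
rewrite leNgt; apply/negP => big.
have [n /andP[n1 n2]] := pow2_bracket t1.
have tp : 0 < tau r by rewrite (lt_le_trans _ t1).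
have h1 : s n <= r + (tau r)^-1.
  apply: ge_inf => //; split; first by rewrite addr_gt0// invr_gt0.
  by rewrite (le_trans _ (ltW big))// exprS ler_pM2l.
have h2 : (tau r)^-1 <= (2 ^+ n)^-1 by rewrite lef_pV2 ?posrE ?exprn_gt0.
apply: Er; exists n => //; rewrite /F /= in_itv /=; apply/andP; split.
  by rewrite lerBlDr (le_trans h1)// lerD2l.
(* By monotonicity no point of [A n] lies below r, since tau r < 2^(n+1). *)
apply: lb_le_inf => // y [y0 hy]; rewrite leNgt; apply/negP => yr.
have := mon _ _ y0 (ltW yr); rewrite leNgt => /negP; apply.
exact: lt_le_trans hy.
Qed.

Lemma PS_abs f a (rho M : R) z : PS f a -> 0 < rho -> 0 <= M ->
  (forall k, normc (a k) * rho ^+ k <= M) -> normc z < rho ->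
  normc (f z) <= M * rho / (rho - normc z).
Proof.
move=> fa r0 M0 hM zr; apply/ler_addgt0Pr => e e0.
have [n hn] := PS_ball fa (normc_ge0 z) e0.
have {}hn := hn n (leqnn _) z (lexx _).
have q0 : 0 <= normc z / rho by rewrite divr_ge0 ?normc_ge0// ltW.
have q1 : normc z / rho < 1 by rewrite ltr_pdivrMr// mul1r.
set S := \sum_(k < n) _ in hn.
have hS : normc S <= M * rho / (rho - normc z).
  apply: le_trans (normc_sum _ _ _) _.
  apply: le_trans (_ : \sum_(k < n) M * (normc z / rho) ^+ k <= _).
    apply: ler_sum => k _; rewrite normcM normcX expr_div_n mulrA ler_pdivlMr ?exprn_gt0//.
    by rewrite mulrAC ler_wpM2r ?exprn_ge0 ?normc_ge0.
  rewrite -mulr_sumr -mulrA ler_wpM2l//.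
  have E : rho / (rho - normc z) = (1 - normc z / rho)^-1.
    by field; rewrite subr_eq0 !gt_eqF// subr_gt0.
  rewrite E -[leRHS]mul1r ler_pdivlMr ?subr_gt0// mulrC -opprB mulNr -subrX1 opprB.
  by rewrite lerBlDr lerDl exprn_ge0.
have -> : f z = S + (f z - S) by ring.
by apply: le_trans (normcD _ _) _; rewrite lerD.
Qed.

(** For q = f' / f this is f^(k) / f, written as a differential polynomial in [q], so that only [q]
    has to be bounded. *)
Fixpoint logD (q : C -> C) (k : nat) : C -> C :=
  if k is k'.+1 then fun z => D (logD q k') z + logD q k' z * q z else fun=> 1.

Lemma logD_holo q k : holo q -> holo (logD q k).
Proof.
move=> qh; elim: k => [|k IH] /=; first exact: holo_cst.
by apply: holoD; [exact: holo_Dfun|exact: holoM].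
Qed.

Lemma iterD_holo f k : holo f -> holo (iter k (@D R) f).
Proof. by move=> fh; elim: k => [//|k IH] /=; exact: holo_Dfun. Qed.

Lemma iterD_logD f q k : holo f -> holo q -> (forall z, D f z = f z * q z) ->
  forall z, iter k (@D R) f z = f z * logD q k z.
Proof.
move=> fh qh fq; elim: k => [|k IH] z /=; first by rewrite mulr1.
rewrite (_ : iter k (@D R) f = fun w => f w * logD q k w); last exact/funext.
rewrite (D_eq (cdiffM (DP z fh) (DP z (logD_holo k qh)))) fq.
by ring.
Qed.

Lemma cauchy_D f z (r B : R) : holo f -> 0 < r ->
  (forall w, normc w <= normc z + r -> normc (f w) <= B) -> normc (D f z) <= B / r.
Proof.
move=> fh r0 hB; apply: analytic_cauchy_D => //; first exact: holo_analytic.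
move=> t; apply: hB; apply: le_trans (normcD _ _) _; rewrite normc_circ//.
exact: ltW.
Qed.

Lemma logD_bound q (rho d Q : R) (n : nat) : holo q -> 0 < d -> 0 <= Q ->
  (forall z, normc z <= rho + n%:R * d -> normc (q z) <= Q) ->
  forall k z, (k <= n)%N -> normc z <= rho + (n - k)%:R * d ->
    normc (logD q k z) <= (d^-1 + Q) ^+ k.
Proof.
move=> qh d0 Q0 hQ; elim=> [|k IH] z kn zn; first by rewrite expr0 /logD normc1.
rewrite -[logD q k.+1 z]/(D (logD q k) z + logD q k z * q z).
have e : (n - k)%:R = (n - k.+1)%:R + 1 :> R by rewrite natr1 -subSn// subSS.
apply: le_trans (normcD _ _) _; rewrite exprSr mulrDr lerD//.
  apply: (cauchy_D (logD_holo k qh) d0) => w wz; apply: IH; first exact: ltnW.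
  by rewrite (le_trans wz)// e mulrDl mul1r addrA lerD2r.
rewrite normcM ler_pM ?normc_ge0//.
  apply: IH; first exact: ltnW.
  by rewrite (le_trans zn)// lerD2l ler_pM2r// e lerDl.
apply: hQ; rewrite (le_trans zn)// lerD2l ler_pM2r// ler_nat leq_subr//.
Qed.

(** This is ln y <= y - 1 at y = e x; it absorbs a logarithm into an arbitrarily small multiple of
    its argument. *)
Lemma ln_le_lin (x e : R) : 0 < x -> 0 < e -> ln x <= e * x - ln e.
Proof.
move=> x0 e0; have h := le_ln1Dx (_ : -1 < e * x - 1).
have : ln (e * x) <= e * x - 1.
  have := h; rewrite (addrC 1) subrK; apply; by rewrite ltrBrDl subrr mulr_gt0.
by rewrite lnM// => ?; lra.
Qed.

Lemma const_of_D0 f : holo f -> (forall z, D f z = 0) -> forall z, f z = f 0.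
Proof.
move=> fh f0 z; have := @cdiff_mvt R (fun w => f (0 + z * w)) (fun=> 0) 0.
rewrite mulr1 !mulr0 !add0r => h.
apply/eqP; rewrite -subr_eq0 -normc_eq0; apply/eqP/le_anti; rewrite normc_ge0 andbT.
have := h _ _; rewrite normc0; apply => // s _.
by have := cdiff_affine (DP (0 + z * s%:C) fh); rewrite f0 mul0r.
Qed.

(** * The logarithmic derivative lemma for a finite family *)

Section log_derivative.
Variables (I : finType) (v : I -> C -> C).
Hypothesis vh : forall i, holo (v i).
Hypothesis v0 : forall i z, v i z != 0.
Hypothesis vnc : exists i, exists z, v i z != v i 0.

Let Lg : exists (P : I -> C -> C) (p : I -> nat -> C), forall i,
  [/\ holo (P i), P i 0 = 0, forall z, D (P i) z = D (v i) z / v i z,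
      forall z, lnc (v i z) = lnc (v i 0) + Re (P i z) & PS (P i) (p i)].
Proof.
have [P hP] := choice (fun i => unit_log (vh i) (v0 i)).
have [p hp] := choice (fun i => holo_PS (let: And4 h _ _ _ := hP i in h)).
by exists P, p => i; case: (hP i) => a b c d; split => //; exact: hp.
Qed.

Definition Tsum (r : R) := \sum_i Tc (v i) r.

Lemma Tsum_ge i r : Tc (v i) r <= Tsum r.
Proof.
by rewrite /Tsum (bigD1 i)//= lerDl sumr_ge0// => j _; exact: Tc_ge0.
Qed.

(* Here tau r is the supremum of normc (p i k) * r ^ k, where P i is the logarithm of
   v i: it is monotone, at least linear in r and at most of the order of Tsum. *)
Lemma log_size : exists (tau : R -> R) (c c1 : R) (p : I -> nat -> C) (P : I -> C -> C),
  [/\ forall r s, 0 < r -> r <= s -> tau r <= tau s,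
      0 < c /\ forall r, 1 <= r -> c * r <= tau r,
      0 <= c1 /\ forall r, 0 < r -> tau r <= 4 * (Tsum r + c1),
      forall i, [/\ holo (P i), PS (P i) (p i) & forall z, D (v i) z = v i z * D (P i) z] &
      forall i k r, 0 < r -> normc (p i k) * r ^+ k <= tau r].
Proof.
have [P [p hP]] := Lg.
pose S r := [set x | exists i k, x = normc (p i k) * r ^+ k].
pose c1 : R := \sum_i `|lnc (v i 0)|.
have c10 : 0 <= c1 by apply: sumr_ge0.
have Sb r : 0 < r -> ubound (S r) (4 * (Tsum r + c1)).
  move=> r0 _ [i [k ->]]; have [h1 h2 h3 h4 h5] := hP i.
  apply: le_trans (log_coef_bound (vh i) (v0 i) k h1 h2 h4 h5 r0) _.
  rewrite ler_pM2l// lerD ?Tsum_ge// /c1 (bigD1 i)//= lerDl sumr_ge0//.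
have [i0 [z0 hz0]] := vnc.
have S0 r : S r !=set0 by exists (normc (p i0 0%N) * r ^+ 0), i0, 0%N.
have up i k r : 0 < r -> normc (p i k) * r ^+ k <= sup (S r).
  by move=> r0; apply: ub_le_sup; [exists (4 * (Tsum r + c1)); exact: Sb|exists i, k].
(* A nonconstant [v i0] has a nonconstant logarithm; its nonzero coefficient of positive index
   yields the linear growth of tau. *)
have [k [k0 pk]] : exists k, (0 < k)%N /\ p i0 k != 0.
  apply: contrapT => H; move/eqP: hz0; apply; apply: const_of_D0 => // z.
  have [h1 h2 h3 h4 h5] := hP i0.
  have P0 w : P i0 w = 0.
    apply: (PS_zero h5) => -[|k]; first by rewrite -(PS_0 h5).
    by apply/eqP/negPn/negP => pk; apply: H; exists k.+1.
  have D0 : D (P i0) z = 0.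
    by apply: D_eq; rewrite (_ : P i0 = fun=> 0); [exact: cdiff_cst|apply/funext].
  by have := h3 z; rewrite D0 => /esym/eqP; rewrite mulf_eq0 invr_eq0 (negbTE (v0 _ _)) orbF => /eqP.
exists (fun r => sup (S r)), (normc (p i0 k)), c1, p, P; split.
- move=> r s r0 rs; apply: ge_sup => // _ [i [j ->]].
  have s0 : 0 < s by exact: lt_le_trans rs.
  apply: le_trans (up i j s s0); rewrite ler_wpM2l ?normc_ge0//.
  by apply: lerXn2r => //; rewrite nnegrE ltW.
- split; first by rewrite normc_gt0.
  move=> r r1; apply: le_trans (up i0 k r (lt_le_trans ltr01 r1)).
  rewrite ler_wpM2l ?normc_ge0//.
  case: k k0 pk => // k _ _; rewrite exprS ler_peMr ?(le_trans ler01)//.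
  exact: exprn_ege1.
- split => // r r0; apply: ge_sup => //; exact: Sb.
- move=> i; have [h1 h2 h3 h4 h5] := hP i; split => // z.
  by rewrite h3 mulrCA divff ?mulr1.
- by move=> i j r; exact: up.
Qed.

Lemma Tsum_large (M : R) : exists r0, forall r, r0 <= r -> M <= Tsum r.
Proof.
have [tau [c [c1 [p [P [_ [c0 hc] [c10 hc1] _ _]]]]]] := log_size.
exists (Num.max 1 ((4 * (`|M| + c1)) / c)) => r; rewrite ge_max => /andP[r1 r2].
have h1 := hc r r1; have h2 := hc1 r (lt_le_trans ltr01 r1).
move: r2; rewrite ler_pdivrMr// mulrC => r2; have := ler_norm M; lra.
Qed.

(** Where [borel_growth] applies, tau at most doubles as r grows by 1 / tau r. Cauchy estimates in
    that ring bound the derivatives of v_i, divided by v_i, by a power of tau r, whose logarithm is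
    a small multiple of [Tsum r] for large r. One tau gives one [b] and one exceptional set for all
    [i] and [k]. *)
Lemma log_derivative_lemma (K : nat) (eps : R) : 0 < eps ->
  exc (fun r => exists2 b : R, 0 <= b <= eps * Tsum r &
    forall i k z, (k <= K)%N -> normc z = r ->
      normc (iter k (@D R) (v i) z) <= expR b * normc (v i z)).
Proof.
move=> e0.
have [tau [c [c1 [p [P [mon [c0 hc] [c10 hc1] hP up]]]]]] := log_size.
have unb M : exists2 r, 0 < r & M <= tau r.
  exists (Num.max 1 (M / c)); first by rewrite lt_max ltr01.
  have m1 : 1 <= Num.max 1 (M / c) by rewrite le_max lexx.
  apply: le_trans (hc _ m1); rewrite mulrC -ler_pdivrMr// le_max lexx orbT//.
(* The ring is cut into K + 3 steps of width d: K + 1 for [logD_bound], one to pass from [P i] to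
   its derivative, and one to keep away from radius r', where the bound of [PS_abs] blows up. *)
pose N : R := K.+3%:R.
have N0 : 0 < N by rewrite ltr0n.
have N1 : 1 <= N by rewrite ler1n.
pose C0 : R := N ^+ 2 * (1 + 2 * (c^-1 + 1)).
have C00 : 0 < C0 by rewrite mulr_gt0 ?exprn_gt0// addr_gt0// mulr_gt0// addr_gt0 ?invr_gt0.
pose Kr : R := K.+1%:R.
have Kr0 : 0 < Kr by rewrite ltr0n.
pose eta := eps / (64 * Kr).
have eta0 : 0 < eta by rewrite divr_gt0// mulr_gt0.
pose C1 := Kr * (`|ln C0| + 4 * `|ln eta|).
(* The last entry gives C1 <= eps tau / 16, and [eta] was chosen so that the other part of
   [Kr * ln B] is also eps tau / 16. The entry 8 c1 turns the size bound into tau <= 8 Tsum, so the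
   sum is at most eps Tsum. *)
pose t0 := Num.max 1 (Num.max (8 * c1) (16 * C1 / eps)).
have := borel_growth mon unb.
have [r1 hr1] : exists r1, forall r, r1 <= r -> t0 <= tau r /\ 1 <= r.
  exists (Num.max 1 (t0 / c)) => r; rewrite ge_max => /andP[h1 h2]; split => //.
  by apply: le_trans (hc _ h1); rewrite mulrC -ler_pdivrMr.
move=> /exc_and/(_ (exc_large hr1)); apply: exc_imp => r r0 [big [ht rr1]].
move: ht; rewrite !ge_max => /and3P[t1 t2 t3].
have {}big := big t1.
have tp : 0 < tau r by rewrite (lt_le_trans _ t1).
pose d := (tau r)^-1 / N.
have d0 : 0 < d by rewrite divr_gt0// invr_gt0.
pose r' := r + (tau r)^-1.
have r'E : r' = r + N * d by rewrite /r' /d mulrCA divff ?mulr1// lt0r_neq0.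
have r'0 : 0 < r' by rewrite addr_gt0// invr_gt0.
have N_E : N = K.+2%:R + 1 by rewrite /N natr1.
pose Q := 2 * tau r * r' / d / d.
have Q0 : 0 <= Q.
  by rewrite /Q divr_ge0 ?(ltW d0)// divr_ge0 ?(ltW d0)// mulr_ge0 ?(ltW r'0)// mulr_ge0// ltW.
have DPb i z : normc z <= r + K.+1%:R * d -> normc (D (P i) z) <= Q.
  move=> zr; have [Ph Pp _] := hP i; apply: (cauchy_D Ph d0) => w wz.
  have wr : normc w <= r' - d.
    rewrite r'E N_E mulrDl mul1r addrA addrK (le_trans wz)//.
    by rewrite -[K.+2%:R]natr1 mulrDl mul1r addrA lerD2r.
  have wr' : normc w < r' by rewrite (le_lt_trans wr)// ltrBlDr ltrDl.
  have tp' : 0 <= tau r' by rewrite (le_trans (ltW tp))// mon// lerDl invr_ge0 ltW.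
  apply: le_trans (PS_abs Pp r'0 tp' (fun k => up i k r' r'0) wr') _.
  apply: le_trans (_ : 2 * tau r * r' / (r' - normc w) <= _).
    rewrite ler_pM2r ?invr_gt0 ?subr_gt0// ler_pM2r//.
  rewrite ler_pM2l ?mulr_gt0// lef_pV2 ?posrE ?subr_gt0//.
  by rewrite lerBrDr addrC -lerBrDr.
pose B := d^-1 + Q.
have B1 : 1 <= B.
  rewrite /B (le_trans _ (_ : d^-1 <= _)) ?lerDl//.
  by rewrite /d invfM !invrK -[leLHS]mulr1 ler_pM.
have BC : B <= C0 * tau r ^+ 4.
  have r'x : r' <= tau r * (c^-1 + 1).
    rewrite mulrDr mulr1 /r' lerD//; last by rewrite (le_trans _ t1)// invf_le1.
    by rewrite ler_pdivlMr// mulrC; exact: hc.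
  have dE : d^-1 = tau r * N by rewrite /d invfM !invrK.
  have -> : B = N * tau r + N ^+ 2 * (2 * tau r ^+ 3 * r').
    by rewrite /B /Q dE; ring.
  have -> : C0 * tau r ^+ 4 = N ^+ 2 * tau r ^+ 4 +
      N ^+ 2 * (2 * tau r ^+ 3 * (tau r * (c^-1 + 1))) by rewrite /C0; ring.
  apply: lerD.
    apply: ler_pM; rewrite ?(ltW N0) ?(ltW tp)//; first by rewrite ler_eXnr.
    by rewrite ler_eXnr.
  rewrite ler_pM2l ?exprn_gt0// ler_pM2l// mulr_gt0// exprn_gt0//.
exists (Kr * ln B).
  rewrite mulr_ge0 ?(ltW Kr0) ?ln_ge0//=.
  have h1 : ln B <= `|ln C0| + 4 * (eta * tau r + `|ln eta|).
    apply: le_trans (_ : ln (C0 * tau r ^+ 4) <= _).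
      rewrite ler_ln// posrE ?(lt_le_trans _ B1)// mulr_gt0// exprn_gt0//.
    rewrite lnM ?posrE ?exprn_gt0// lnXn//.
    have a1 := ln_le_lin tp eta0; have a2 := ler_norm (ln C0).
    have a3 := ler_norm (- ln eta); rewrite normrN in a3.
    rewrite -[ln _ *+ 4]mulr_natl; apply: lerD => //.
    by rewrite ler_pM2l//; lra.
  have h2 : Kr * ln B <= C1 + eps * tau r / 16.
    apply: le_trans (ler_wpM2l (ltW Kr0) h1) _.
    have -> : eps * tau r / 16 = Kr * (4 * (eta * tau r)).
      by rewrite /eta; field; exact: lt0r_neq0.
    by rewrite /C1 -mulrDr; apply: eq_ler; ring.
  have h3 : C1 <= eps * tau r / 16.
    by move: t3; rewrite ler_pdivrMr// => t3; lra.
  have h4 : tau r <= 8 * Tsum r by have := hc1 r r0; lra.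
  have h5 : eps * tau r <= eps * (8 * Tsum r) by rewrite ler_pM2l.
  lra.
move=> i k z kK zr; have [Ph Pp PD] := hP i.
have qh := holo_Dfun Ph.
rewrite (iterD_logD k (vh i) qh PD) normcM mulrC ler_wpM2r ?normc_ge0//.
have := logD_bound qh d0 Q0 (DPb i) (_ : (k <= K.+1)%N) (_ : normc z <= _) .
move=> /(_ (leqW kK)) h; apply: le_trans (h _) _.
  by rewrite zr lerDl mulr_ge0// ltW.
rewrite -/B; apply: le_trans (_ : B ^+ K.+1 <= _).
  by rewrite ler_weXn2l// leqW.
rewrite /Kr expRM_natl lnK// posrE; exact: lt_le_trans B1.
Qed.

End log_derivative.

End logarithmic_derivatives.

(** * Wronskians and Borel's theorem *)

Section wronskians.
Variable R : realType.
Local Notation C := R[i].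
Implicit Types (f g : C -> C) (z w d : C).

Lemma holo_det n (A : 'I_n -> 'I_n -> C -> C) : (forall i j, holo (A i j)) ->
  holo (fun z => \det (\matrix_(i, j) A i j z)).
Proof.
move=> h; rewrite (_ : (fun z => _) = fun z => \sum_(s : 'S_n) (-1) ^+ s * \prod_i A i (s i) z).
  apply: holo_sum => s _; apply: holoM; first exact: holo_cst.
  by apply: holo_prod => i _; exact: h.
apply/funext => z; rewrite /determinant; apply: eq_bigr => s _.
by congr (_ * _); apply: eq_bigr => i _; rewrite mxE.
Qed.

(** Every term of the permutation expansion meets each column once, so the column weights always
    multiply to the full product. *)
Lemma det_bound n (A : 'M[C]_n) (x : 'I_n -> R) (b : R) : 0 <= b -> (forall i, 0 <= x i) ->
  (forall k i, normc (A k i) <= b * x i) -> normc (\det A) <= n`!%:R * b ^+ n * \prod_i x i.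
Proof.
move=> b0 x0 hA; rewrite /determinant; apply: le_trans (normc_sum _ _ _) _.
apply: le_trans (_ : \sum_(s : 'S_n) b ^+ n * \prod_i x i <= _); last first.
  by rewrite sumr_const card_Sn -[leLHS]mulr_natl mulrA.
apply: ler_sum => s _; rewrite normcM normcX normcN normc1 expr1n mul1r normc_prod.
apply: le_trans (_ : \prod_i (b * x (s i)) <= _).
  by apply: ler_prod => i _; rewrite normc_ge0 hA.
rewrite big_split /= prodr_const card_ord ler_wpM2l ?exprn_ge0//.
by rewrite [leRHS](reindex_inj (@perm_inj _ s)).
Qed.

(** The quotient f / g could have poles, so e = f - c g is studied instead: it vanishes at z0 and
    satisfies the same relation. A zero of exact order m + 1 there would give e' g - e g' the exact
    order m, as g(z0) <> 0. *)
Lemma proportional f g : holo f -> holo g -> (exists z, g z != 0) ->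
  (forall z, D f z * g z = f z * D g z) -> exists c, forall z, f z = c * g z.
Proof.
move=> fh gh [z0 gz0] fg; exists (f z0 / g z0).
set c := f z0 / g z0.
pose e z := f z - c * g z.
have eh : holo e by apply: holoB => //; apply: holoM => //; exact: holo_cst.
have De z : D e z = D f z - c * D g z.
  by apply: D_eq; apply: cdiffB; [exact: DP|apply: cdiffZ; exact: DP].
have [ne|] := pselect (exists w, e w != 0); last first.
  move=> H z; apply/eqP; rewrite -subr_eq0; apply/negPn/negP => ez.
  by apply: H; exists z.
exfalso.
have [m [k [kh k0 kE]]] := holo_factor z0 eh ne.
have ez0 : e z0 = 0 by rewrite /e /c divfK ?subrr.
case: m kE => [|m] kE; first by move: k0; have := kE z0; rewrite expr0 mul1r ez0 => <-; rewrite eqxx.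
have subh : holo (fun w => w - z0) by exact: holo_subc.
have Dk z : D e z = m.+1%:R * (z - z0) ^+ m * k z + (z - z0) ^+ m.+1 * D k z.
  apply: D_eq; rewrite (_ : e = fun w => (w - z0) ^+ m.+1 * k w); last exact/funext.
  apply: cdiffM; last exact: DP.
  have := cdiffX m.+1 (cdiffB (cdiff_id z) (cdiff_cst z0 z)).
  by rewrite subr0 mulr1.
have bh : holo (fun z => m.+1%:R * k z * g z + (z - z0) * (D k z * g z - k z * D g z)).
  apply: holoD; first by apply: holoM => //; apply: holoM => //; exact: holo_cst.
  apply: holoM => //; apply: holoB; first by apply: holoM => //; exact: holo_Dfun.
  by apply: holoM => //; exact: holo_Dfun.
have [|H|H] := holo_mul_eq0 (holoX m subh) bh.
- move=> z; have : D e z * g z - e z * D g z = 0.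
    by rewrite De /e !mulrBl fg; ring.
  by rewrite Dk kE => <-; rewrite exprS; ring.
- have := H (z0 + 1); rewrite addrAC subrr add0r expr1n => /eqP.
  by rewrite oner_eq0.
have := H z0; rewrite subrr mul0r addr0 => /eqP.
by rewrite !mulf_eq0 pnatr_eq0 (negbTE k0) (negbTE gz0).
Qed.

Definition wronskian n (phi : 'I_n -> C -> C) z : C :=
  \det (\matrix_(k, i) iter k (@D R) (phi i) z).

Lemma wronskian_holo n (phi : 'I_n -> C -> C) : (forall i, holo (phi i)) ->
  holo (wronskian phi).
Proof.
move=> h; apply: (@holo_det n (fun k i => iter k (@D R) (phi i))) => k i.
exact: iterD_holo.
Qed.

Lemma sum_eliminate n (a b c : 'I_n -> C) (p u v : C) :
  \sum_i a i * b i + p * u = 0 -> \sum_i a i * c i + p * v = 0 ->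
  \sum_i (a i * b i * v - a i * c i * u) = 0.
Proof.
move=> /eqP; rewrite addr_eq0 => /eqP h1 /eqP; rewrite addr_eq0 => /eqP h2.
by rewrite sumrB -!mulr_suml h1 h2; ring.
Qed.

(* Induction on n: unless the Wronskian of the first n functions vanishes, the
   cofactors of the last row solve the linear system for all z, and differentiating
   the system shows that their ratios are constant. *)
Lemma wronskian_dep n (phi : 'I_n -> C -> C) : (forall i, holo (phi i)) ->
  (forall z, wronskian phi z = 0) ->
  exists c : 'I_n -> C, (exists i, c i != 0) /\ forall z, \sum_i c i * phi i z = 0.
Proof.
elim: n phi => [|n IH] phi ph W0.
  by have := W0 0; rewrite /wronskian det_mx00 => /eqP; rewrite oner_eq0.
pose psi i := phi (lift ord_max i).
have psih i : holo (psi i) by exact: ph.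
have [Wn|] := pselect (forall z, wronskian psi z = 0).
  have [c [[i ci] hc]] := IH psi psih Wn.
  exists (fun j => if unlift ord_max j is Some k then c k else 0); split.
    by exists (lift ord_max i); rewrite liftK.
  move=> z; rewrite big_ord_recr /= unlift_none mul0r addr0 -[RHS](hc z).
  apply: eq_bigr => j _.
  have -> : widen_ord (leqnSn n) j = lift ord_max j by apply: val_inj; rewrite /= /bump leqNgt ltn_ord.
  by rewrite liftK.
move=> /existsNP[z0 /eqP Wz0].
pose M z := \matrix_(k, i) iter k (@D R) (phi i) z : 'M[C]_n.+1.
pose Cf i z := cofactor (M z) ord_max i.
have Cfh i : holo (Cf i).
  rewrite /Cf (_ : (fun z => _) = fun z => (-1) ^+ (@ord_max n + i) *
    \det (\matrix_(k, j) iter (lift ord_max k) (@D R) (phi (lift i j)) z)).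
    apply: holoM; first exact: holo_cst.
    apply: (@holo_det n (fun k j => iter (lift ord_max k) (@D R) (phi (lift i j)))) => k j.
    exact: iterD_holo.
  apply/funext => z; rewrite /cofactor; congr (_ * \det _).
  by apply/matrixP => k j; rewrite !mxE.
have CfW z : Cf ord_max z = wronskian psi z.
  rewrite /Cf /cofactor addnn -mul2n exprM sqrrN expr1n expr1n mul1r; congr (\det _).
  by apply/matrixP => k j; rewrite !mxE /psi lift_max.
have rel (k : 'I_n.+1) z : \sum_i iter k (@D R) (phi i) z * Cf i z = 0.
  have := congr1 (fun A : 'M[C]_(n.+1) => A k ord_max) (mul_mx_adj (M z)).
  rewrite (_ : \det (M z) = 0); last exact: W0.
  rewrite !mxE mul0rn => E; rewrite -[RHS]E; apply: eq_bigr => i _.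
  by rewrite !mxE.
(* Differentiating relation k produces relation k + 1, which vanishes too, and leaves this one. The
   last row is excluded so that k + 1 is still a row. *)
have rel' (k : 'I_n) z : \sum_i iter k (@D R) (phi i) z * D (Cf i) z = 0.
  have kh i : holo (iter k (@D R) (phi i)) by exact: iterD_holo.
  have h : cdiff (fun z => \sum_i iter k (@D R) (phi i) z * Cf i z) z
     (\sum_i (iter k.+1 (@D R) (phi i) z * Cf i z + iter k (@D R) (phi i) z * D (Cf i) z)).
    by apply: cdiff_sum => i _; apply: cdiffM; exact: DP.
  have E : (fun z => \sum_i iter k (@D R) (phi i) z * Cf i z) = fun=> 0.
    apply/funext => w; have := rel (widen_ord (leqnSn n) k) w; exact.
  rewrite E in h; have := cdiff_unique h (cdiff_cst 0 z).
  rewrite big_split /= => H; rewrite -[RHS]H.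
  have R1 : \sum_(i < n.+1) D (iter k (@D R) (phi i)) z * Cf i z = 0.
    exact: (rel (lift ord0 k) z).
  by rewrite R1 add0r.
have prop i : exists c, forall z, Cf (lift ord_max i) z = c * Cf ord_max z.
  apply: proportional => //; first by exists z0; rewrite CfW.
  pose d j z := D (Cf (lift ord_max j)) z * Cf ord_max z - Cf (lift ord_max j) z * D (Cf ord_max) z.
  have dh j : holo (d j).
    by apply: holoB; apply: holoM => //; exact: holo_Dfun.
  (* Eliminating the last unknown from both systems leaves a homogeneous one with the matrix of
     [psi], so [d j] vanishes wherever that determinant does not; the product form then extends this
     to the plane. *)
  have dz j z : wronskian psi z * d j z = 0.
    have [->|Wz] := eqVneq (wronskian psi z) 0; first by rewrite mul0r.
    suff -> : d j z = 0 by rewrite mulr0.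
    pose A := \matrix_(k, i) iter k (@D R) (psi i) z : 'M[C]_n.
    pose x : 'cV[C]_n := \col_i d i z.
    have Ax : A *m x = 0.
      apply/colP => k; rewrite !mxE.
      have h1 := rel' k z; have h2 := rel (widen_ord (leqnSn n) k) z.
      have w j' : widen_ord (leqnSn n) j' = lift ord_max j'.
        by apply: val_inj; rewrite /= /bump leqNgt ltn_ord.
      move: h1 h2; rewrite !big_ord_recr /=.
      rewrite (eq_bigr (fun i => iter k (@D R) (psi i) z * D (Cf (lift ord_max i)) z)); last first.
        by move=> j' _; rewrite w.
      move=> h1.
      rewrite (eq_bigr (fun i => iter k (@D R) (psi i) z * Cf (lift ord_max i) z)); last first.
        by move=> j' _; rewrite w.
      move=> h2.
      rewrite (eq_bigr (fun i => (iter k (@D R) (psi i) z * D (Cf (lift ord_max i)) z) * Cf ord_max z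
        - (iter k (@D R) (psi i) z * Cf (lift ord_max i) z) * D (Cf ord_max) z)); last first.
        by move=> j' _; rewrite !mxE /d mulrBr !mulrA.
      exact: (sum_eliminate h1 h2).
    have Au : A \in unitmx by rewrite unitmxE unitfE.
    have := mulKmx Au x; rewrite Ax mulmx0 => /colP/(_ j); rewrite !mxE => <-//.
  have [H|H] := holo_mul_eq0 (wronskian_holo psih) (dh i) (dz i).
  - by have := H z0 => H0; rewrite H0 eqxx in Wz0.
  - by move=> z; apply/eqP; rewrite -subr_eq0; apply/eqP; exact: H.
have [c hc] := choice prop.
exists (fun j => if unlift ord_max j is Some k then c k else 1); split.
  by exists ord_max; rewrite unlift_none oner_eq0.
have sh : holo (fun z => \sum_i (if unlift ord_max i is Some k then c k else 1) * phi i z).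
  by apply: holo_sum => i _; apply: holoM => //; exact: holo_cst.
have [|H|//] := holo_mul_eq0 (Cfh ord_max) sh; last first.
  by move: Wz0; rewrite -CfW H eqxx.
move=> z; rewrite -[RHS](rel ord0 z) mulr_sumr; apply: eq_bigr => i _ /=.
case: unliftP => [j ->|->]; last by ring.
by rewrite hc; ring.
Qed.

(** The moduli of the zeros are a countable union of finite sets, hence of measure zero. *)
Lemma exc_no_zeros f : holo f -> (exists w, f w != 0) ->
  exc (fun r => forall z, normc z = r -> f z != 0).
Proof.
move=> fh fw.
pose A := \bigcup_n (@normc R @` [set z | normc z <= n%:R /\ f z = 0]).
have cA : countable A.
  apply: bigcup_countable => // n _; apply: finite_set_countable.
  by apply: finite_image; exact: holo_zeros_finite.
apply: exc_imp (exc_countable cA) => r r0 Ar z zr; apply/eqP => fz.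
apply: Ar; exists (Num.bound r) => //; exists z => //; split => //.
by rewrite zr ltW// lt_bound.
Qed.

Lemma lnc_le z (x : R) : z != 0 -> normc z <= x -> lnc z <= ln x.
Proof.
move=> z0 zx; rewrite /lnc ler_ln// posrE ?normc_gt0//.
by rewrite (lt_le_trans _ zx)// normc_gt0.
Qed.

Lemma ln_prodR n (x : 'I_n -> R) : (forall i, 0 < x i) -> ln (\prod_i x i) = \sum_i ln (x i).
Proof.
move=> x0; elim: n x x0 => [|n IH] x x0; first by rewrite !big_ord0 ln1.
rewrite !big_ord_recl lnM ?posrE ?IH//.
by apply: prodr_gt0.
Qed.

(* By Cramer's rule W * c_i is c0 times a minor, so |W * v_i| is bounded by the
   product of all |v_j| up to the error of the logarithmic derivative lemma. As log |v_j|
   has constant mean and the mean of log |W| is bounded below, Tsum would be at most half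
   of itself plus a constant. *)
Lemma unit_sum_const m (v : 'I_m.+1 -> C -> C) (c : 'I_m.+1 -> C) (c0 : C) :
  (forall i, holo (v i)) -> (forall i z, v i z != 0) -> (forall i, c i != 0) ->
  (forall z, \sum_i c i * v i z = c0) -> (exists z, wronskian v z != 0) ->
  (exists i z, v i z != v i 0) -> False.
Proof.
move=> vh v0 cn0 hc [w0 Ww0] vnc.
pose A z := \matrix_(k, i) iter k (@D R) (v i) z : 'M[C]_m.+1.
have Wh := wronskian_holo vh.
have Dc (k : nat) z : \sum_i iter k.+1 (@D R) (v i) z * c i = 0.
  elim: k z => [|k IH] z.
    have h : cdiff (fun w => \sum_i c i * v i w) z (\sum_i c i * D (v i) z).
      by apply: cdiff_sum => i _; apply: cdiffZ; exact: DP.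
    rewrite (_ : (fun w => _) = fun=> c0) in h; last exact/funext.
    rewrite -[RHS](cdiff_unique h (cdiff_cst c0 z)).
    by apply: eq_bigr => i _; rewrite mulrC.
  have h : cdiff (fun w => \sum_i c i * iter k.+1 (@D R) (v i) w) z
     (\sum_i c i * D (iter k.+1 (@D R) (v i)) z).
    by apply: cdiff_sum => i _; apply: cdiffZ; apply: DP; exact: iterD_holo.
  rewrite (_ : (fun w => _) = fun=> 0) in h; last first.
    by apply/funext => w; rewrite -[RHS](IH w); apply: eq_bigr => i _; rewrite mulrC.
  rewrite -[RHS](cdiff_unique h (cdiff_cst 0 z)).
  by apply: eq_bigr => i _; rewrite mulrC.
have cramer z i : wronskian v z * c i = c0 * cofactor (A z) ord0 i.
  pose x : 'cV[C]_m.+1 := \col_j c j.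
  have Ax : A z *m x = \col_k (if k == ord0 then c0 else 0).
    apply/colP => k; rewrite !mxE; under eq_bigr do rewrite !mxE.
    case: eqVneq => [->|k0].
      by rewrite -(hc z); apply: eq_bigr => j _; rewrite mulrC.
    have -> : k = k.-1.+1 :> nat by rewrite prednK// lt0n; apply: contraNneq k0 => h; apply/eqP/val_inj.
    exact: Dc.
  have := congr1 (mulmx (\adj (A z))) Ax.
  rewrite mulmxA mul_adj_mx => /colP/(_ i).
  rewrite mul_scalar_mx !mxE => ->.
  rewrite (bigD1 ord0)//= !mxE eqxx big1 ?addr0 1?mulrC// => j j0.
  by rewrite !mxE (negbTE j0) mulr0.
have c00 : c0 != 0.
  apply: contraNneq Ww0 => h; have := cramer w0 ord0; rewrite h mul0r => /eqP.
  by rewrite mulf_eq0 (negbTE (cn0 _)) orbF.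
(* Counting no zeros at all still bounds the mean of log |W| below by a constant for r >= 1, even if
   W vanishes at 0. *)
have [|cJ hJ] := @jensen_counting R _ 0 (fun=> 0%N) Wh (ex_intro _ w0 Ww0).
  by exists (wronskian v); split=> // w; rewrite expr0 mul1r.
have n1 : 0 < m.+1%:R :> R by rewrite ltr0n.
pose K1 : R := `|ln (m.+1`!%:R)| + `|ln (normc c0 * m`!%:R)| + \sum_i `|lnc (c i)|.
pose K2 : R := K1 + `|\sum_i lnc (v i 0)| - cJ.
(* Summing the m + 1 bounds for T(v_i) gives an error (m + 1)^2 b, which this choice keeps below
   Tsum / 2. What remains is Tsum <= 2 (m + 1) K2, refuted by the threshold on the radius. *)
pose eps : R := (2 * m.+1%:R ^+ 2)^-1.
have e0 : 0 < eps by rewrite invr_gt0 mulr_gt0// exprn_gt0.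
have [r2 hr2] := Tsum_large vh v0 vnc (2 * m.+1%:R * K2 + 1).
have := exc_and (exc_no_zeros Wh (ex_intro _ w0 Ww0)) (log_derivative_lemma vh v0 vnc m.+1 e0).
move=> /(exc_unbounded (Num.max r2 1))[r [rM r0 [Wr [b /andP[b0 bT] hb]]]].
move: rM; rewrite gt_max => /andP[/ltW/hr2 Tbig /ltW r1].
have hJr : cJ <= mean (fun t => lnc (wronskian v (circ r t))).
  by have := hJ [::] r r1; rewrite big_nil addr0 mul0r addr0; apply.
have fact0 k : 0 < k`!%:R :> R by rewrite ltr0n fact_gt0.
have eb0 : 0 < expR b by rewrite expR_gt0.
have vn0 i z : 0 < normc (v i z) by rewrite normc_gt0.
have prod0 z : 0 < \prod_i normc (v i z) by apply: prodr_gt0.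
have Abd z k i : normc z = r -> normc (A z k i) <= expR b * normc (v i z).
  by move=> zr; rewrite mxE; apply: hb => //; exact: ltnW.
have lnprod z : ln (\prod_i normc (v i z)) = \sum_i lnc (v i z) by rewrite ln_prodR.
(* Two bounds, because log+ is a maximum: [S1] makes the common majorant nonnegative, [S2] makes it
   dominate log |v_i|. *)
have S1 z : normc z = r ->
    lnc (wronskian v z) <= ln (m.+1`!%:R) + m.+1%:R * b + \sum_i lnc (v i z).
  move=> zr; have h : normc (wronskian v z) <= m.+1`!%:R * expR b ^+ m.+1 * \prod_i normc (v i z).
    by apply: det_bound => [|i|k i]; [exact: ltW|exact: ltW|exact: Abd].
  apply: le_trans (lnc_le (Wr z zr) h) _.
  rewrite lnM ?posrE ?mulr_gt0 ?exprn_gt0// lnM ?posrE ?exprn_gt0//.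
  by rewrite lnXn// expRK lnprod -[b *+ _]mulr_natl.
have S2 z i : normc z = r ->
    lnc (v i z) <= ln (normc c0 * m`!%:R) + m%:R * b + \sum_i lnc (v i z) - lnc (c i) - lnc (wronskian v z).
  move=> zr.
  have h : normc (cofactor (A z) ord0 i) <= m`!%:R * expR b ^+ m * \prod_j normc (v (lift i j) z).
    rewrite /cofactor normcM normcX normcN normc1 expr1n mul1r.
    apply: det_bound => [|j|k j]; [exact: ltW|exact: ltW|rewrite !mxE].
    by apply: hb => //; exact: ltnW (ltn_ord _).
  have h2 : normc (wronskian v z * c i * v i z) <=
      normc c0 * m`!%:R * expR b ^+ m * \prod_j normc (v j z).
    rewrite cramer [normc (c0 * _ * _)]normcM [normc (c0 * _)]normcM (bigD1_ord i)//= [leRHS](_ : _ =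
      normc c0 * (m`!%:R * expR b ^+ m * \prod_j normc (v (lift i j) z)) * normc (v i z)); last by ring.
    by rewrite ler_pM2r// ler_pM2l// normc_gt0.
  have c0m : 0 < normc c0 * m`!%:R by rewrite mulr_gt0// normc_gt0.
  have := lnc_le _ h2; rewrite !mulf_neq0 ?Wr// => /(_ isT).
  rewrite lncM ?mulf_neq0 ?Wr// lncM ?Wr//.
  rewrite lnM ?posrE ?mulr_gt0 ?exprn_gt0 ?normc_gt0// lnM ?posrE ?exprn_gt0//.
  by rewrite lnXn// expRK lnprod -[b *+ _]mulr_natl; lra.
have Tb i : Tc (v i) r <= K2 + m.+1%:R * b.
  have Wc := lnc_circ_cont Wh (ltW r0) Wr.
  have vc j : continuous (fun t => lnc (v j (circ r t))) by exact: unit_lnc_cont.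
  have [sc sm] := mean_sum (index_enum 'I_m.+1) vc.
  pose K3 := K1 + m.+1%:R * b.
  apply: le_trans (_ : mean (fun t => (K3 + \sum_j lnc (v j (circ r t))) +
     -1 * lnc (wronskian v (circ r t))) <= _); last first.
    rewrite meanD; last 2 first.
    - by apply: continuous_addR => //; exact: continuous_cstR.
    - by apply: continuous_mulR => //; exact: continuous_cstR.
    rewrite meanD ?mean_cst ?sm ?meanZ//; last exact: continuous_cstR.
    rewrite (eq_bigr (fun j => lnc (v j 0))); last by move=> j _; rewrite mean_lnc_unit.
    have := ler_norm (\sum_i lnc (v i 0)); rewrite /K2 /K3; lra.
  apply: ler_mean; first exact: lnplus_cont.
    apply: continuous_addR; first by apply: continuous_addR => //; exact: continuous_cstR.
    by apply: continuous_mulR => //; exact: continuous_cstR.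
  move=> t; have zr : normc (circ r t) = r by rewrite normc_circ// ltW.
  have s1 := S1 _ zr; have s2 := S2 _ i zr.
  have l1 := ler_norm (ln (m.+1`!%:R : R)).
  have l2 := ler_norm (ln (normc c0 * m`!%:R)).
  have l3 : - lnc (c i) <= \sum_i `|lnc (c i)|.
    rewrite (bigD1 i)//= (le_trans (ler_norm _))// normrN lerDl sumr_ge0//.
  have l4 : 0 <= \sum_i `|lnc (c i)| by apply: sumr_ge0.
  have l5 := normr_ge0 (ln (m.+1`!%:R : R)); have l6 := normr_ge0 (ln (normc c0 * m`!%:R)).
  rewrite /lnplus -/(lnc _) ge_max /K3 /K1; move: s2; rewrite -[m.+1%:R]natr1 mulrDl mul1r in s1 *.
  move: (\sum_j lnc _) (lnc (wronskian _ _)) (lnc (v i _)) (\sum_i _) (m%:R * b) l3 l4 s1 => X Y Z U V l3 l4 s1 s2.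
  by apply/andP; split; lra.
have : Tsum v r <= m.+1%:R * K2 + m.+1%:R ^+ 2 * b.
  apply: le_trans (ler_sum _ (fun i _ => Tb i)) _.
  rewrite sumr_const card_ord -[leLHS]mulr_natl; apply: eq_ler; ring.
have : m.+1%:R ^+ 2 * b <= Tsum v r / 2.
  apply: le_trans (ler_wpM2l _ bT) _; first by rewrite exprn_ge0// ltW.
  rewrite /eps; apply: eq_ler; field.
  by rewrite nat1r lt0r_neq0.
move=> h1 h2; move: Tbig; rewrite -mulrA; lra.
Qed.

(** Induction on the number of functions. A zero coefficient, or a vanishing Wronskian of the
    quotients by the last function, gives a relation among fewer of them. Otherwise [unit_sum_const]
    leaves only constant quotients. *)
Lemma borel_theorem n (u : 'I_n -> C -> C) (c : 'I_n -> C) :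
  (forall i, holo (u i)) -> (forall i z, u i z != 0) -> (exists i, c i != 0) ->
  (forall z, \sum_i c i * u i z = 0) ->
  exists i j, i != j /\ exists a : C, forall z, u i z = a * u j z.
Proof.
elim: n u c => [|n IH] u c uh u0 [i0 ci0] hc; first by case: i0 ci0.
have sub (c' : 'I_n -> C) (i : 'I_n.+1) : (exists j, c' j != 0) ->
    (forall z, \sum_j c' j * u (lift i j) z = 0) ->
    exists i j, i != j /\ exists a : C, forall z, u i z = a * u j z.
  move=> c'0 hc'; have [//|//|j [k [jk [a ha]]]] := IH (fun j => u (lift i j)) c' _ _ c'0 hc'.
  exists (lift i j), (lift i k); split; last by exists a.
  by apply: contraNneq jk => /lift_inj ->.
have [[i ci]|allc] := pselect (exists i, c i = 0).
  apply: (sub (fun j => c (lift i j)) i).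
    have := ci0; have [<-|//] := eqVneq i i0; first by rewrite ci eqxx.
    case: (unliftP i i0) => [j -> ij cj|-> ]; last by rewrite eqxx.
    by exists j.
  by move=> z; rewrite -[RHS](hc z) (bigD1_ord i)//= ci mul0r add0r.
have cn0 i : c i != 0 by apply/eqP => ci; apply: allc; exists i.
case: n u c uh u0 hc IH sub cn0 i0 {allc ci0} => [|m] u c uh u0 hc IH sub cn0 i0.
  have := hc 0; rewrite big_ord1 => /eqP; rewrite mulf_eq0.
  by rewrite (negbTE (cn0 _)) (negbTE (u0 _ _)).
pose v i z := u (lift ord_max i) z * (u ord_max z)^-1.
have vh i : holo (v i) by apply: holoM => //; apply: holoV.
have v0 i z : v i z != 0 by rewrite mulf_neq0// invr_neq0.
apply: contrapT => H.
have [W0|] := pselect (forall z, wronskian v z = 0).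
  have [c' [c'0 hc']] := wronskian_dep vh W0.
  apply/H/(sub c' ord_max c'0) => z.
  have := hc' z; rewrite (eq_bigr (fun j => (c' j * u (lift ord_max j) z) * (u ord_max z)^-1)); last first.
    by move=> j _; rewrite /v mulrA.
  rewrite -mulr_suml => /eqP; rewrite mulf_eq0 invr_eq0 (negbTE (u0 _ _)) orbF => /eqP //.
move=> /existsNP[z0 /eqP Wz0].
apply: (@unit_sum_const m v (fun i => c (lift ord_max i)) (- c ord_max)) => //.
- move=> z; rewrite (eq_bigr (fun j => (c (lift ord_max j) * u (lift ord_max j) z) * (u ord_max z)^-1)); last first.
    by move=> j _; rewrite /v mulrA.
  rewrite -mulr_suml; have := hc z; rewrite (bigD1_ord ord_max)//= addrC => /eqP.
  by rewrite addr_eq0 => /eqP ->; rewrite mulNr mulfK.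
- by exists z0.
- apply: contrapT => H2; apply: H.
  exists (lift ord_max ord0), ord_max; split; first by rewrite eq_sym neq_lift.
  exists (v ord0 0) => z.
  have -> : v ord0 0 = v ord0 z.
    by apply/eqP/negPn/negP => h; apply: H2; exists ord0, z; rewrite eq_sym.
  by rewrite /v divfK.
Qed.

End wronskians.

(** * Counting common zeros *)

Section counting.
Variable R : realType.
Local Notation C := R[i].
Implicit Types (f g : C -> C) (z w d : C).

Lemma proximityE f r : holo f -> (forall z, f z != 0) ->
  proximity f r = Tc f r.
Proof.
move=> fh f0; have pi0 : (2 * pi : R) != 0 by rewrite gt_eqF// twopi_gt0.
have := meanZ (2 * pi)^-1 (lnplus_cont fh f0 (r := r)).
rewrite -/(Tc f r) {1}/mean => e.
have : (2 * pi)^-1 * Tc f r * (2 * pi) = Tc f r by rewrite mulrAC mulVf ?mul1r.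
move=> <-; rewrite -e mulfVK// /proximity; congr (Rintegral _ _ _).
by apply/funext => t; rewrite mulrC.
Qed.

Lemma has_orderP f z k : has_order f z k -> exists h, [/\ exists d, cdiff h z d, h z != 0 &
  exists2 d, 0 < d & forall w, w != z -> normc (w - z) < d ->
    f w = (w - z) ^ k * h w].
Proof.
case=> h [/nearCP[d d0 H] h0 /dnearCP fE]; exists h; split=> //.
by apply/derivable_cdiff; apply: H; rewrite subrr normc0.
Qed.

(** For k = -(n + 1), the function (w - z)^(n+1) f(w) vanishes at [z] and equals [h] at all other
    nearby points, against h(z) <> 0 and continuity. *)
Lemma has_order_ge0 f z k : holo f -> has_order f z k -> 0 <= k.
Proof.
move=> fh /has_orderP[h [[dh hd] h0 [d d0 H]]]; case: k H => // n H; exfalso.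
pose p w := (w - z) ^+ n.+1 * f w.
have ph : holo p.
  by apply: holoM => //; apply: holoX; exact: holo_subc.
have hp : ccont (fun w => h w - p w) z.
  by apply: cdiff_cont; apply: (cdiffB hd); apply: DP.
have hp0 : h z - p z != 0 by rewrite /p subrr expr0n mul0r subr0.
have [e e0 he] := ccont_neq0 hp hp0.
have [x x0 xs] := small_complex (ltac:(by rewrite lt_min d0 e0) : 0 < Num.min d e).
have /andP[xd xe] : (normc x < d) && (normc x < e) by rewrite -lt_min.
have := he (z + x); rewrite addrAC subrr add0r => /(_ xe) /eqP; apply.
rewrite /p (H (z + x)); last by rewrite addrAC subrr add0r.
  rewrite addrAC subrr add0r NegzE -exprnN mulrA divff ?mul1r ?subrr//.
  by rewrite expf_neq0.
by rewrite -subr_eq0 addrAC subrr add0r.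
Qed.

Lemma ord_ge0 f z : holo f -> 0 <= ord f z.
Proof.
by move=> fh; rewrite /ord; case: xgetP => // k -> /(has_order_ge0 fh).
Qed.

Lemma pole_mult_holo f z : holo f -> pole_mult f z = 0.
Proof.
by move=> fh; rewrite /pole_mult; apply/max_idPl; rewrite oppr_le0 ord_ge0.
Qed.

Lemma zero_mult_factor f z : holo f -> exists g, holo g /\
  forall w, f w = (w - z) ^+ `|zero_mult f z| * g w.
Proof.
move=> fh; rewrite /zero_mult (max_idPr (ord_ge0 _ fh)) /ord.
(* If no order exists, [ord] takes its default 0 and the factor is trivial. *)
case: xgetP => [k -> H|_]; last by exists f; split=> // w; rewrite absz0 expr0 mul1r.
have k0 := has_order_ge0 fh H.
case/has_orderP: H => h [[dh hd] h0 [d d0 H]].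
apply: holo_order_ge => //; exists h; split; first exact: (cdiff_cont hd).
by exists d => // w wz wd; rewrite (H w)// -{1}(gez0_abs k0).
Qed.

Lemma N_poles_holo f r : holo f -> N_poles f r = 0.
Proof.
move=> fh; have n0 t : n_poles f t = 0 by apply: fsbig1 => z _; exact: pole_mult_holo.
rewrite /N_poles /integrated_counting n0 mul0r addr0 /Rintegral integral0_eq// => t _.
by rewrite n0 subrr mul0r.
Qed.

Lemma characteristicE f r : holo f -> (forall z, f z != 0) ->
  characteristic f r = Tc f r.
Proof. by move=> fh f0; rewrite /characteristic N_poles_holo// addr0 proximityE. Qed.

(* The maximum is inactive where [b <= t]; it makes the second factor continuous on R. *)
Definition tail_inv (b c t : R) := if b <= t then c * (Num.max t b)^-1 else 0.

Lemma maxrV_continuous (b : R) : 0 < b -> continuous (fun t : R => (Num.max t b)^-1).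
Proof.
move=> b0 t; apply: cvgV; first by rewrite gt_eqF// lt_max b0 orbT.
by apply: continuous_max; [exact: cvg_id|exact: cvg_cst].
Qed.

Lemma tail_inv_measurable (b c : R) (A : set R) : 0 < b -> measurable_fun A (tail_inv b c).
Proof.
move=> b0; apply: measurable_funTS; apply: measurable_fun_ifT.
- exact: measurable_realfun.measurable_fun_ler.
- apply: measurable_realfun.continuous_measurable_fun => t.
  by apply: cvgM; [exact: cvg_cst|exact: maxrV_continuous].
- exact: measurable_cst.
Qed.

Lemma integral_tail_inv (b c r : R) : 0 < b <= r -> 0 <= c ->
  (\int[lebesgue_measure]_(t in `[0%R, r]) (tail_inv b c t)%:E)%E = (c * (ln r - ln b))%:E.
Proof.
move=> /andP[b0 br] c0.
pose P : set R := [set t | b <= t].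
pose h (t : R) := (c * (Num.max t b)^-1).
transitivity (\int[lebesgue_measure]_(t in `[0%R, r]) (((EFin \o h) \_ P) t))%E.
  apply: eq_integral => t _; rewrite /patch /tail_inv.
  case: ifPn => bt; first by rewrite mem_set.
  by rewrite memNset//; exact/negP.
rewrite -integral_mkcondr.
have -> : `[0%R, r]%classic `&` P = `[b, r]%classic.
  apply/seteqP; split=> t /=; rewrite !in_itv/=.
    by move=> [/andP[_ ->]]; rewrite /P/= => ->.
  by rewrite /P/= => /andP[bt ->]; rewrite (le_trans (ltW b0) bt).
have [->|bnr] := eqVneq b r.
  by rewrite set_itv1 integral_set1 subrr mulr0.
have {bnr}br : b < r by rewrite lt_neqAle bnr.
have hc : continuous h.
  by move=> t; apply: cvgM; [exact: cvg_cst|exact: maxrV_continuous].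
rewrite (@continuous_FTC2 _ h (fun t => c * ln t))//.
- by rewrite -EFinB mulrBr.
- exact: continuous_subspaceT.
- split.
  + move=> t; rewrite in_itv/= => /andP[bt _].
    by apply: derivableM => //; have [] := is_derive1_ln (lt_trans b0 bt).
  + apply: cvg_at_right_filter; apply: cvgM; first exact: cvg_cst.
    exact: continuous_ln.
  + apply: cvg_at_left_filter; apply: cvgM; first exact: cvg_cst.
    by apply: continuous_ln; apply: lt_trans br.
- move=> t; rewrite in_itv/= => /andP[bt _]; have t0 := lt_trans b0 bt.
  have hd := is_derive1_ln t0.
  have : is_derive t 1 (fun t => c * ln t) (c * t^-1).
    exact: (@is_deriveZ _ _ _ _ c t 1 _ hd).
  by rewrite derive1E => -[_ ->]; rewrite /h max_l// ltW.
Qed.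

(** A point a <> 0 is counted from t = |a| on and contributes the integral of 1 / t from |a| to r.
    The point 0 cancels in n t - n 0 and enters only through the last term. *)
Lemma integrated_countingE (n : R -> int) (s : seq C) (mu : C -> nat) r : 0 < r ->
  (forall a, a \in s -> normc a <= r) ->
  (forall t, 0 <= t <= r -> n t = \sum_(a <- s | normc a <= t) (mu a)%:Z) ->
  integrated_counting n r = \sum_(a <- s | a != 0) (mu a)%:R * (ln r - lnc a)
    + (n 0)%:~R * ln r.
Proof.
move=> r0 sr nE; rewrite /integrated_counting; congr (_ + _).
rewrite /Rintegral -[RHS]/(fine (_%:E)); congr fine.
transitivity (\int[lebesgue_measure]_(t in `[0%R, r])
    \sum_(a <- s) (if a == 0%R then 0 else tail_inv (normc a) (mu a)%:R t)%:E)%E.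
  apply: eq_integral => t; rewrite inE/= in_itv/= => /andP[t0 tr].
  rewrite sumEFin; congr (_%:E).
  rewrite !nE ?lexx ?(ltW r0) ?t0//.
  rewrite (big_mkcond (fun a => normc a <= t)) (big_mkcond (fun a => normc a <= 0)).
  rewrite -sumrB/= rmorph_sum/= mulr_suml; apply: eq_bigr => a _.
  have -> : (normc a <= 0) = (a == 0).
    by rewrite le_eqVlt ltNge normc_ge0 orbF normc_eq0.
  rewrite /tail_inv; have [->|a0] := eqVneq a 0; first by rewrite normc0 t0 subrr mul0r.
  case: ifPn => at0; last by rewrite subrr mul0r.
  by rewrite subr0 max_l// pmulrn.
rewrite ge0_integral_sum//=.
- rewrite -sumEFin [RHS]big_mkcond big_seq_cond [RHS]big_seq_cond; apply: eq_bigr => a /andP[sa _].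
  have [a0|a0] := eqVneq a 0; first by rewrite integral0.
  by rewrite integral_tail_inv// sr// normc_gt0 a0.
- move=> a; apply/measurable_realfun.measurable_EFinP.
  have [a0|a0] := eqVneq a 0; first exact: measurable_cst.
  by apply: tail_inv_measurable; rewrite normc_gt0.
- move=> a t _; rewrite lee_fin; case: ifP => // _; rewrite /tail_inv; case: ifP => // at0.
  by rewrite mulr_ge0// invr_ge0 le_max normc_ge0 orbT.
Qed.

Definition gcd_mult f g z : nat := `|Num.min (zero_mult f z) (zero_mult g z)|%N.

Lemma zero_mult_ge0 f z : 0 <= zero_mult f z.
Proof. by rewrite /zero_mult le_max lexx. Qed.

Lemma gcd_multE f g z : Num.min (zero_mult f z) (zero_mult g z) = gcd_mult f g z.
Proof. by rewrite /gcd_mult gez0_abs// le_min !zero_mult_ge0. Qed.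

Lemma gcd_multC f g z : gcd_mult f g z = gcd_mult g f z.
Proof. by rewrite /gcd_mult minC. Qed.

Lemma gcd_mult_factor f g z : holo f -> exists h, holo h /\
  forall w, f w = (w - z) ^+ gcd_mult f g z * h w.
Proof.
move=> fh; have [h [hh fE]] := zero_mult_factor z fh.
have le : (gcd_mult f g z <= `|zero_mult f z|)%N.
  by rewrite -lez_nat -gcd_multE gez0_abs ?zero_mult_ge0// ge_min lexx.
exists (fun w => (w - z) ^+ (`|zero_mult f z| - gcd_mult f g z) * h w); split.
  by apply: holoM => //; apply: holoX; exact: holo_subc.
by move=> w; rewrite mulrA -exprD subnKC.
Qed.

Lemma gcd_mult_zero f g z : holo f -> (0 < gcd_mult f g z)%N -> f z = 0.
Proof.
move=> fh m0; have [h [_ ->]] := gcd_mult_factor g z fh.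
by rewrite subrr expr0n eqn0Ngt m0 mul0r.
Qed.

(** The common multiplicity is positive only at zeros of [f], so the finitely many of them in the
    disc carry the whole sum. The list depends on [r]. *)
Lemma N_gcd_sum f g r : holo f -> (exists w, f w != 0) -> 0 < r ->
  exists s : seq C, [/\ uniq s, forall a, a \in s -> a != 0 &
  N_gcd f g r = \sum_(a <- s) (gcd_mult f g a)%:R * (ln r - lnc a)
    + (gcd_mult f g 0)%:R * ln r].
Proof.
move=> fh f0 r0.
have /finite_seqP[s0 s0E] := holo_zeros_finite r fh f0.
pose s1 := undup s0.
have s1P a : (a \in s1) <-> (normc a <= r /\ f a = 0).
  rewrite mem_undup; split=> [as0|].
    by have : [set` s0] a by []; rewrite -s0E.
  by rewrite -[_ /\ _]/([set z | normc z <= r /\ f z = 0] a) s0E.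
have nE t : 0 <= t <= r ->
    n_gcd f g t = \sum_(a <- s1 | normc a <= t) (gcd_mult f g a)%:Z.
  move=> /andP[t0 tr]; rewrite /n_gcd -[RHS]big_filter.
  rewrite (@fsbigE _ _ _ _ _ [seq a <- s1 | normc a <= t]).
  - rewrite [RHS]big_seq [LHS]big_seq_cond; apply: eq_big => [a|a _]; last exact: gcd_multE.
    rewrite andb_idr// mem_filter => /andP[at0 _]; exact: mem_set.
  - by rewrite filter_uniq// undup_uniq.
  - by move=> a /=; rewrite mem_filter => /andP[].
  - move=> a at0; rewrite mem_filter at0/= => /negP as1; rewrite gcd_multE.
    apply/eqP; rewrite eqz_nat -leqn0 leqNgt; apply/negP => /(gcd_mult_zero fh) fa.
    by apply: as1; apply/s1P; split=> //; exact: le_trans at0 tr.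
exists [seq a <- s1 | a != 0]; split.
- by rewrite filter_uniq// undup_uniq.
- by move=> a; rewrite mem_filter => /andP[].
rewrite /N_gcd (integrated_countingE (s := s1) (mu := gcd_mult f g) r0)//.
  rewrite big_filter; congr (_ + _ * _); rewrite nE ?lexx ?(ltW r0)//.
  rewrite (eq_bigl (pred1 0)); last first.
    by move=> a /=; rewrite le_eqVlt ltNge normc_ge0 orbF normc_eq0.
  have [s10|s10] := boolP (0 \in s1).
    by rewrite -big_filter filter_pred1_uniq ?undup_uniq// big_seq1 pmulrn.
  rewrite big_seq_cond big1; last by move=> a /andP[as1 /eqP a0]; rewrite -a0 as1 in s10.
  have [->//|] := posnP (gcd_mult f g 0) => /(gcd_mult_zero fh) f00.
  by move/negP: s10; case; apply/s1P; rewrite normc0 ltW.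
by move=> a /s1P[].
Qed.

End counting.

(** * The gcd bound *)

Section gcd_bound.
Variable R : realType.
Local Notation C := R[i].
Implicit Types (f g : C -> C) (z w d : C).

(** The coefficient of the j-th derivative of f in the k-th derivative of h f, that is, binomial (k,
    j) times the (k - j)-th derivative of h. The recursion avoids binomials: only triangularity and
    the diagonal matter. *)
Fixpoint leibniz (h : C -> C) (k j : nat) : C -> C :=
  if k is k'.+1 then
    fun z => D (leibniz h k' j) z + (if j is j'.+1 then leibniz h k' j' z else 0)
  else fun z => if j == 0%N then h z else 0.

Lemma leibniz_holo h k j : holo h -> holo (leibniz h k j).
Proof.
move=> hh; elim: k j => [|k IH] [|j] /=; [exact: hh|exact: holo_cst| |].
  by apply: holoD; [apply: holo_Dfun|exact: holo_cst].
by apply: holoD; [apply: holo_Dfun|].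
Qed.

Lemma D_cst (c : C) z : D (fun=> c) z = 0.
Proof. by apply: D_eq; exact: cdiff_cst. Qed.

Lemma leibniz_lt h k j z : (k < j)%N -> leibniz h k j z = 0.
Proof.
elim: k j z => [|k IH] [|j] z //= kj.
rewrite IH// addr0 (_ : leibniz h k j.+1 = fun=> 0) ?D_cst//.
by apply/funext => w; apply: IH; apply: leqW.
Qed.

Lemma leibniz_diag h k z : leibniz h k k z = h z.
Proof.
elim: k z => //= k IH z; rewrite IH (_ : leibniz h k k.+1 = fun=> 0) ?D_cst ?add0r//.
by apply/funext => w; exact: leibniz_lt.
Qed.

Lemma leibnizE h f k n z : holo h -> holo f -> (k < n)%N ->
  iter k (@D R) (fun w => h w * f w) z = \sum_(j < n) leibniz h k j z * iter j (@D R) f z.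
Proof.
move=> hh fh; case: n => // n; elim: k z => [|k IH] z kn.
  rewrite big_ord_recl/= big1 ?addr0// => i _; exact: mul0r.
rewrite iterS (_ : iter k _ _ = fun w => \sum_(j < n.+1) leibniz h k j w * iter j (@D R) f w);
  last by apply/funext => w; apply: IH; exact: ltnW.
have H (j : 'I_n.+1) : cdiff (fun w => leibniz h k j w * iter j (@D R) f w) z
   (D (leibniz h k j) z * iter j (@D R) f z + leibniz h k j z * iter j.+1 (@D R) f z).
  by apply: cdiffM; apply: DP; [exact: leibniz_holo|exact: iterD_holo].
rewrite (D_eq (cdiff_sum _ (fun j _ => H j))) big_split/=.
under [RHS]eq_bigr do rewrite mulrDl.
rewrite big_split/=; congr (_ + _).
rewrite big_ord_recr [RHS]big_ord_recl/= leibniz_lt// !mul0r addr0 add0r.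
by apply: eq_bigr.
Qed.

(** By the Leibniz rule the matrix is a lower triangular one with diagonal [h], times the Wronskian
    matrix of [phi]. *)
Lemma wronskian_mul h (n : nat) (phi : 'I_n -> C -> C) z : holo h ->
  (forall i, holo (phi i)) ->
  wronskian (fun i w => h w * phi i w) z = h z ^+ n * wronskian phi z.
Proof.
move=> hh ph; rewrite /wronskian.
pose L : 'M[C]_n := \matrix_(k, j) leibniz h k j z.
have -> : \matrix_(k, i) iter k (@D R) (fun w => h w * phi i w) z =
    L *m \matrix_(k, i) iter k (@D R) (phi i) z.
  apply/matrixP => k i; rewrite !mxE (leibnizE _ hh (ph i) (ltn_ord k)).
  by apply: eq_bigr => j _; rewrite !mxE.
rewrite det_mulmx det_trig; last first.
  by apply/is_trig_mxP => k j kj; rewrite mxE leibniz_lt.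
congr (_ * _); under eq_bigr do rewrite mxE leibniz_diag.
by rewrite big_const_ord iter_mulr_1.
Qed.

(** Differentiation lowers the order of the individual entries, but pulling the common factor out of
    the determinant by [wronskian_mul] loses nothing. *)
Lemma wronskian_div (n k : nat) (phi : 'I_n -> C -> C) z :
  (forall i, exists g, holo g /\ forall w, phi i w = (w - z) ^+ k * g w) ->
  exists g, holo g /\ forall w, wronskian phi w = (w - z) ^+ (n * k) * g w.
Proof.
move=> /choice[psi H]; exists (wronskian psi); split.
  by apply: wronskian_holo => i; have [] := H i.
have eq : phi = fun i w => (w - z) ^+ k * psi i w.
  by apply/funext => i; apply/funext => w; have [_ ->] := H i.
move=> w; rewrite eq mulnC exprM -(wronskian_mul (h := fun w => (w - z) ^+ k))//.
  by apply: holoX; exact: holo_subc.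
by move=> i; have [] := H i.
Qed.

(** Only row 0 contains the subtracted 1. Scaling that row by 1 / x brings every entry under
    [det_bound], so [x] is paid once and not n times. *)
Lemma wronskian_sub1_bound (n : nat) (u : 'I_n -> C -> C) z (b x : R) : 0 <= b -> 0 < x ->
  (forall i, holo (u i)) -> (forall i, u i z != 0) ->
  (forall i (k : nat), (k <= n)%N -> normc (iter k (@D R) (u i) z) <= b * normc (u i z)) ->
  (forall i, normc (u i z - 1) <= x * (b * normc (u i z))) -> (0 < n)%N ->
  normc (wronskian (fun i w => u i w - 1) z) <=
    x * (n`!%:R * b ^+ n * \prod_i normc (u i z)).
Proof.
move=> b0 x0 uh u0 ub ux n0; case: n n0 u uh u0 ub ux => // n _ u uh u0 ub ux.
rewrite /wronskian; set A := \matrix_(_, _) _.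
pose d : 'rV[C]_(n.+1) := \row_j (if j == ord0 then (x^-1)%:C else 1).
have dA : \det (diag_mx d *m A) = (x^-1)%:C * \det A.
  rewrite det_mulmx det_diag big_ord_recl mxE eqxx big1 ?mulr1// => i _.
  by rewrite mxE.
have := @det_bound R n.+1 (diag_mx d *m A) (fun i => normc (u i z)) b b0.
rewrite dA normcM normc_real ger0_norm ?invr_ge0 ?(ltW x0)//.
rewrite ler_pdivrMl//; apply=> [i|k i]; first exact: normc_ge0.
rewrite mul_diag_mx !mxE; have [->|k0] := eqVneq k ord0.
  rewrite [leLHS]normcM normc_real ger0_norm ?invr_ge0 ?(ltW x0)//.
  rewrite ler_pdivrMl//; exact: ux.
rewrite mul1r; case: k k0 => -[//|k] /= kn _.
have D1 : D (fun w => u i w - 1) = D (u i).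
  apply/funext => w; rewrite (D_eq (d := D (u i) w))//.
  by rewrite -[X in cdiff _ _ X]subr0; apply: cdiffB; [exact: DP|exact: cdiff_cst].
by rewrite -iterS iterSr D1 -iterSr; apply: ub; exact: ltnW.
Qed.

(* The index k < (q + 1)^2 enumerates the exponent pairs in [0, q]^2; k = 0 is the
   constant 1. *)
Definition mono f g (q k : nat) : C -> C := fun w => f w ^+ (k %% q.+1) * g w ^+ (k %/ q.+1).

Lemma mono_holo f g q k : holo f -> holo g -> holo (mono f g q k).
Proof. by move=> fh gh; apply: holoM; apply: holoX. Qed.

Lemma mono_neq0 f g q k z : f z != 0 -> g z != 0 -> mono f g q k z != 0.
Proof. by move=> f0 g0; rewrite mulf_neq0// expf_neq0. Qed.

Lemma mono0 f g q z : mono f g q 0 z = 1.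
Proof. by rewrite /mono mod0n div0n !expr0 mulr1. Qed.

Lemma lnc_mono f g q k z : f z != 0 -> g z != 0 ->
  lnc (mono f g q k z) = (k %% q.+1)%:R * lnc (f z) + (k %/ q.+1)%:R * lnc (g z).
Proof. by move=> f0 g0; rewrite lncM ?expf_neq0// !lncX. Qed.

Lemma expf_sub1_div (f : C -> C) z (k n : nat) :
  (exists g, holo g /\ forall w, f w - 1 = (w - z) ^+ k * g w) -> holo f ->
  exists g, holo g /\ forall w, f w ^+ n - 1 = (w - z) ^+ k * g w.
Proof.
move=> [g [gh gE]] fh; exists (fun w => g w * \sum_(i < n) f w ^+ i); split.
  by apply: holoM => //; apply: holo_sum => i _; apply: holoX.
by move=> w; rewrite subrX1 gE mulrA.
Qed.

(** By u v - 1 = (u - 1) v + (v - 1) for the two powers u and v. *)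
Lemma mono_sub1_div f g q k (j : nat) z : holo f -> holo g ->
  (exists h, holo h /\ forall w, f w - 1 = (w - z) ^+ k * h w) ->
  (exists h, holo h /\ forall w, g w - 1 = (w - z) ^+ k * h w) ->
  exists h, holo h /\ forall w, mono f g q j w - 1 = (w - z) ^+ k * h w.
Proof.
move=> fh gh fd gd.
have [a [ah aE]] := expf_sub1_div (j %% q.+1) fd fh.
have [b [bh bE]] := expf_sub1_div (j %/ q.+1) gd gh.
exists (fun w => a w * g w ^+ (j %/ q.+1) + b w); split.
  by apply: holoD => //; apply: holoM => //; apply: holoX.
move=> w; rewrite mulrDr mulrA -aE -bE /mono.
by rewrite mulrBl mul1r addrA subrK.
Qed.

(** * Size of the monomials and of their Wronskian on circles *)

Lemma lnplus_ge_lnc z : lnc z <= lnplus (normc z).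
Proof. by rewrite /lnplus le_max lexx orbT. Qed.

Lemma lnplus_ge0 (x : R) : 0 <= lnplus x.
Proof. by rewrite /lnplus le_max lexx. Qed.

Lemma natM_lnc_le (i q : nat) z : (i <= q)%N -> i%:R * lnc z <= q%:R * lnplus (normc z).
Proof.
move=> iq; apply: (@le_trans _ _ (i%:R * lnplus (normc z))).
  by rewrite ler_wpM2l// lnplus_ge_lnc.
by rewrite ler_wpM2r ?lnplus_ge0// ler_nat.
Qed.

Lemma Tc_mono f g q k r : holo f -> holo g -> (forall z, f z != 0) -> (forall z, g z != 0) ->
  (k %/ q.+1 <= q)%N -> Tc (mono f g q k) r <= q%:R * (Tc f r + Tc g r).
Proof.
move=> fh gh f0 g0 kq; have fc := lnplus_cont fh f0 (r := r).
have gc := lnplus_cont gh g0 (r := r).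
have sc : continuous (fun t => lnplus (normc (f (circ r t))) + lnplus (normc (g (circ r t)))).
  exact: continuous_addR fc gc.
rewrite -(meanD fc gc) -(meanZ _ sc); apply: ler_mean.
- by apply: lnplus_cont; [exact: mono_holo|move=> z; exact: mono_neq0].
- exact: continuous_mulR (@continuous_cstR R _) sc.
move=> t; rewrite {1}/lnplus -/(lnc _) lnc_mono// ge_max; apply/andP; split.
  by rewrite mulr_ge0// addr_ge0// lnplus_ge0.
by rewrite mulrDr; apply: lerD; apply: natM_lnc_le => //; rewrite -ltnS ltn_pmod.
Qed.

Lemma lnplusV z : z != 0 -> lnplus (normc z^-1) = lnplus (normc z) - lnc z.
Proof. by move=> z0; rewrite !lnplusE lncV// normrN; lra. Qed.

Definition lnminus f (r t : R) := lnplus (normc (f (circ r t))) - lnc (f (circ r t)).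

Lemma mean_lnminus f r : holo f -> (forall z, f z != 0) -> 0 < r ->
  continuous (lnminus f r) /\ mean (lnminus f r) = Tc f r - lnc (f 0).
Proof.
move=> fh f0 r0; have ac := lnplus_cont fh f0 (r := r).
have bc := unit_lnc_cont fh f0 (r := r).
have bc' : continuous (fun t => -1 * lnc (f (circ r t))).
  exact: continuous_mulR (@continuous_cstR R _) bc.
have -> : lnminus f r = fun t => lnplus (normc (f (circ r t))) + -1 * lnc (f (circ r t)).
  by apply/funext => t; rewrite mulN1r.
split; first by move=> t; apply: cvgD; [exact: ac|exact: bc'].
by rewrite (meanD ac bc') (meanZ _ bc) mean_lnc_unit// mulN1r.
Qed.

Lemma natM_lnc_ge (i q : nat) z : z != 0 -> (i <= q)%N ->
  - (q%:R * (lnplus (normc z) - lnc z)) <= i%:R * lnc z.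
Proof.
by move=> z0 /(natM_lnc_le z^-1); rewrite lnplusV// lncV// mulrN lerNl.
Qed.

Lemma normcE_lnc z : z != 0 -> normc z = expR (lnc z).
Proof. by move=> z0; rewrite /lnc lnK// posrE normc_gt0. Qed.

Definition wronskian_mono f g (q M : nat) :=
  wronskian (fun (i : 'I_M) w => mono f g q i.+1 w - 1).

(** With p = log+ |1/f| + log+ |1/g| and exponents at most q, each monomial u satisfies 1 <= exp (q
    p) |u|. Since |u - 1| <= 1 + |u|, [wronskian_sub1_bound] applies with x = 2 exp (q p). *)
Lemma wronskian_mono_bound f g (q M : nat) r t b : holo f -> holo g ->
  (forall z, f z != 0) -> (forall z, g z != 0) -> (0 < M)%N -> (M < q.+1 * q.+1)%N ->
  0 <= b -> 0 <= r ->
  (forall (i : 'I_M) (k : nat) z, (k <= M)%N -> normc z = r ->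
    normc (iter k (@D R) (mono f g q i.+1) z) <= expR b * normc (mono f g q i.+1 z)) ->
  wronskian_mono f g q M (circ r t) != 0 ->
  lnc (wronskian_mono f g q M (circ r t)) <=
   ln (2 * M`!%:R) + M%:R * b + q%:R * (lnminus f r t + lnminus g r t)
   + \sum_(i < M) lnc (mono f g q i.+1 (circ r t)).
Proof.
move=> fh gh f0 g0 M0 Mq b0 r0 H; set z := circ r t => W0.
pose p := lnminus f r t + lnminus g r t.
have zr : normc z = r by exact: normc_circ.
have dq (i : 'I_M) : (i.+1 %/ q.+1 <= q)%N.
  by rewrite -ltnS ltn_divLR//; apply: leq_ltn_trans Mq; exact: ltn_ord.
have mq (i : 'I_M) : (i.+1 %% q.+1 <= q)%N by rewrite -ltnS ltn_pmod.
have u0 (i : 'I_M) : mono f g q i.+1 z != 0 by exact: mono_neq0.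
have p0 : 0 <= p.
  by rewrite /p /lnminus -!lnplusV// addr_ge0// lnplus_ge0.
have ux (i : 'I_M) : normc (mono f g q i.+1 z - 1) <=
    2 * expR (q%:R * p) * (expR b * normc (mono f g q i.+1 z)).
  apply: le_trans (normcD _ _) _; rewrite normcN normc1.
  have e1 : 1 <= expR (q%:R * p) * expR b.
    by rewrite -expRD -expR0 ler_expR addr_ge0// mulr_ge0.
  have h1 : normc (mono f g q i.+1 z) <= expR (q%:R * p) * expR b * normc (mono f g q i.+1 z).
    by rewrite ler_peMl// normc_ge0.
  have h2 : 1 <= expR (q%:R * p) * expR b * normc (mono f g q i.+1 z).
    rewrite (normcE_lnc (u0 i)) lnc_mono// -!expRD -[leLHS]expR0 ler_expR.
    have := natM_lnc_ge (f0 z) (mq i); have := natM_lnc_ge (g0 z) (dq i).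
    rewrite /p /lnminus -/z; lra.
  by rewrite -!mulrA mulr_natl mulr2n; apply: lerD; rewrite mulrA.
have x0 : 0 < 2 * expR (q%:R * p) by rewrite mulr_gt0// expR_gt0.
have uh (i : 'I_M) : holo (mono f g q i.+1) by exact: mono_holo.
have := wronskian_sub1_bound (expR_ge0 b) x0 uh u0 (fun i k kM => H i k z kM zr) ux M0.
move=> /(lnc_le W0) /le_trans; apply.
have prod0 : 0 < \prod_(i < M) normc (mono f g q i.+1 z).
  by apply: prodr_gt0 => i _; rewrite normc_gt0.
have fact0 : 0 < M`!%:R :> R by rewrite ltr0n fact_gt0.
have -> : 2 * expR (q%:R * p) * (M`!%:R * expR b ^+ M * \prod_(i < M) normc (mono f g q i.+1 z))
  = (2 * M`!%:R) * expR (M%:R * b + q%:R * p) * \prod_(i < M) normc (mono f g q i.+1 z).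
  by rewrite expRD (expRM_natl M); ring.
rewrite lnM ?posrE ?mulr_gt0 ?expR_gt0// lnM ?posrE ?mulr_gt0 ?expR_gt0// expRK.
rewrite ln_prodR; last by move=> i; rewrite normc_gt0.
by rewrite /p addrA.
Qed.

Lemma mono_ratio f g q (i j : nat) (a z : C) : f z != 0 -> g z != 0 ->
  mono f g q i z = a * mono f g q j z ->
  f z ^ ((i %% q.+1)%:Z - (j %% q.+1)%:Z) * g z ^ ((i %/ q.+1)%:Z - (j %/ q.+1)%:Z) = a.
Proof.
move=> f0 g0; rewrite /mono => e.
rewrite !expfzDr// -!invr_expz mulrACA.
rewrite -[LHS]/(f z ^+ (i %% q.+1) * g z ^+ (i %/ q.+1) * (f z ^- _ * g z ^- _)).
by rewrite e -mulrA mulrACA !mulfV ?expf_neq0// !mulr1.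
Qed.

(** A relation among the u_k - 1 is one among u_0 = 1 and the u_k, with minus the sum of the
    coefficients at 1. Borel's theorem makes two monomials proportional, and distinct indices have
    distinct pairs of quotient and remainder by q + 1. *)
Lemma wronskian_mono_neq0 f g (q M : nat) : holo f -> holo g ->
  (forall z, f z != 0) -> (forall z, g z != 0) ->
  (forall i j : int, (i, j) != (0, 0) -> ~ exists c, forall z, f z ^ i * g z ^ j = c) ->
  exists z, wronskian_mono f g q M z != 0.
Proof.
move=> fh gh f0 g0 indep; apply: contrapT => W0.
have {}W0 z : wronskian_mono f g q M z = 0.
  by apply/eqP/negPn/negP => Wz; apply: W0; exists z.
have uh k : holo (mono f g q k) by exact: mono_holo.
have [//|c [[i0 ci0] cE]] := wronskian_dep _ W0.
  by move=> i; apply: holoB; [exact: uh|exact: holo_cst].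
pose cc (k : 'I_M.+1) := if unlift ord0 k is Some i then c i else - \sum_i c i.
have [||i [j [ij [a aE]]]] := borel_theorem (u := fun k : 'I_M.+1 => mono f g q k)
    (c := cc) (fun k => uh k) (fun k z => mono_neq0 _ _ (f0 z) (g0 z)).
- by exists (lift ord0 i0); rewrite /cc liftK.
- move=> z; rewrite big_ord_recl {1}/cc unlift_none mono0 mulr1 addrC -sumrB.
  rewrite -[RHS](cE z); apply: eq_bigr => i _.
  by rewrite /cc liftK mulrBr mulr1.
apply: (indep ((i %% q.+1)%:Z - (j %% q.+1)%:Z) ((i %/ q.+1)%:Z - (j %/ q.+1)%:Z)).
  apply: contraNneq ij => -[/eqP]; rewrite subr_eq0 => /eqP[e1] /eqP.
  rewrite subr_eq0 => /eqP[e2]; apply/eqP/val_inj.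
  by rewrite /= (divn_eq i q.+1) (divn_eq j q.+1) e1 e2.
by exists a => z; exact: (mono_ratio (f0 z) (g0 z) (aE z)).
Qed.

Lemma N_gcd_le_mean f g (q M : nat) : holo f -> holo g ->
  (exists w, f w - 1 != 0) ->
  (exists w, wronskian_mono f g q M w != 0) ->
  exists c, forall r, 1 <= r ->
    (forall z, normc z = r -> wronskian_mono f g q M z != 0) ->
    M%:R * N_gcd (fun z => f z - 1) (fun z => g z - 1) r <=
    mean (fun t => lnc (wronskian_mono f g q M (circ r t))) + c.
Proof.
move=> fh gh f1 W0.
have f1h : holo (fun z => f z - 1) by apply: holoB; [|exact: holo_cst].
have g1h : holo (fun z => g z - 1) by apply: holoB; [|exact: holo_cst].
have uh k : holo (mono f g q k) by exact: mono_holo.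
have Wh : holo (wronskian_mono f g q M).
  by apply: wronskian_holo => i; apply: holoB; [exact: uh|exact: holo_cst].
pose mu := gcd_mult (fun z => f z - 1) (fun z => g z - 1).
have Wd a : exists h, holo h /\
    forall w, wronskian_mono f g q M w = (w - a) ^+ (M * mu a) * h w.
  apply: wronskian_div => i; apply: mono_sub1_div => //.
    exact: (gcd_mult_factor (fun z => g z - 1) a f1h).
  by rewrite /mu gcd_multC; exact: (gcd_mult_factor (fun z => f z - 1) a g1h).
(* The multiplicity at 0 is passed separately, as it enters [N_gcd] through the term in ln r. *)
have [c H] := jensen_counting (fun a => (M * mu a)%N) Wh W0 (Wd 0).
exists (- c) => r r1 Wr; have r0 : 0 < r by apply: lt_le_trans r1.
have [s [su s0 ->]] := N_gcd_sum (fun z => g z - 1) f1h f1 r0.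
have := H s r r1 su s0 (fun a _ => Wd a) Wr.
rewrite -/mu lerBrDr => le; apply: le_trans le.
rewrite mulrDr mulr_sumr mulrA -natrM [leLHS]addrC addrA lerD2r lerD2l.
by apply: ler_sum => a _; rewrite natrM mulrA.
Qed.

Lemma N_gcd_le_T f g (q M : nat) : holo f -> holo g ->
  (forall z, f z != 0) -> (forall z, g z != 0) -> (0 < M)%N -> (M < q.+1 * q.+1)%N ->
  (exists w, f w - 1 != 0) ->
  (exists w, wronskian_mono f g q M w != 0) ->
  exists c, forall r b, 1 <= r ->
    (forall z, normc z = r -> wronskian_mono f g q M z != 0) ->
    0 <= b ->
    (forall (i : 'I_M) (k : nat) z, (k <= M)%N -> normc z = r ->
      normc (iter k (@D R) (mono f g q i.+1) z) <= expR b * normc (mono f g q i.+1 z)) ->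
    M%:R * N_gcd (fun z => f z - 1) (fun z => g z - 1) r <=
      M%:R * b + q%:R * (Tc f r + Tc g r) + c.
Proof.
move=> fh gh f0 g0 M0 Mq f1 W0; have [c H] := N_gcd_le_mean fh gh f1 W0.
have uh k : holo (mono f g q k) by exact: mono_holo.
have u0 k z : mono f g q k z != 0 by exact: mono_neq0.
exists (c + ln (2 * M`!%:R) - q%:R * (lnc (f 0) + lnc (g 0))
  + \sum_(i < M) lnc (mono f g q i.+1 0)) => r b r1 Wr b0 ub.
have r0 : 0 < r by apply: lt_le_trans r1.
apply: le_trans (H r r1 Wr) _.
have Wh : holo (wronskian_mono f g q M).
  by apply: wronskian_holo => i; apply: holoB; [exact: uh|exact: holo_cst].
have [fc fm] := mean_lnminus fh f0 r0; have [gc gm] := mean_lnminus gh g0 r0.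
have lc : continuous (fun t => lnminus f r t + lnminus g r t).
  exact: continuous_addR fc gc.
have qc : continuous (fun t => q%:R * (lnminus f r t + lnminus g r t)).
  exact: continuous_mulR (@continuous_cstR R _) lc.
have [sc sm] := mean_sum (index_enum 'I_M)
  (fun i : 'I_M => unit_lnc_cont (uh i.+1) (u0 i.+1) (r := r)).
have kc : continuous (fun _ : R => ln (2 * M`!%:R) + M%:R * b) by exact: continuous_cstR.
have kqc : continuous (fun t => ln (2 * M`!%:R) + M%:R * b + q%:R * (lnminus f r t + lnminus g r t)).
  exact: continuous_addR kc qc.
have ac : continuous (fun t => ln (2 * M`!%:R) + M%:R * b
    + q%:R * (lnminus f r t + lnminus g r t) + \sum_(i < M) lnc (mono f g q i.+1 (circ r t))).
  exact: continuous_addR kqc sc.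
have le := ler_mean (lnc_circ_cont Wh (ltW r0) Wr) ac
  (fun t => wronskian_mono_bound fh gh f0 g0 M0 Mq b0 (ltW r0) ub (Wr _ (normc_circ t (ltW r0)))).
apply: le_trans (lerD le (lexx c)) _.
rewrite (meanD kqc sc) (meanD kc qc) mean_cst (meanZ _ lc) (meanD fc gc) fm gm sm.
(* The product of the columns costs only a constant, because the monomials are zero-free; no
   characteristic enters here. *)
have -> : \sum_(i < M) mean (fun t => lnc (mono f g q i.+1 (circ r t))) =
    \sum_(i < M) lnc (mono f g q i.+1 0).
  by apply: eq_bigr => i _; rewrite mean_lnc_unit.
by apply: eq_ler; ring.
Qed.

Lemma N_gcd_relation f g (i j : int) (c : C) r : holo f -> holo g ->
  (exists w, f w - 1 != 0) -> c != 1 -> (forall z, f z ^ i * g z ^ j = c) -> 0 < r ->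
  N_gcd (fun z => f z - 1) (fun z => g z - 1) r = 0.
Proof.
move=> fh gh f1 c1 H r0.
have f1h : holo (fun z => f z - 1) by apply: holoB; [|exact: holo_cst].
have g1h : holo (fun z => g z - 1) by apply: holoB; [|exact: holo_cst].
have mu0 a : gcd_mult (fun z => f z - 1) (fun z => g z - 1) a = 0%N.
  apply/eqP; rewrite -leqn0 leqNgt; apply/negP => m0.
  have := gcd_mult_zero f1h m0; rewrite gcd_multC in m0.
  move/subr0_eq => fa; have /subr0_eq ga := gcd_mult_zero g1h m0.
  by move/eqP: c1; apply; rewrite -(H a) fa ga !exp1rz mulr1.
have [s [_ _ ->]] := N_gcd_sum (fun z => g z - 1) f1h f1 r0.
by rewrite mu0 mul0r addr0 big1// => a _; rewrite mu0 mul0r.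
Qed.

(** Each of M b, q S and c is at most M (eps / 8) S, the second because p >= 8 / eps; three eighths
    stay below one half. *)
Lemma N_gcd_arith (q p M eps S T b c N : R) : 0 < q -> 0 < p -> M = q * p ->
  0 < eps -> 8 <= eps * p -> 0 <= S -> T <= M * (q * S) ->
  b <= eps / (8 * M * q) * T -> 8 * q * c / eps <= T ->
  M * N <= M * b + q * S + c -> N <= eps / 2 * S.
Proof.
move=> q0 p0 ME e0 pe S0 TS bT cT NS.
have M0 : 0 < M by rewrite ME mulr_gt0.
have e'0 : 0 < eps / (8 * M * q) by rewrite divr_gt0// !mulr_gt0.
have bS : b <= eps / 8 * S.
  apply: le_trans bT _; apply: le_trans (ler_wpM2l (ltW e'0) TS) _.
  by apply: eq_ler; field; rewrite !gt_eqF.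
have qS : q * S <= M * (eps / 8 * S).
  have := ler_wpM2l (mulr_ge0 (ltW q0) S0) pe; rewrite ME; lra.
have cS : c <= M * (eps / 8 * S).
  have := le_trans cT TS; rewrite ler_pdivrMr// => h.
  by rewrite -(ler_pM2l q0); lra.
rewrite -(ler_pM2l M0); apply: le_trans NS _.
have := ler_wpM2l (ltW M0) bS; have := mulr_ge0 (mulr_ge0 (ltW e0) (ltW M0)) S0; lra.
Qed.

Lemma N_gcd_no_relation f g (eps : R) : holo f -> holo g ->
  (forall z, f z != 0) -> (forall z, g z != 0) -> (exists z, f z != f 0) ->
  (forall i j : int, (i, j) != (0, 0) -> ~ exists c, forall z, f z ^ i * g z ^ j = c) ->
  0 < eps ->
  exc (fun r => N_gcd (fun z => f z - 1) (fun z => g z - 1) r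
    <= eps / 2 * (Tc f r + Tc g r)).
Proof.
move=> fh gh f0 g0 [z1 fz1] indep e0.
have f1 : exists w, f w - 1 != 0.
  have [h|h] := eqVneq (f 0) 1; last by exists 0; rewrite subr_eq0.
  by exists z1; rewrite subr_eq0 -h.
(* M = (q + 1)^2 - 1 counts the exponent pairs other than (0, 0), and q > 8 / eps gives q / M = 1 /
   (q + 2) <= eps / 8. *)
pose q := (Num.bound (8 / eps)).+1; pose M := (q * q.+2)%N.
have q0 : 0 < q%:R :> R by rewrite ltr0n.
have M0 : (0 < M)%N by [].
have MR0 : 0 < M%:R :> R by rewrite ltr0n.
have Mq : (M < q.+1 * q.+1)%N by rewrite mulSn [M]mulnS ltn_add2r.
have qe : 8 <= eps * q.+2%:R.
  rewrite mulrC -ler_pdivrMr//; apply: ltW.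
  apply: lt_le_trans (lt_bound _) _.
  by rewrite ler_nat /q; do 3 apply: leqW.
pose v (i : 'I_M) := mono f g q i.+1.
have vh i : holo (v i) by exact: mono_holo.
have v0 i z : v i z != 0 by exact: mono_neq0.
(* Index 0 of [v] stands for the exponents (1, 0), as q >= 1, so it is [f] itself. *)
have vnc : exists i z, v i z != v i 0.
  exists (Ordinal M0), z1; rewrite /v /mono /= modn_small// divn_small//.
  by rewrite !expr0 !mulr1 !expr1.
have W0 := wronskian_mono_neq0 q M fh gh f0 g0 indep.
have Wh : holo (wronskian_mono f g q M).
  by apply: wronskian_holo => i; apply: holoB; [exact: vh|exact: holo_cst].
have [c H] := N_gcd_le_T fh gh f0 g0 M0 Mq f1 W0.
have e'0 : 0 < eps / (8 * M%:R * q%:R) by rewrite divr_gt0// !mulr_gt0.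
have [r0 large] := Tsum_large vh v0 vnc (8 * q%:R * c / eps).
have TsumE r : Tsum v r <= M%:R * (q%:R * (Tc f r + Tc g r)).
  rewrite [leRHS]mulr_natl -[X in _ *+ X](card_ord M) -sumr_const.
  apply: ler_sum => i _; apply: Tc_mono => //.
  by rewrite -ltnS ltn_divLR//; apply: leq_ltn_trans Mq; exact: ltn_ord.
apply: exc_imp (exc_and (log_derivative_lemma vh v0 vnc M e'0) (exc_and (exc_no_zeros Wh W0)
  (exc_large (P := fun r => 1 <= r /\ 8 * q%:R * c / eps <= Tsum v r) (r0 := Num.max 1 r0) _))).
- move=> r _ [[b /andP[b0 be] ub] [Wr [r1 Tr]]].
  have := H r b r1 Wr b0 ub; set N := N_gcd _ _ r; have := TsumE r.
  set S := Tc f r + Tc g r => TS.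
  have S0 : 0 <= S by apply: addr_ge0; exact: Tc_ge0.
  apply: (@N_gcd_arith q%:R q.+2%:R M%:R eps S (Tsum v r) b c) => //.
  by rewrite -natrM.
- by move=> r; rewrite ge_max => /andP[r1 /large].
Qed.

End gcd_bound.

Theorem corollary1p4 (R : realType) (f g : R[i] -> R[i])
  (f_entire : entire f) (g_entire : entire g)
  (f_nonconst : ~ constant_fun f) (g_nonconst : ~ constant_fun g)
  (f_neq0 : forall z, f z != 0) (g_neq0 : forall z, g z != 0)
  (fg_indep : mult_independent f g)
  (eps : R) (eps_gt0 : 0 < eps) :
  le_exc (N_gcd (fun z => f z - 1) (fun z => g z - 1))
    (fun r => eps * Num.max (characteristic f r) (characteristic g r)).
Proof.
move/entireE: f_entire => fh; move/entireE: g_entire => gh.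
have [z1 fz1] : exists z, f z != f 0.
  apply: contrapT => h; apply: f_nonconst; exists (f 0) => z.
  by apply/eqP/negPn/negP => fz; apply: h; exists z.
have T0 r : 0 <= Tc f r /\ 0 <= Tc g r by split; exact: Tc_ge0.
have [[i [j [ij [c H]]]]|rel] := pselect (exists i j : int,
  (i, j) != (0, 0) /\ exists c, forall z, f z ^ i * g z ^ j = c).
  have c1 : c != 1.
    by apply/eqP => c1; apply: (fg_indep _ _ ij); apply/funext => z; rewrite H.
  have f1 : exists w, f w - 1 != 0.
    have [h|h] := eqVneq (f 0) 1; last by exists 0; rewrite subr_eq0.
    by exists z1; rewrite subr_eq0 -h.
  exists set0; split=> // [|r r0 _]; first by rewrite measure0.
  rewrite (N_gcd_relation fh gh f1 c1 H r0) !characteristicE//.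
  by apply: mulr_ge0; [exact: ltW|rewrite le_max (T0 r).1].
apply: exc_imp (N_gcd_no_relation fh gh f_neq0 g_neq0 _ _ eps_gt0).
- move=> r _ le; apply: le_trans le _; rewrite !characteristicE//.
  (* The sum of the two characteristics is at most twice their maximum, which uses up the factor
     1/2. *)
  rewrite -mulrA ler_wpM2l ?(ltW eps_gt0)// mulrC ler_pdivrMr// mulr_natr mulr2n.
  by apply: lerD; rewrite le_max lexx ?orbT.
- by exists z1.
- by move=> i j ij h; apply: rel; exists i, j.
Qed.
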